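(* Let $H$ be a complex Hilbert space, let $\mathcal{A}\subseteq\mathcal{L}(H)$ be a power algebra with the removable singularity property and put $$\mathcal{D}=\{Z\in G_I(\mathcal{A}): I<Z^*Z\}.$$ Then $h$ is a biholomorphic mapping of $\mathcal{D}$ onto itself if and only if $h=L$ on $\mathcal{D}$, where $L$ is a linear isometry of $\mathcal{A}$ onto itself with $L(I)\in G_I(\mathcal{A})$.
   Context: $\mathcal{L}(H)$ is the Banach space of bounded linear operators on $H$ with the operator norm. A power algebra is a closed complex subspace $\mathcal{A}$ of $\mathcal{L}(H)$ containing the identity operator $I$ on $H$ and the squares of each of its elements. $G_I(\mathcal{A})$ is the connected component containing $I$ of $\{Z\in\mathcal{A}: Z^{-1}\text{ exists}\}$ (inverse in $\mathcal{L}(H)$). $\mathcal{A}_0=\{Z\in\mathcal{A}:\|Z\|<1\}$. A power algebra $\mathcal{A}$ has the removable singularity property if, for any complex Banach space $\mathcal{X}$, every bounded holomorphic function $h:G_I(\mathcal{A})\cap\mathcal{A}_0\to\mathcal{X}$ extends to a holomorphic function on $\mathcal{A}_0$. For self-adjoint operators, $S<T$ means that $T-S$ is positive and invertible (so for $Z\in G_I(\mathcal{A})$, $I<Z^*Z$ is equivalent to $\|Z^{-1}\|<1$). Holomorphic means complex Fréchet differentiable; a biholomorphic mapping is a holomorphic bijection with holomorphic inverse. Linear means complex linear, and isometries are with respect to the operator norm. *)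

(* Defs.v *)
From HB Require Import structures.
From mathcomp Require Import all_boot all_order all_algebra.
From mathcomp Require Import all_classical all_reals.
From mathcomp Require Import topology normedtype sequences derive.
From mathcomp Require Import complex ring.

Set Implicit Arguments.
Unset Strict Implicit.
Unset Printing Implicit Defensive.

Import Order.TTheory GRing.Theory Num.Theory.
Import numFieldNormedType.Exports.

Local Open Scope classical_set_scope.
Local Open Scope complex_scope.
Local Open Scope ring_scope.

(* The inner product is linear in its first argument and conjugate-linear in
   the second; the norm is the one it induces. *)
HB.mixin Record isHilbert (R : realType) T & CompleteNormedModule R[i] T := {
  inner : {dot T for Num.conj};
  innerxx : forall x : T, inner x x = `|x| ^+ 2 }.

#[short(type="hilbertType")]
HB.structure Definition Hilbert (R : realType) :=
  {T of CompleteNormedModule R[i] T & isHilbert R T}.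

Section BoundedOperators.
Variables (R : realType) (V : normedModType R[i]).

Definition is_bop : pred (V -> V) := fun f =>
  `[< linear f /\ exists M : R[i], forall x, `|f x| <= M * `|x| >].

Record bop := Bop { bop_fun :> V -> V; bop_funP : is_bop bop_fun }.

HB.instance Definition _ := [isSub for bop_fun].
HB.instance Definition _ := [Choice of bop by <:].

Lemma is_bop_submod : submod_closed is_bop.
Proof.
split.
  apply/asboolP; split; first by move=> a x y; rewrite /= scaler0 addr0.
  by exists 0 => x; rewrite mul0r normr0.
move=> a f g /asboolP[lf [M hM]] /asboolP[lg [N hN]]; apply/asboolP; split.
  move=> b x y; rewrite !fctE lf lg !scalerDr !scalerA (mulrC a b).
  by rewrite !addrA; congr (_ + _); rewrite -!addrA; congr (_ + _); rewrite addrC.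
exists (`|a| * M + N) => x.
rewrite (le_trans (ler_normD _ _))// mulrDl lerD//.
by rewrite normrZ -mulrA ler_wpM2l.
Qed.
HB.instance Definition _ := GRing.isSubmodClosed.Build R[i] (V -> V) is_bop
  is_bop_submod.
HB.instance Definition _ := [SubChoice_isSubLmodule of bop by <:].

Lemma bop_linear (Z : bop) : linear Z.
Proof. by case: Z => f /= /asboolP[]. Qed.
HB.instance Definition _ (Z : bop) :=
  GRing.isLinear.Build R[i] V V _ (bop_fun Z) (bop_linear Z).

(* Norms of a normedModType R[i] take values in R[i]; they are real, so nothing
   is lost by taking real parts to form the supremum. *)
Definition opnorm (Z : bop) : R :=
  sup [set complex.Re `|Z x| | x in [set x : V | `|x| <= 1]].

Lemma norm_realE (x : V) : `|x| = (complex.Re `|x|)%:C.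
Proof. by rewrite RRe_real// ger0_real. Qed.

Lemma bop_bounded (Z : bop) : exists2 M : R, 0 <= M &
  forall x, `|Z x| <= M%:C * `|x|.
Proof.
case: Z => f /= /asboolP[_ [M hM]].
have Mr : (complex.Re `|M|)%:C = `|M| by rewrite RRe_real// ger0_real.
exists (complex.Re `|M|); first by rewrite -ler0c Mr.
move=> x; rewrite Mr.
have [x0|x0] := eqVneq `|x| 0.
  by rewrite x0 mulr0 (le_trans (hM x))// x0 mulr0.
rewrite (le_trans (hM x))// ler_wpM2r// real_ler_norm//.
have h := ger0_real (le_trans (normr_ge0 _) (hM x)).
have -> : M = M * `|x| * `|x|^-1 by rewrite mulfK.
by rewrite rpredM ?rpredV ?normr_real.
Qed.

Lemma opnorm_has_sup (Z : bop) :
  has_sup [set complex.Re `|Z x| | x in [set x : V | `|x| <= 1]].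
Proof.
split; first by exists (complex.Re `|Z 0|), 0 => //=; rewrite normr0.
have [M M0 hM] := bop_bounded Z; exists M => _ [x /= x1 <-].
rewrite -lecR -norm_realE (le_trans (hM x))// -[leRHS]mulr1.
by rewrite ler_wpM2l// ler0c.
Qed.

Lemma opnorm_ge0 (Z : bop) : 0 <= opnorm Z.
Proof.
rewrite (@le_trans _ _ (complex.Re `|Z 0|))//.
  by rewrite -ler0c -norm_realE.
by apply: (sup_upper_bound (opnorm_has_sup Z)); exists 0 => //=; rewrite normr0.
Qed.

Lemma opnorm_le (Z : bop) (x : V) : `|Z x| <= (opnorm Z)%:C * `|x|.
Proof.
have [->|x0] := eqVneq x 0; first by rewrite linear0 !normr0 mulr0.
have nx0 : 0 < `|x| by rewrite normr_gt0.
rewrite -ler_pdivrMr// mulrC.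
rewrite -[`|x|^-1]ger0_norm ?invr_ge0// -normrZ -linearZ/=.
rewrite [leLHS]norm_realE lecR; apply: (sup_upper_bound (opnorm_has_sup Z)).
exists (`|x|^-1 *: x) => //=.
by rewrite normrZ normfV normr_id mulVf// gt_eqF.
Qed.

Lemma opnorm_lub (Z : bop) (M : R) : 0 <= M ->
  (forall x, `|Z x| <= M%:C * `|x|) -> opnorm Z <= M.
Proof.
move=> M0 hM; apply: ge_sup; first by case: (opnorm_has_sup Z).
move=> _ [x /= x1 <-].
rewrite -lecR -norm_realE (le_trans (hM x))// -[leRHS]mulr1.
by rewrite ler_wpM2l// ler0c.
Qed.

Let bop_norm (Z : bop) : R[i] := (opnorm Z)%:C.

Let ler_bop_normD (Z W : bop) : bop_norm (Z + W) <= bop_norm Z + bop_norm W.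
Proof.
rewrite /bop_norm -rmorphD lecR; apply: opnorm_lub.
  by rewrite addr_ge0// opnorm_ge0.
move=> x; rewrite rmorphD/= mulrDl (le_trans (ler_normD _ _))//.
by rewrite lerD// opnorm_le.
Qed.

Let bop_normZ_le (a : R[i]) (Z : bop) : bop_norm (a *: Z) <= `|a| * bop_norm Z.
Proof.
have [r r0 ar] : exists2 r : R, 0 <= r & `|a| = r%:C.
  have ar : (complex.Re `|a|)%:C = `|a| by rewrite RRe_real// ger0_real.
  by exists (complex.Re `|a|); rewrite // -ler0c ar.
rewrite ar /bop_norm -rmorphM lecR; apply: opnorm_lub.
  by rewrite mulr_ge0 ?opnorm_ge0.
move=> x.
have -> : (r * opnorm Z)%:C = `|a| * (opnorm Z)%:C by rewrite ar -rmorphM.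
rewrite -mulrA.
by rewrite [X in `|X| <= _](_ : _ = a *: Z x)// normrZ ler_wpM2l// opnorm_le.
Qed.

Let bop_normZ (a : R[i]) (Z : bop) : bop_norm (a *: Z) = `|a| * bop_norm Z.
Proof.
apply/eqP; rewrite eq_le bop_normZ_le/=.
have [->|a0] := eqVneq a 0.
  by rewrite normr0 mul0r ler0c opnorm_ge0.
have := bop_normZ_le a^-1 (a *: Z).
rewrite scalerA mulVf// scale1r normfV.
by rewrite [_^-1 * _]mulrC ler_pdivlMr ?normr_gt0// mulrC.
Qed.

Let bop_norm0 (Z : bop) : bop_norm Z = 0 -> Z = 0.
Proof.
move=> Z0; apply/val_inj/funext => x /=.
by have := opnorm_le Z x; rewrite [(_)%:C]Z0 mul0r normr_le0 => /eqP.
Qed.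

HB.instance Definition _ :=
  Lmodule_isNormed.Build R[i] bop ler_bop_normD bop_normZ bop_norm0.

Lemma bop_normE (Z : bop) : `|Z| = (opnorm Z)%:C.
Proof. by []. Qed.

Fact id_is_bop : is_bop (@id V).
Proof. by apply/asboolP; split=> //; exists 1 => x; rewrite mul1r. Qed.

Fact comp_is_bop (Z W : bop) : is_bop (Z \o W).
Proof.
apply/asboolP; split; first by move=> a x y /=; rewrite !linearP.
exists ((opnorm Z)%:C * (opnorm W)%:C) => x /=.
rewrite (le_trans (opnorm_le _ _))// -mulrA ler_wpM2l//.
  by rewrite ler0c opnorm_ge0.
exact: opnorm_le.
Qed.

Let bop1 := Bop id_is_bop.
Let bop_mul (Z W : bop) := Bop (comp_is_bop Z W).
Let bop_mulA : associative bop_mul. Proof. by move=> X Y Z; exact/val_inj. Qed.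
Let bop_mul1l : left_id bop1 bop_mul. Proof. by move=> X; exact/val_inj. Qed.
Let bop_mul1r : right_id bop1 bop_mul. Proof. by move=> X; exact/val_inj. Qed.
Let bop_mulDl : left_distributive bop_mul +%R.
Proof. by move=> X Y Z; exact/val_inj. Qed.
Let bop_mulDr : right_distributive bop_mul +%R.
Proof.
by move=> X Y Z; apply/val_inj/funext => x /=; rewrite !fctE raddfD.
Qed.
HB.instance Definition _ := GRing.Zmodule_isPzRing.Build bop
  bop_mulA bop_mul1l bop_mul1r bop_mulDl bop_mulDr.

Lemma bop1E (x : V) : (1 : bop) x = x. Proof. by []. Qed.
Lemma bopME (Z W : bop) (x : V) : (Z * W) x = Z (W x). Proof. by []. Qed.

End BoundedOperators.

Section Adjoint.
Variables (R : realType) (H : hilbertType R).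
Implicit Types x y z : H.

Local Notation "''[' x , y ]" := (inner x y).

Lemma innerC x y : '[x, y] = ('[y, x])^*%R.
Proof. by rewrite (hermC (inner : {dot H for Num.conj})) expr0 mul1r. Qed.

Let norm_proj x y : y != 0 ->
  `|x - ('[x, y] / `|y| ^+ 2) *: y| ^+ 2 =
  `|x| ^+ 2 - `| '[x, y] | ^+ 2 / `|y| ^+ 2.
Proof.
move=> y0; have n0 : `|y| ^+ 2 != 0 by rewrite expf_neq0// normr_eq0.
rewrite -[LHS]innerxx dnormB dnormZ linearZr_LR/= !innerxx.
have nr : (`|y| ^+ 2)^-1 \is Num.real by rewrite rpredV rpredX// normr_real.
have -> : (('[x, y] / `|y| ^+ 2)^*)%R * '[x, y] = `| '[x, y] | ^+ 2 / `|y| ^+ 2.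
  by rewrite rmorphM/= (CrealP nr) mulrAC -normCKC.
have -> : ((`| '[x, y] | ^+ 2 / `|y| ^+ 2)^*)%R = `| '[x, y] | ^+ 2 / `|y| ^+ 2.
  by apply/CrealP; rewrite rpredM// rpredX// normr_real.
rewrite normrM exprMn [`| (_)^-1 |]ger0_norm ?invr_ge0 ?exprn_ge0//.
by move: (`|y| ^+ 2) (`|x| ^+ 2) (`| _ | ^+ 2) n0 => n a b n0; field.
Qed.

Lemma inner_CauchySchwarz x y : `| '[x, y] | <= `|x| * `|y|.
Proof.
have [->|y0] := eqVneq y 0; first by rewrite linear0r !normr0 mulr0.
have y20 : 0 < `|y| ^+ 2 by rewrite exprn_gt0// normr_gt0.
rewrite -ler_sqr ?nnegrE ?mulr_ge0// exprMn -ler_pdivrMr// -subr_ge0.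
by rewrite -norm_proj// exprn_ge0.
Qed.

Let eps_eq0 (c : R) (a : R[i]) :
  (forall e : R, 0 < e -> `|a| <= (c * e)%:C) -> a = 0.
Proof.
move=> h; apply/eqP; rewrite -normr_eq0 eq_le normr_ge0 andbT.
have ar : `|a| = (complex.Re `|a|)%:C by rewrite RRe_real// ger0_real.
rewrite ar lecR; apply/ler_addgt0Pl => e e0; rewrite addr0.
have c0 : 0 < `|c| + 1 by rewrite ltr_wpDl.
have := h (e / (`|c| + 1)) (divr_gt0 e0 c0).
rewrite ar lecR => /le_trans; apply.
rewrite mulrCA ler_piMr//; first exact: ltW.
by rewrite ler_pdivrMr// mul1r ler_wpDr// ler_norm.
Qed.

Let parallelogram x y :
  `|x - y| ^+ 2 = 2 * `|x| ^+ 2 + 2 * `|y| ^+ 2 - `|x + y| ^+ 2.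
Proof. by rewrite -!innerxx dnormB dnormD; ring. Qed.

Let Re_sq x : (complex.Re `|x| ^+ 2)%:C = `|x| ^+ 2.
Proof. by rewrite rmorphXn/= RRe_real// ger0_real. Qed.

Theorem Riesz (phi : H -> R[i]) (M : R) :
  (forall a x y, phi (a *: x + y) = a * phi x + phi y) ->
  (forall x, `|phi x| <= M%:C * `|x|) ->
  exists w, forall x, phi x = '[x, w].
Proof.
move=> phiP phiM.
have phi0 : phi 0 = 0.
  have := phiP 1 0 0; rewrite scaler0 addr0 mul1r => /eqP.
  by rewrite -subr_eq subrr => /eqP <-.
have phiZ a x : phi (a *: x) = a * phi x by have := phiP a x 0; rewrite phi0 !addr0.
have phiD x y : phi (x + y) = phi x + phi y.
  by have := phiP 1 x y; rewrite scale1r mul1r.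
have phiN x : phi (- x) = - phi x by rewrite -scaleN1r phiZ mulN1r.
have [[x1 x1P]|nz] := pselect (exists x, phi x != 0); last first.
  exists 0 => x; rewrite linear0r; apply/eqP/negP => h.
  by apply: nz; exists x; exact/negP.
pose S := [set complex.Re `|x| ^+ 2 | x in [set x | phi x = 1]].
have S0 : S !=set0.
  exists (complex.Re `|(phi x1)^-1 *: x1| ^+ 2); exists ((phi x1)^-1 *: x1) => //=.
  by rewrite phiZ mulVf.
have infS : has_inf S.
  by split=> //; exists 0 => _ [x _ <-]; exact: sqr_ge0.
pose d := inf S.
have dP x : phi x = 1 -> d%:C <= `|x| ^+ 2.
  by move=> x1'; rewrite -Re_sq lecR; apply: (ge_inf infS.2); exists x.
have uex (n : nat) : exists x, phi x = 1 /\ `|x| ^+ 2 <= (d + n.+1%:R^-1)%:C.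
  have n0 : (0 : R) < n.+1%:R^-1 by rewrite invr_gt0.
  have [_ [x xK <-] h] := inf_adherent n0 infS.
  by exists x; split=> //; rewrite -Re_sq lecR ltW.
have [u uP] := choice uex.
have uu (n m : nat) : (n <= m)%N ->
    `|u n - u m| ^+ 2 <= (4 * n.+1%:R^-1)%:C.
  move=> nm; rewrite parallelogram lerBlDr.
  have h2 : 4 * d%:C <= `|u n + u m| ^+ 2.
    have /dP : phi (2^-1 *: (u n + u m)) = 1.
      rewrite phiZ phiD !(uP _).1.
      by rewrite (_ : 1 + 1 = 2) ?mulVf ?pnatr_eq0.
    rewrite normrZ exprMn normfV ger0_norm// => /(@ler_wpM2l _ 4) -/(_ (ler0n _ _)).
    by rewrite mulrA (_ : 4 * 2^-1 ^+ 2 = 1) ?mul1r//; field.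
  have hn := (uP n).2.
  have hm : `|u m| ^+ 2 <= (d + n.+1%:R^-1)%:C.
    apply: le_trans (uP m).2 _.
    by rewrite lecR lerD2l lef_pV2 ?posrE// ler_nat.
  move: hn hm; rewrite rmorphD [(4 * _)%:C]rmorphM rmorph_nat /=.
  move: (d%:C) (n.+1%:R^-1%:C) h2 => a b h2 hn hm.
  apply: le_trans (lerD (ler_wpM2l (ler0n _ 2) hn) (ler_wpM2l (ler0n _ 2) hm)) _.
  apply: le_trans (lerD (lexx _) h2).
  by rewrite le_eqVlt; apply/orP; left; apply/eqP; ring.
have cu : cvg (u @ \oo).
  apply: cauchy_cvg; apply: cauchy_exP => e e0.
  have er : (complex.Re e)%:C = e by rewrite RRe_real// gtr0_real.
  have re0 : 0 < complex.Re e by rewrite -ltcR er.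
  pose N := Num.bound (4 / complex.Re e ^+ 2).
  exists (u N); exists N => // m /= Nm.
  rewrite -ball_normE /= -(@ltr_pXn2r _ 2)// ?nnegrE// ?ltW//.
  apply: le_lt_trans (uu _ _ Nm) _.
  rewrite -er -rmorphXn ltcR ltr_pdivrMr// mulrC -ltr_pdivrMr ?exprn_gt0//.
  apply: lt_trans (archi_boundP _) _; last by rewrite ltr_nat.
  by rewrite divr_ge0// exprn_ge0// ltW.
pose y := lim (u @ \oo).
have yP (e : R) : 0 < e ->
    exists k, [/\ phi k = 1, `|y - k| <= e%:C & `|k| ^+ 2 <= (d + e ^+ 2)%:C].
  move=> e0.
  have /cvgrPdist_lt /(_ e%:C) := cu.
  rewrite ltcR => /(_ e0) [N _ hN].
  pose N' := Num.bound (e ^- 2).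
  exists (u (maxn N N')); split; first exact: (uP _).1.
    by apply/ltW/hN; rewrite /= leq_maxl.
  apply: le_trans (uP _).2 _; rewrite lecR lerD2l.
  rewrite invf_ple ?posrE ?exprn_gt0//.
  apply: le_trans (ltW (archi_boundP _)) _.
    by rewrite invr_ge0 exprn_ge0// ltW.
  by rewrite ler_nat leqW// leq_maxr.
have y1 : phi y = 1.
  apply/eqP; rewrite -subr_eq0; apply/eqP/(@eps_eq0 `|M|) => e /yP[k [k1 yk _]].
  rewrite -k1 -phiN -phiD (le_trans (phiM _))//.
  rewrite (@le_trans _ _ (`|M|%:C * `|y - k|))//.
    by rewrite ler_wpM2r// lecR ler_norm.
  by rewrite rmorphM ler_wpM2l// ler0c.
have yker z : phi z = 0 -> '[y, z] = 0.
  move=> z0; have [->|nz] := eqVneq z 0; first by rewrite linear0r.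
  apply/(@eps_eq0 (2 * complex.Re `|z|)) => e e0.
  have [k [k1 yk kd]] := yP _ e0.
  have zz : (complex.Re `|z|)%:C = `|z| by rewrite RRe_real// ger0_real.
  have -> : y = (y - k) + k by rewrite subrK.
  rewrite linearDl (le_trans (ler_normD _ _))//.
  have -> : (2 * complex.Re `|z| * e)%:C = e%:C * `|z| + e%:C * `|z|.
    by rewrite !rmorphM/= zz rmorph_nat; ring.
  apply: lerD.
    by rewrite (le_trans (inner_CauchySchwarz _ _))// ler_wpM2r.
  have z20 : 0 < `|z| ^+ 2 by rewrite exprn_gt0// normr_gt0.
  have ec0 : 0 <= e%:C by rewrite ler0c ltW.
  rewrite -ler_sqr ?nnegrE ?mulr_ge0// exprMn -ler_pdivrMr//.
  have : d%:C <= `|k - ('[k, z] / `|z| ^+ 2) *: z| ^+ 2.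
    by apply: dP; rewrite phiD phiN phiZ z0 mulr0 oppr0 addr0.
  rewrite norm_proj// lerBrDr -lerBrDl => /le_trans; apply.
  by rewrite lerBlDl -rmorphXn -rmorphD.
have ny : y != 0 by apply/eqP => y0; move: y1; rewrite y0 phi0 => /eqP; rewrite eq_sym oner_eq0.
have ny2 : `|y| ^+ 2 != 0 by rewrite expf_neq0// normr_eq0.
exists ((`|y| ^+ 2)^-1 *: y) => x.
have nr : (`|y| ^+ 2)^-1 \is Num.real by rewrite rpredV rpredX// normr_real.
rewrite linearZr_LR/= (CrealP nr).
have : '[y, x - phi x *: y] = 0.
  by apply: yker; rewrite phiD phiN phiZ y1 mulr1 subrr.
rewrite innerC => /eqP; rewrite conjC_eq0 => /eqP.
rewrite linearBl linearZl_LR/= innerxx => /eqP; rewrite subr_eq0 => /eqP ->.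
by rewrite mulrC mulfK.
Qed.

Theorem adjoint_exists (Z : bop H) :
  exists W : bop H, forall x y, '[Z x, y] = '[x, W y].
Proof.
have ex y : exists w, forall x, '[Z x, y] = '[x, w].
  apply: (@Riesz _ (opnorm Z * complex.Re `|y|)).
    by move=> a u v; rewrite linearP linearPl.
  move=> x; rewrite (le_trans (inner_CauchySchwarz _ _))//.
  have -> : (opnorm Z * complex.Re `|y|)%:C = (opnorm Z)%:C * `|y|.
    by rewrite [in RHS]norm_realE -rmorphM.
  rewrite mulrAC ler_wpM2r//.
  exact: opnorm_le.
have [W WP] := choice ex.
have inj u v : (forall x, '[x, u] = '[x, v]) -> u = v.
  move=> h; apply/eqP; rewrite -subr_eq0 -(dnorm_eq0 (inner : {dot H for Num.conj})).
  by rewrite linearBr/= h subrr.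
have Wb : is_bop W.
  apply/asboolP; split.
    move=> a u v; apply: inj => x.
    by rewrite -WP linearPr/= !WP linearPr.
  exists (opnorm Z)%:C => y.
  have [->|W0] := eqVneq (W y) 0.
    by rewrite normr0 mulr_ge0// ler0c opnorm_ge0.
  have nW : 0 < `|W y| by rewrite normr_gt0.
  rewrite -(ler_pM2r nW) -expr2 -innerxx -WP.
  rewrite (le_trans (real_ler_norm _))//.
    by rewrite WP innerxx rpredX// normr_real.
  rewrite (le_trans (inner_CauchySchwarz _ _))// mulrAC ler_wpM2r//.
  exact: opnorm_le.
by exists (Bop Wb) => x y; exact: WP.
Qed.

Definition adjoint (Z : bop H) : bop H := sval (cid (adjoint_exists Z)).

Lemma adjointP (Z : bop H) x y : '[Z x, y] = '[x, adjoint Z y].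
Proof. exact: (svalP (cid (adjoint_exists Z))). Qed.

Definition op_positive (T : bop H) := forall x, 0 <= '[T x, x].

Definition op_invertible (Z : bop H) := exists W : bop H, W * Z = 1 /\ Z * W = 1.

(* Only meant for self-adjoint S and T. *)
Definition op_lt (S T : bop H) := op_positive (T - S) /\ op_invertible (T - S).

End Adjoint.

Section PowerAlgebra.
Variables (R : realType) (H : hilbertType R).

Definition power_algebra (A : set (bop H)) : Prop :=
  [/\ (A 0 /\ forall (a : R[i]) (Z W : bop H), A Z -> A W -> A (a *: Z + W)),
      closed A,
      A 1
    & forall Z, A Z -> A (Z ^+ 2)].

Record powerAlgebra := PowerAlgebra {
  pa_set : set (bop H);
  pa_setP : power_algebra pa_set }.

Variable A : powerAlgebra.

Record pa_elt := PaElt { pa_val :> bop H; pa_valP : pa_val \in pa_set A }.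

HB.instance Definition _ := [isSub for pa_val].
HB.instance Definition _ := [Choice of pa_elt by <:].

Fact pa_submod : submod_closed (mem (pa_set A)).
Proof.
have [[A0 AD] _ _ _] := pa_setP A.
split=> [|a Z W]; first exact/mem_set.
by move=> /set_mem ZA /set_mem WA; exact/mem_set/AD.
Qed.
HB.instance Definition _ :=
  GRing.SubChoice_isSubLmodule.Build R[i] (bop H) _ pa_elt pa_submod.

Let pa_norm (Z : pa_elt) : R[i] := `|pa_val Z|.
Let ler_pa_normD (Z W : pa_elt) : pa_norm (Z + W) <= pa_norm Z + pa_norm W.
Proof. exact: ler_normD. Qed.
Let pa_normZ (a : R[i]) (Z : pa_elt) : pa_norm (a *: Z) = `|a| * pa_norm Z.
Proof. exact: normrZ. Qed.
Let pa_norm0 (Z : pa_elt) : pa_norm Z = 0 -> Z = 0.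
Proof. by move=> Z0; apply/val_inj/normr0_eq0. Qed.
HB.instance Definition _ :=
  Lmodule_isNormed.Build R[i] pa_elt ler_pa_normD pa_normZ pa_norm0.

Lemma pa_normE (Z : pa_elt) : `|Z| = `|pa_val Z|. Proof. by []. Qed.

Fact pa_one_subproof : (1 : bop H) \in pa_set A.
Proof. by have [_ _ A1 _] := pa_setP A; exact/mem_set. Qed.
Definition pa_one : pa_elt := PaElt pa_one_subproof.

(* The topology on A is that of the operator norm; Z ranges over A but its
   inverse is only required to lie in bop H. *)
Definition GI : set pa_elt :=
  connected_component [set Z : pa_elt | op_invertible Z] pa_one.

Definition open_unit_ball : set pa_elt := [set Z | `|Z| < 1].

End PowerAlgebra.
Arguments pa_one {R H} A.
Arguments GI {R H} A _.
Arguments open_unit_ball {R H} A _.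
Coercion pa_elt : powerAlgebra >-> Sortclass.

(* Frechet differentiability over the scalar field R[i]; U is meant to be open,
   so that the values of f outside U are irrelevant. *)
Definition holomorphic_on (R : realType) (V W : normedModType R[i])
  (U : set V) (f : V -> W) := forall x, U x -> differentiable f x.

Definition biholomorphic (R : realType) (V W : normedModType R[i])
    (D : set V) (E : set W) (h : V -> W) :=
  [/\ holomorphic_on D h, set_bij D E h &
      exists2 g : W -> V, holomorphic_on E g & forall x, D x -> g (h x) = x].

Definition removable_singularity_property (R : realType) (H : hilbertType R)
    (A : powerAlgebra H) :=
  forall (X : completeNormedModType R[i]) (h : A -> X),
    holomorphic_on (GI A `&` open_unit_ball A) h ->
    [bounded h Z | Z in GI A `&` open_unit_ball A] ->
    exists2 g : A -> X, holomorphic_on (open_unit_ball A) g &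
      forall Z, (GI A `&` open_unit_ball A) Z -> g Z = h Z.

Definition domainD (R : realType) (H : hilbertType R) (A : powerAlgebra H) : set A :=
  [set Z : A | GI A Z /\ op_lt 1 (adjoint Z * Z)].
Arguments domainD {R H} A _.

(* Main.v *)
Require Import Defs.
From HB Require Import structures.
From mathcomp Require Import all_boot all_order all_algebra.
From mathcomp Require Import all_classical all_reals.
From mathcomp Require Import topology normedtype sequences landau derive.
From mathcomp Require Import exp trigo.
From mathcomp Require Import complex ring lra.

Set Implicit Arguments.
Unset Strict Implicit.
Unset Printing Implicit Defensive.

Import Order.TTheory GRing.Theory Num.Theory.
Import numFieldNormedType.Exports.

Local Open Scope classical_set_scope.
Local Open Scope complex_scope.
Local Open Scope ring_scope.

(** Inversion turns the domain into a ball with a thin set removed.  For [Z] in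
    [GI A] the condition [1 < Z^* Z] says that the inverse of [Z] has norm less
    than one ([op_lt1P]).  A power algebra is closed under the product [X Y X],
    so that Neumann's series stays inside it, and it contains the inverses of
    the elements of [GI A] ([GI_has_inverse]).  Hence inversion is holomorphic
    on [GI A] and exchanges [domainD A] with the set [ballB A] of the elements
    of [GI A] of norm less than one.

    Necessity.  Conjugating a biholomorphic map [h] of the domain by inversion
    gives a bounded holomorphic map of [ballB A] onto itself.  It extends to the
    whole open unit ball because singularities are removable; its values have
    norm at most one, since a larger value could be used to build a bounded
    function without extension ([extend_bound]), and less than one by a maximum
    principle ([strong_max]).  Treating the inverse of [h] in the same way, one
    gets mutually inverse automorphisms [f] and [g] of the open unit ball that
    preserve [GI A] ([biholomorphic_ball_auto]).

    The main point is that [f] fixes the origin.  Let [v = g'(f 0) (f 0)] be the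
    velocity at the origin of the dilations transported by [f] ([drift]).
    Dilations preserve [GI A] and its complement, [f] and [g] do so as well, and
    a blow-up at the origin shows that [GI A] is invariant under the
    translations by multiples of [v] ([GI_drift]).  Next, the adjoint of [v]
    lies in the algebra: for a number [xi] of modulus one that is close to [1],
    the Taylor coefficients of the contractions [l |-> g (xi f (l I))] are
    compared with those of [l |-> l I], and positivity shows that the adjoint of
    the constant one is close to minus the quadratic one ([drift_adjoint_in]).
    Consequently [1 + a v + b v^*] is invertible for all scalars [a] and [b].  A
    self-adjoint operator whose real multiples can all be added to [1] without
    losing invertibility is zero ([selfadjoint_eq0]); so the real and imaginary
    parts of [v] vanish, and [f 0], the image of [v] under [f'(0)], is zero.
    By Cartan's uniqueness theorem [f] is then the restriction of a linear
    isometry ([auto_fix0_linear]).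

    It remains to invert once more, and this is a fact about isometries that
    also gives sufficiency.  Let [L] be a linear isometry of the algebra onto
    itself with [u = L I] in [GI A].  Because the identity is an extreme point
    of the unit ball, [u] is unitary ([isometry_unitary]).  Cartan's theorem
    shows that [L] carries the Moebius transformations that move the origin
    along [I] to those that move it along [u] ([isometry_mob]); expanding in the
    parameter, [L (Z Z) = L Z u^-1 L Z], so that [u^-1 L] is a unital Jordan
    homomorphism.  Invertibility can be expressed by Jordan products
    ([inverse_iff]); hence the inverse of [L Z] is [u^-1 L(Z^-1) u^-1]
    ([isometry_pinv]).  For the isometry obtained from [f] this says that [h] is
    [Z |-> u^-1 L(Z) u^-1], a linear isometry; for a given [L] it says that [L]
    preserves [GI A] and the norms of inverses, and therefore the domain
    ([isometry_domainD]).

    The analysis rests on functions of one complex variable with values in a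
    Banach space.  Averages over dyadic points replace integrals: Goursat's
    argument shows that the averages of a holomorphic function over two
    concentric circles have the same limit, Cauchy's formula follows, and
    expanding its kernel gives Taylor expansions with sharp bounds
    ([taylor_disc]).  The Cauchy estimates, the identity theorem
    ([ball_identity]), Cartan's theorem ([cartan]) and the positivity argument
    are all read off from these bounds. *)

(** * Norms as real numbers *)

Section Mag.
Variable R : realType.

(** The norm of a complex normed space takes values in [R[i]]; its real part
    is used so that estimates are inequalities between reals. *)
Definition mag (V : normedZmodType R[i]) (x : V) : R := complex.Re `|x|.

Lemma magE (V : normedZmodType R[i]) (x : V) : `|x| = (mag x)%:C.
Proof. by rewrite /mag RRe_real// ger0_real. Qed.

Lemma mag_ge0 (V : normedZmodType R[i]) (x : V) : 0 <= mag x.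
Proof. by rewrite -ler0c -magE. Qed.

Lemma mag0 (V : normedZmodType R[i]) : mag (0 : V) = 0.
Proof. by rewrite /mag normr0. Qed.

Lemma mag_eq0 (V : normedZmodType R[i]) (x : V) : (mag x == 0) = (x == 0).
Proof. by rewrite -(inj_eq (@complexI R)) -magE normr_eq0. Qed.

Lemma mag0_eq (V : normedZmodType R[i]) (x : V) : mag x = 0 -> x = 0.
Proof. by move/eqP; rewrite mag_eq0 => /eqP. Qed.

Lemma mag_gt0 (V : normedZmodType R[i]) (x : V) : (0 < mag x) = (x != 0).
Proof. by rewrite lt_def mag_ge0 andbT mag_eq0. Qed.

Lemma magN (V : normedZmodType R[i]) (x : V) : mag (- x) = mag x.
Proof. by rewrite /mag normrN. Qed.

Lemma magB (V : normedZmodType R[i]) (x y : V) : mag (x - y) = mag (y - x).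
Proof. by rewrite -magN opprB. Qed.

Lemma magD (V : normedZmodType R[i]) (x y : V) : mag (x + y) <= mag x + mag y.
Proof. by rewrite -lecR rmorphD /= -!magE ler_normD. Qed.

Lemma magDB (V : normedZmodType R[i]) (x y z : V) :
  mag (x - z) <= mag (x - y) + mag (y - z).
Proof. by apply: le_trans (magD _ _); rewrite addrA subrK. Qed.

Lemma mag_subl (V : normedZmodType R[i]) (x y : V) : mag x - mag y <= mag (x - y).
Proof. by rewrite lerBlDr -{1}(subrK y x) magD. Qed.

Lemma mag_sum (V : normedZmodType R[i]) (I : Type) (r : seq I) (P : pred I)
  (F : I -> V) : mag (\sum_(i <- r | P i) F i) <= \sum_(i <- r | P i) mag (F i).
Proof.
elim/big_ind2: _ => [|x1 x2 y1 y2 h1 h2|//]; first by rewrite mag0.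
exact: le_trans (magD _ _) (lerD h1 h2).
Qed.

Lemma magZ (V : normedModType R[i]) (a : R[i]) (x : V) : mag (a *: x) = mag a * mag x.
Proof. by apply: (@complexI R); rewrite rmorphM /= -!magE normrZ. Qed.

Lemma magM (a b : R[i]) : mag (a * b) = mag a * mag b.
Proof. by apply: (@complexI R); rewrite rmorphM /= -!magE normrM. Qed.

Lemma mag1 : mag (1 : R[i]) = 1. Proof. by rewrite /mag normr1. Qed.

Lemma magX (a : R[i]) n : mag (a ^+ n) = mag a ^+ n.
Proof.
by elim: n => [|n IH]; [rewrite !expr0 mag1|rewrite !exprS magM IH].
Qed.

Lemma magV (a : R[i]) : mag a^-1 = (mag a)^-1.
Proof.
have [->|a0] := eqVneq a 0; first by rewrite invr0 mag0 invr0.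
have ma : mag a != 0 by rewrite mag_eq0.
by apply: (mulfI ma); rewrite -magM !divff// mag1.
Qed.

Lemma magR (r : R) : mag r%:C = `|r|.
Proof. by rewrite -[r%:C]/(r +i* 0) /mag /= expr0n addr0 sqrtr_sqr. Qed.

Lemma mag_nat n : mag (n%:R : R[i]) = n%:R.
Proof. by rewrite -(rmorph_nat (real_complex R)) magR ger0_norm. Qed.

Lemma magi : mag ('i : R[i]) = 1.
Proof. by rewrite -['i]/(0 +i* 1) /mag /= expr0n add0r expr1n sqrtr1. Qed.

Lemma mag_complex (x y : R) : mag (x +i* y) = Num.sqrt (x ^+ 2 + y ^+ 2).
Proof. by []. Qed.

Lemma mag_sqr (z : R[i]) : mag z ^+ 2 = complex.Re z ^+ 2 + complex.Im z ^+ 2.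
Proof. by case: z => x y; rewrite mag_complex sqr_sqrtr// addr_ge0// sqr_ge0. Qed.

Lemma mag_Re (z : R[i]) : `|complex.Re z| <= mag z.
Proof.
by rewrite -ler_sqr ?nnegrE ?mag_ge0// mag_sqr real_normK ?num_real// lerDl sqr_ge0.
Qed.

Lemma mag_Im (z : R[i]) : `|complex.Im z| <= mag z.
Proof.
by rewrite -ler_sqr ?nnegrE ?mag_ge0// mag_sqr real_normK ?num_real// lerDr sqr_ge0.
Qed.

Lemma mag_leD (z : R[i]) : mag z <= `|complex.Re z| + `|complex.Im z|.
Proof.
rewrite -ler_sqr ?nnegrE ?mag_ge0 ?addr_ge0// mag_sqr sqrrD.
rewrite !real_normK ?num_real// -addrA lerD2l lerDr.
by rewrite mulrn_wge0// mulr_ge0.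
Qed.

Lemma complexP2 (z w : R[i]) :
  complex.Re z = complex.Re w -> complex.Im z = complex.Im w -> z = w.
Proof. by case: z => a b; case: w => c d /= -> ->. Qed.

Lemma mag_conj (z : R[i]) : mag (z^*)%C = mag z.
Proof. by case: z => x y; rewrite !mag_complex sqrrN. Qed.

End Mag.

(** * The complex exponential *)

Section Cexp.
Variable R : realType.

Lemma is_derive_eps (f : R -> R) (x df : R) : is_derive x 1 f df ->
  forall e : R, 0 < e -> exists2 d : R, 0 < d &
    forall h, `|h| < d -> `|f (x + h) - f x - h * df| <= e * `|h|.
Proof.
move=> [/derivable_nbhsP /eqaddoP fd <-] e e0.
have /nbhs_norm0P[d /= d0 hd] := fd _ e0.
exists d => // h hh; have := hd h hh.
by rewrite !fctE /= [h%:A]mulr1 opprD addrA [h + x]addrC.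
Qed.

Definition cexp (z : R[i]) : R[i] :=
  (expR (complex.Re z) * cos (complex.Im z))
  +i* (expR (complex.Re z) * sin (complex.Im z)).

Lemma cexpD z w : cexp (z + w) = cexp z * cexp w.
Proof.
case: z => a b; case: w => c d; apply: complexP2 => /=.
  by rewrite expRD cosD; ring.
by rewrite expRD sinD; ring.
Qed.

Lemma cexp0 : cexp 0 = 1.
Proof. by apply: complexP2; rewrite /= expR0 ?cos0 ?sin0 ?mulr1 ?mulr0. Qed.

Lemma mag_cexp z : mag (cexp z) = expR (complex.Re z).
Proof.
apply/eqP; rewrite -(@eqrXn2 _ 2)// ?mag_ge0 ?expR_ge0// mag_sqr /= !exprMn.
by rewrite -mulrDr cos2Dsin2 mulr1.
Qed.

Lemma cexp_neq0 z : cexp z != 0.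
Proof. by rewrite -mag_gt0 mag_cexp expR_gt0. Qed.

Lemma cexp_periodic z : cexp (z + 0 +i* (pi *+ 2)) = cexp z.
Proof.
case: z => a b; apply: complexP2 => /=; rewrite addr0.
  by rewrite cosD cos2pi sin2pi mulr0 subr0 mulr1.
by rewrite sinD cos2pi sin2pi mulr0 addr0 mulr1.
Qed.

(** By [cexpD] the derivative at the origin determines the others. *)
Lemma cexp_near0 (e : R) : 0 < e -> exists2 d : R, 0 < d &
  forall h, mag h < d -> mag (cexp h - 1 - h) <= e * mag h.
Proof.
move=> e0; pose e1 := Num.min 1 (e / 12).
have e10 : 0 < e1 by rewrite lt_min ltr01 divr_gt0.
have e11 : e1 <= 1 by rewrite ge_min lexx.
have e1e : e1 * 12 <= e by rewrite -ler_pdivlMr// ge_min lexx orbT.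
clearbody e1.
have [d1 d10 h1] := is_derive_eps (is_derive_expR 0) e10.
have [d2 d20 h2] := is_derive_eps (is_derive_cos 0) e10.
have [d3 d30 h3] := is_derive_eps (is_derive_sin 0) e10.
exists (Num.min (Num.min d1 d2) (Num.min d3 e1)).
  by rewrite !lt_min d10 d20 d30 e10.
move=> h; rewrite !lt_min => /andP[/andP[hd1 hd2] /andP[hd3 hd4]].
case: h hd1 hd2 hd3 hd4 => x y hd1 hd2 hd3 hd4.
have hx := mag_Re (x +i* y); have hy := mag_Im (x +i* y).
rewrite /= in hx hy.
have := h1 x (le_lt_trans hx hd1); have := h2 y (le_lt_trans hy hd2).
have := h3 y (le_lt_trans hy hd3).
rewrite !add0r expR0 cos0 sin0 oppr0 !mulr1 mulr0 !subr0 addr0 => s3 s2 s1.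
apply: le_trans (mag_leD _) _ => /=.
rewrite oppr0 addr0.
have -> : expR x * cos y - 1 - x = (expR x - 1 - x) * cos y + (1 + x) * (cos y - 1) by ring.
have -> : expR x * sin y - y = (expR x - 1 - x) * sin y + x * sin y + (sin y - y) by ring.
set m := mag _ in hx hy hd4 *.
have m0 : 0 <= m by apply: mag_ge0.
have b1 : `|(expR x - 1 - x) * cos y| <= e1 * m.
  rewrite normrM; apply: le_trans (ler_pM _ _ s1 (cos_max y)) _ => //.
  by rewrite mulr1 ler_pM2l.
have b2 : `|(1 + x) * (cos y - 1)| <= 2 * (e1 * m).
  rewrite normrM; apply: ler_pM => //.
    by apply: le_trans (ler_normD _ _) _; rewrite normr1; lra.
  by apply: le_trans s2 _; rewrite ler_pM2l.
have b3 : `|(expR x - 1 - x) * sin y| <= e1 * m.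
  rewrite normrM; apply: le_trans (ler_pM _ _ s1 (sin_max y)) _ => //.
  by rewrite mulr1 ler_pM2l.
have b4 : `|sin y - y| <= e1 * m by apply: le_trans s3 _; rewrite ler_pM2l.
have b5 : `|x * sin y| <= e1 * (2 * m).
  rewrite normrM; apply: ler_pM => //; first by lra.
  have -> : sin y = (sin y - y) + y by ring.
  apply: le_trans (ler_normD _ _) _.
  have : e1 * m <= m by rewrite ler_piMl.
  lra.
apply: le_trans (lerD (ler_normD _ _) (ler_normD _ _)) _.
have := ler_normD ((expR x - 1 - x) * sin y) (x * sin y).
have em0 : 0 <= e1 * m by rewrite mulr_ge0// ltW.
have : 12 * (e1 * m) <= e * m by rewrite mulrA ler_wpM2r// mulrC.
lra.
Qed.

(** The imaginary part is kept off both ends of the interval because circles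
    are cut along the positive ray: each point off the ray has exactly one
    logarithm in the cut strip, in its interior. *)
Lemma cexp_surj (w : R[i]) : ~ (0 <= w) ->
  exists2 c, cexp c = w & 0 < complex.Im c < pi *+ 2.
Proof.
case: w => a b wn.
have m0 : 0 < mag (a +i* b).
  by rewrite mag_gt0; apply/eqP => h; apply: wn; rewrite h.
set m := mag _ in m0.
have sq : a ^+ 2 + b ^+ 2 = m ^+ 2 by rewrite mag_sqr.
have am : -1 <= a / m <= 1.
  have := mag_Re (a +i* b); rewrite /= -/m ler_norml => /andP[h1 h2].
  by rewrite ler_pdivlMr// ler_pdivrMr// mul1r mulN1r h1.
pose t := acos (a / m).
have ct : cos t = a / m by rewrite acosK.
have st : sin t = `|b| / m.
  rewrite sin_acos//; have -> : 1 - (a / m) ^+ 2 = (`|b| / m) ^+ 2.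
    rewrite !exprMn real_normK ?num_real//; have -> : b ^+ 2 = m ^+ 2 - a ^+ 2 by rewrite -sq; ring.
    by field; rewrite gt_eqF.
  by rewrite sqrtr_sqr ger0_norm// divr_ge0// ltW.
have t0 : 0 <= t by apply: acos_ge0.
have tp : t <= pi by apply: acos_lepi.
have em : expR (ln m) = m by rewrite lnK.
have pi0 := @pi_gt0 R.
have [b0|b0] := leP 0 b.
  exists (ln m +i* t).
    apply: complexP2; rewrite /= em ?ct ?st ?(ger0_norm b0) mulrC divfK// gt_eqF//.
  rewrite /=; apply/andP; split; last by rewrite mulr2n; lra.
  rewrite lt_def t0 andbT; apply/eqP => tt.
  move: ct st; rewrite tt cos0 sin0 => /(congr1 (fun u => u * m)).
  rewrite divfK ?gt_eqF// mul1r => am' /(congr1 (fun u => u * m)).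
  rewrite divfK ?gt_eqF// mul0r => /esym /eqP; rewrite normr_eq0 => /eqP bb.
  by apply: wn; rewrite bb -am' lecE /= eqxx /= ltW.
exists (ln m +i* (pi *+ 2 - t)).
  apply: complexP2; rewrite /= em addrC.
    by rewrite cosD2pi cosN ct mulrC divfK// gt_eqF.
  by rewrite sinD2pi sinN st ltr0_norm// mulNr opprK mulrC divfK// gt_eqF.
rewrite /=; apply/andP; split; first by rewrite mulr2n; lra.
rewrite gtrBl lt_def t0 andbT; apply/eqP => tt.
move: st; rewrite tt sin0 => /(congr1 (fun u => u * m)).
by rewrite divfK ?gt_eqF// mul0r => /esym /eqP; rewrite normr_eq0 (lt_eqF b0).
Qed.

Lemma cos_eq1 (u : R) : `|u| < pi *+ 2 -> cos u = 1 -> u = 0.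
Proof.
wlog u0 : u / 0 <= u.
  move=> h up cu; have [u0|u0] := leP 0 u; first exact: h.
  by apply: oppr_inj; rewrite oppr0; apply: h; rewrite ?normrN ?cosN// oppr_ge0 ltW.
rewrite ger0_norm// => up cu; apply/eqP/negP => /negP un.
have : 0 < sin (u / 2).
  apply: sin_gt0_pi; apply/andP; split.
    by rewrite divr_gt0// lt_def un u0.
  by rewrite ltr_pdivrMr// mulr_natr.
have : cos ((u / 2) *+ 2) = 1 by rewrite -mulr_natr divfK ?pnatr_eq0.
rewrite cos_mulr2n => c1 s0.
have := cos2Dsin2 (u / 2); move: c1; rewrite mulr2n.
have := exprn_gt0 2 s0.
set a := sin _ ^+ 2; set b := cos _ ^+ 2; lra.
Qed.

Lemma cexp_inj z w : `|complex.Im z - complex.Im w| < pi *+ 2 ->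
  cexp z = cexp w -> z = w.
Proof.
case: z => a b; case: w => c d /= bd [h1 h2].
have ac : a = c.
  apply: (@expR_inj R).
  by rewrite -[a]/(complex.Re (a +i* b)) -[c]/(complex.Re (c +i* d)) -!mag_cexp /cexp /= h1 h2.
rewrite ac in h1 h2 *; congr (_ +i* _); apply/eqP; rewrite -subr_eq0.
have e0 : expR c != 0 by rewrite gt_eqF// expR_gt0.
apply/eqP/cos_eq1 => //; rewrite cosB (mulfI e0 h1) (mulfI e0 h2).
by rewrite -!expr2 cos2Dsin2.
Qed.

End Cexp.

Section Phase.
Variable (R : realType).

(** Choose the phase that makes the two terms positive multiples of each
    other. *)
Lemma phase_align (a b : R[i]) : exists2 e, mag e = 1 & mag (a + (e^*)%C * b) = mag a + mag b.
Proof.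
have [a0|a0] := eqVneq a 0.
  by exists 1; rewrite ?mag1// a0 mag0 !add0r magM mag_conj mag1 mul1r.
have [b0|b0] := eqVneq b 0.
  by exists 1; rewrite ?mag1// b0 mulr0 mag0 !addr0.
have ma : 0 < mag a by rewrite mag_gt0. have mb : 0 < mag b by rewrite mag_gt0.
pose r : R := mag b / mag a.
have r0 : 0 < r by rewrite divr_gt0.
pose e := a * r%:C / b.
exists (e^*)%C.
  by rewrite mag_conj /e !magM magV magR gtr0_norm// /r mulrCA divff ?gt_eqF// mulr1 divff// gt_eqF.
rewrite conjcK /e divfK// -[X in X + _]mulr1 -mulrDr magM -[1]/(1%:C) -rmorphD magR ger0_norm.
  by rewrite mulrDr mulr1 /r mulrCA divff ?gt_eqF// mulr1.
by rewrite addr_ge0// ltW.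
Qed.

Lemma half_sum m : \sum_(k < m) (2^-1 : R) ^+ k.+1 = 1 - 2^-1 ^+ m.
Proof.
elim: m => [|m IH]; first by rewrite big_ord0 expr0 subrr.
by rewrite big_ord_recr /= IH exprS; field.
Qed.

End Phase.

Section CircleParameter.
Variable (R : realType).

Lemma phase (s : R[i]) : exists2 e, mag e = 1 & e * s = (mag s)%:C.
Proof.
have [->|s0] := eqVneq s 0; first by exists 1; rewrite ?mag1// mag0 mulr0.
exists ((mag s)%:C / s); last by rewrite divfK.
by rewrite magM magV magR ger0_norm ?mag_ge0// divff// mag_eq0.
Qed.

(** The Cayley transform of a small imaginary number. *)
Lemma circle_near1 (d : R) : 0 < d ->
  exists xi : R[i], [/\ mag xi = 1, xi != 1 & mag (xi - 1) < d].
Proof.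
move=> d0; pose w : R[i] := 1 +i* (d / 4).
have t0 : 0 < d / 4 by rewrite divr_gt0.
have w1 : 1 <= mag w by apply: le_trans (mag_Re w); rewrite /= normr1.
have w0 : w != 0 by rewrite -mag_gt0 (lt_le_trans ltr01).
have c0 : (w^*)%C != 0 by rewrite -mag_gt0 mag_conj (lt_le_trans ltr01).
have E : w / (w^*)%C - 1 = (0 +i* (d / 2)) / (w^*)%C.
  rewrite -[X in _ - X](divff c0) -mulrBl; congr (_ / _).
  by apply: complexP2 => /=; field.
have mE : mag (w / (w^*)%C - 1) = d / 2 / mag w.
  rewrite E magM magV mag_conj; congr (_ / _).
  by rewrite mag_complex expr0n /= add0r sqrtr_sqr ger0_norm// divr_ge0// ltW.
have d2 : 0 < d / 2 by rewrite divr_gt0.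
exists (w / (w^*)%C); split.
- by rewrite magM magV mag_conj divff// mag_eq0.
- by rewrite -subr_eq0 -mag_gt0 mE divr_gt0// (lt_le_trans ltr01).
- rewrite mE ltr_pdivrMr ?(lt_le_trans ltr01)//.
  have : d * 1 <= d * mag w by rewrite ler_pM2l.
  lra.
Qed.

End CircleParameter.

(** * Goursat's theorem for dyadic boundary sums *)

Section Goursat.
Variables (R : realType) (V : normedModType R[i]).
Implicit Types (F G : R[i] -> V) (z d : R[i]).

(** Epsilon-delta form, which is what the estimates below consume and produce. *)
Definition cdiff F z := exists l : V, forall e : R, 0 < e ->
  exists2 d : R, 0 < d &
    forall k, mag k < d -> mag (F (z + k) - F z - k *: l) <= e * mag k.

(** The average of [F] over the left end points of the [2 ^ n] equal pieces of
    the segment from [z] to [z + d]: a normalized Riemann sum, dyadic so that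
    halving a segment is exact. *)
Fixpoint avg n F z d : V :=
  if n is m.+1 then 2^-1 *: (avg m F z (d / 2) + avg m F (z + d / 2) (d / 2))
  else F z.

Lemma avg_segment n F G z d :
  (forall t : R, 0 <= t < 1 -> F (z + t%:C * d) = G (z + t%:C * d)) ->
  avg n F z d = avg n G z d.
Proof.
elim: n z d => [|n IH] z d h /=.
  by have := h 0; rewrite mul0r addr0; apply; rewrite lexx ltr01.
have two : (2 : R[i])^-1 = (2^-1 : R)%:C by rewrite fmorphV rmorph_nat.
congr (_ *: (_ + _)); apply: IH => t /andP[t0 t1].
  have := h (t / 2); rewrite rmorphM /= -two -mulrA [_^-1 * d]mulrC; apply.
  by apply/andP; split; lra.
have := h ((1 + t) / 2).
have -> : z + ((1 + t) / 2)%:C * d = z + d / 2 + t%:C * (d / 2).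
  by rewrite rmorphM rmorphD /= -two; ring.
by apply; apply/andP; split; lra.
Qed.

Lemma avg_bound n F z d (M : R) :
  (forall t : R, 0 <= t < 1 -> mag (F (z + t%:C * d)) <= M) ->
  mag (avg n F z d) <= M.
Proof.
elim: n z d => [|n IH] z d h /=.
  by have := h 0; rewrite mul0r addr0; apply; rewrite lexx ltr01.
have two : (2 : R[i])^-1 = (2^-1 : R)%:C by rewrite fmorphV rmorph_nat.
have h1 : mag (avg n F z (d / 2)) <= M.
  apply: IH => t /andP[t0 t1].
  have := h (t / 2); rewrite rmorphM /= -two -mulrA [_^-1 * d]mulrC; apply.
  by apply/andP; split; lra.
have h2 : mag (avg n F (z + d / 2) (d / 2)) <= M.
  apply: IH => t /andP[t0 t1].
  have := h ((1 + t) / 2).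
  have -> : z + ((1 + t) / 2)%:C * d = z + d / 2 + t%:C * (d / 2).
    by rewrite rmorphM rmorphD /= -two; ring.
  by apply; apply/andP; split; lra.
have m2 : mag (2^-1 : R[i]) = 2^-1 by rewrite two magR ger0_norm ?invr_ge0.
rewrite magZ m2.
have := magD (avg n F z (d / 2)) (avg n F (z + d / 2) (d / 2)); lra.
Qed.

Lemma avgD n F G z d : avg n (fun x => F x + G x) z d = avg n F z d + avg n G z d.
Proof.
by elim: n z d => [//|n IH] z d /=; rewrite !IH addrACA scalerDr.
Qed.

Lemma avgZ n (a : R[i]) F z d : avg n (fun x => a *: F x) z d = a *: avg n F z d.
Proof.
elim: n z d => [//|n IH] z d /=.
by rewrite !IH -scalerDr !scalerA mulrC.
Qed.

Lemma avgN n F z d : avg n (fun x => - F x) z d = - avg n F z d.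
Proof. by rewrite -scaleN1r -avgZ; apply: avg_segment => t _; rewrite scaleN1r. Qed.

Lemma avgB n F G z d : avg n (fun x => F x - G x) z d = avg n F z d - avg n G z d.
Proof. by rewrite -avgN -avgD. Qed.

Lemma half_double (v : V) : 2^-1 *: (v + v) = v.
Proof. by rewrite scalerDr -scalerDl -[RHS]scale1r; congr (_ *: _); field. Qed.

Lemma avg_cst n (v : V) z d : avg n (fun=> v) z d = v.
Proof.
by elim: n z d => [//|n IH] z d /=; rewrite !IH half_double.
Qed.

(** The average of an affine function exceeds its value at the left end point
    by an amount that depends on the step only; this is why affine functions
    contribute nothing to boundary sums of rectangles. *)
Lemma avg_lin n (l : V) z d :
  avg n (fun x => x *: l) z d = z *: l + avg n (fun x => x *: l) 0 d.
Proof.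
elim: n z d => [|n IH] z d /=; first by rewrite scale0r addr0.
rewrite (IH z) (IH (z + _)) (IH (0 + _)) add0r !scalerDl.
set A := avg _ _ _ _; set u := (d / 2) *: l; set v := z *: l.
rewrite (_ : v + A + (v + u + A) = (v + v) + (A + (u + A))); last first.
  by rewrite -!addrA; congr (_ + _); rewrite addrCA.
by rewrite scalerDr half_double.
Qed.

(** A Riemann sum of the integral of [F] along the boundary of a rectangle. *)
Definition bd n F z (w h : R) : V :=
  w%:C *: (avg n F z w%:C - avg n F (z + 'i * h%:C) w%:C) +
  ('i * h%:C) *: (avg n F (z + w%:C) ('i * h%:C) - avg n F z ('i * h%:C)).

Lemma halfC (w : R) : (w / 2)%:C = w%:C / 2.
Proof. by rewrite rmorphM /= fmorphV rmorph_nat. Qed.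

(** The sums over inner edges cancel exactly, without passing to the limit. *)
Lemma bd_split n F z w h : bd n.+1 F z w h =
  (bd n F z (w / 2) (h / 2) + bd n F (z + 'i * (h / 2)%:C) (w / 2) (h / 2)) +
  (bd n F (z + (w / 2)%:C) (w / 2) (h / 2) +
   bd n F (z + (w / 2)%:C + 'i * (h / 2)%:C) (w / 2) (h / 2)).
Proof.
rewrite /bd /= !halfC !mulrA.
set a := w%:C / 2; set b := 'i * h%:C / 2.
have ea : w%:C = a + a by rewrite /a; field.
have eb : 'i * h%:C = b + b by rewrite /b; field.
have sa (x : V) : w%:C *: (2^-1 *: x) = a *: x by rewrite scalerA.
have sb (x : V) : ('i * h%:C) *: (2^-1 *: x) = b *: x by rewrite scalerA.
rewrite -!scalerBr sa sb ea eb !addrA.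
rewrite (_ : z + b + b + a = z + a + b + b); last by ring.
rewrite (_ : z + a + a + b = z + a + b + a); last by ring.
rewrite (_ : z + b + a = z + a + b); last by ring.
set P1 := avg n F z a; set P2 := avg n F (z + a) a.
set T1 := avg n F (z + b + b) a; set T2 := avg n F (z + a + b + b) a.
set M1 := avg n F (z + b) a; set M2 := avg n F (z + a + b) a.
set R1 := avg n F (z + a + a) b; set R2 := avg n F (z + a + b + a) b.
set L1 := avg n F z b; set L2 := avg n F (z + b) b.
set N1 := avg n F (z + a) b; set N2 := avg n F (z + a + b) b.
rewrite -!addrA.
rewrite [X in _ = X](_ : _ = (a *: (P1 - M1) + b *: (N1 - L1) + (a *: (M1 - T1) + b *: (N2 - L2))) + (a *: (P2 - M2) + b *: (R1 - N1) + (a *: (M2 - T2) + b *: (R2 - N2)))); last by rewrite !addrA.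
rewrite [X in _ = X + _]addrACA [X in _ = _ + X]addrACA -!scalerDr.
rewrite !(addrA _ _ (- T1)) !(addrA _ _ (- T2)) !subrK.
rewrite [X in _ = X]addrACA -!scalerDr; congr (_ *: _ + _ *: _).
  by rewrite [RHS]addrACA -opprD addrA.
rewrite (addrACA N1) [R1 - N1 + _]addrACA -!opprD [RHS]addrC.
by rewrite [RHS]addrA subrK addrA.
Qed.

Definition rect z (w h : R) (x : R[i]) :=
  complex.Re z <= complex.Re x <= complex.Re z + w /\
  complex.Im z <= complex.Im x <= complex.Im z + h.

Lemma bd_bound n F z (w h M : R) : 0 <= w -> 0 <= h ->
  (forall x, rect z w h x -> mag (F x) <= M) ->
  mag (bd n F z w h) <= 2 * (w + h) * M.
Proof.
case: z => x y w0 h0 hM; set z := x +i* y.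
have b1 : mag (avg n F z w%:C) <= M.
  apply: avg_bound => t /andP[t0 t1]; apply: hM; split => /=.
    by rewrite mul0r subr0; apply/andP; split; nra.
  by rewrite mulr0 mul0r addr0 addr0; apply/andP; split; lra.
have b2 : mag (avg n F (z + 'i * h%:C) w%:C) <= M.
  apply: avg_bound => t /andP[t0 t1]; apply: hM; split => /=.
    by rewrite !mul0r !mulr0 !subr0 addr0; apply/andP; split; nra.
  by rewrite !mulr0 !mul0r !mul1r !add0r !addr0; apply/andP; split; lra.
have b3 : mag (avg n F (z + w%:C) ('i * h%:C)) <= M.
  apply: avg_bound => t /andP[t0 t1]; apply: hM; split => /=.
    by rewrite !mul0r !mulr0 !subr0 ?mulr0 ?addr0; apply/andP; split; nra.
  by rewrite !mulr0 !mul0r !mul1r !add0r !addr0; apply/andP; split; nra.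
have b4 : mag (avg n F z ('i * h%:C)) <= M.
  apply: avg_bound => t /andP[t0 t1]; apply: hM; split => /=.
    by rewrite !mul0r !mulr0 !subr0 ?mulr0 ?addr0; apply/andP; split; nra.
  by rewrite !mulr0 !mul0r !mul1r !add0r !addr0; apply/andP; split; nra.
rewrite /bd; apply: le_trans (magD _ _) _.
rewrite !magZ magM magi !magR mul1r !ger0_norm//.
have := magD (avg n F z w%:C) (- avg n F (z + 'i * h%:C) w%:C).
have := magD (avg n F (z + w%:C) ('i * h%:C)) (- avg n F z ('i * h%:C)).
rewrite !magN => s1 s2.
have t1 : mag (avg n F (z + w%:C) ('i * h%:C) - avg n F z ('i * h%:C)) <= 2 * M by lra.
have t2 : mag (avg n F z w%:C - avg n F (z + 'i * h%:C) w%:C) <= 2 * M by lra.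
have := ler_wpM2l w0 t2; have := ler_wpM2l h0 t1.
lra.
Qed.

Lemma bdB n F G z w h : bd n (fun x => F x - G x) z w h = bd n F z w h - bd n G z w h.
Proof.
rewrite /bd !avgB [in RHS]opprD [RHS]addrACA -!scalerBr; congr (_ *: _ + _ *: _).
  by rewrite !opprD !opprK addrACA.
by rewrite !opprD !opprK addrACA.
Qed.

Lemma bd_affine n (a l : V) c z w h : bd n (fun x => a + (x - c) *: l) z w h = 0.
Proof.
have E y d : avg n (fun x => a + (x - c) *: l) y d =
    (a - c *: l) + y *: l + avg n (fun x => x *: l) 0 d.
  rewrite -addrA -avg_lin -[X in _ = X + _](avg_cst n (a - c *: l) y d) -avgD.
  by apply: avg_segment => t _; rewrite scalerBl addrA addrAC.
rewrite /bd !E.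
have D (u v x y : V) : (u + x + y) - (u + v + y) = x - v.
  by rewrite opprD addrACA subrr addr0 opprD addrACA subrr add0r.
rewrite !D -!scalerBl !scalerA -scalerDl.
rewrite (_ : _ + _ = 0) ?scale0r//; ring.
Qed.

Lemma nested_intervals (a b : nat -> R) :
  (forall n, a n <= a n.+1) -> (forall n, b n.+1 <= b n) -> (forall n, a n <= b n) ->
  exists c, forall n, a n <= c <= b n.
Proof.
move=> ha hb hab.
have am n k : a n <= a (n + k)%N.
  by elim: k => [|k IH]; rewrite ?addn0// addnS (le_trans IH).
have bm n k : b (n + k)%N <= b n.
  by elim: k => [|k IH]; rewrite ?addn0// addnS (le_trans _ IH).
have ab n k : a n <= b k.
  by rewrite (le_trans (am n k))// (le_trans (hab _))// addnC bm.
exists (sup (range a)) => n; apply/andP; split.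
  apply: ub_le_sup; last by exists n.
  by exists (b 0%N) => _ [k _ <-].
apply: ge_sup; first by exists (a 0%N), 0%N.
by move=> _ [k _ <-].
Qed.

(** The odd extension of the fourth root: monotone, with infinite slope at the
    origin, so that its increments across the origin exceed any multiple of a
    small length. *)
Definition root4 (t : R) : R :=
  if 0 <= t then Num.sqrt (Num.sqrt t) else - Num.sqrt (Num.sqrt (- t)).

Lemma root4_mono t u : t <= u -> root4 t <= root4 u.
Proof.
rewrite /root4 => tu; case: (leP 0 t) => t0; case: (leP 0 u) => u0.
- by rewrite !ler_sqrt ?sqrtr_ge0// (le_trans t0).
- by have := lt_le_trans u0 (le_trans t0 tu); rewrite ltxx.
- by rewrite (@le_trans _ _ 0)// ?oppr_le0 sqrtr_ge0.
- by rewrite lerN2 !ler_sqrt ?sqrtr_ge0 ?lerN2// oppr_ge0 ltW.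
Qed.

Lemma root4_inc t u : t <= 0 -> 0 <= u ->
  Num.sqrt (Num.sqrt ((u - t) / 2)) <= root4 u - root4 t.
Proof.
move=> t0 u0; rewrite /root4 u0.
have -> : (if 0 <= t then Num.sqrt (Num.sqrt t) else - Num.sqrt (Num.sqrt (- t))) =
    - Num.sqrt (Num.sqrt (- t)).
  case: leP => // t1; have -> : t = 0 by lra.
  by rewrite oppr0 !sqrtr0 oppr0.
rewrite opprK.
have [h|h] := leP (- t) u.
  by rewrite ler_wpDr ?sqrtr_ge0// !ler_sqrt ?sqrtr_ge0//; lra.
rewrite ler_wpDl ?sqrtr_ge0// !ler_sqrt ?sqrtr_ge0//; lra.
Qed.

Lemma sqrt_sqrt_16 (t : R) j : 0 <= t ->
  Num.sqrt (Num.sqrt (t / 16 ^+ j)) = Num.sqrt (Num.sqrt t) / 2 ^+ j.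
Proof.
move=> t0; have e16 : (16 : R) ^+ j = (4 ^+ j) ^+ 2.
  by rewrite -exprM mulnC exprM; congr (_ ^+ j); ring.
have e4 : (4 : R) ^+ j = (2 ^+ j) ^+ 2.
  by rewrite -exprM mulnC exprM; congr (_ ^+ j); ring.
rewrite sqrtrM// e16 sqrtrV ?exprn_ge0// sqrtr_sqr ger0_norm ?exprn_ge0//.
by rewrite sqrtrM ?sqrtr_ge0// e4 sqrtrV ?exprn_ge0// sqrtr_sqr ger0_norm ?exprn_ge0.
Qed.

Definition inc4 (x w c : R) := root4 (x + w - c) - root4 (x - c).

Lemma inc4_split x w c : inc4 x w c = inc4 x (w / 2) c + inc4 (x + w / 2) (w / 2) c.
Proof.
rewrite /inc4; have <- : x + w / 2 + w / 2 = x + w by rewrite -addrA -splitr.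
by rewrite [RHS]addrC addrA subrK.
Qed.

Lemma inc4_ge0 x w c : 0 <= w -> 0 <= inc4 x w c.
Proof. by move=> w0; rewrite subr_ge0 root4_mono//; lra. Qed.

Lemma geom_small (A e : R) : 0 < e -> exists j, A / 2 ^+ j < e.
Proof.
move=> e0; have [A0|A0] := leP A 0.
  exists 0%N; rewrite expr0 divr1; exact: le_lt_trans e0.
exists (Num.bound (A / e)); set N := Num.bound _.
rewrite ltr_pdivrMr ?exprn_gt0// mulrC -ltr_pdivrMr//.
apply: lt_le_trans (archi_boundP _) _; first by rewrite divr_ge0// ltW.
by rewrite -natrX ler_nat ltnW// ltn_expl.
Qed.

Definition eventually_le (u : nat -> V) (e : R) :=
  exists N, forall n, (N <= n)%N -> mag (u n) <= e.

Lemma bd_quarters F z w h (e1 e2 e3 e4 : R) :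
  eventually_le (fun n => bd n F z (w / 2) (h / 2)) e1 ->
  eventually_le (fun n => bd n F (z + 'i * (h / 2)%:C) (w / 2) (h / 2)) e2 ->
  eventually_le (fun n => bd n F (z + (w / 2)%:C) (w / 2) (h / 2)) e3 ->
  eventually_le (fun n => bd n F (z + (w / 2)%:C + 'i * (h / 2)%:C) (w / 2) (h / 2)) e4 ->
  eventually_le (fun n => bd n F z w h) (e1 + e2 + (e3 + e4)).
Proof.
move=> [N1 h1] [N2 h2] [N3 h3] [N4 h4].
exists (maxn (maxn N1 N2) (maxn N3 N4)).+1 => -[//|n]; rewrite ltnS !geq_max.
move=> /andP[/andP[n1 n2] /andP[n3 n4]]; rewrite bd_split.
apply: le_trans (magD _ _) _; apply: lerD.
  by apply: le_trans (magD _ _) _; apply: lerD; [exact: h1|exact: h2].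
by apply: le_trans (magD _ _) _; apply: lerD; [exact: h3|exact: h4].
Qed.

Lemma mag_rect z w h x y : 0 <= w -> 0 <= h -> rect z w h x -> rect z w h y ->
  mag (x - y) <= w + h.
Proof.
case: z x y => [z1 z2] [x1 x2] [y1 y2] w0 h0 [/= /andP[a b] /andP[c d]].
move=> [/= /andP[a' b'] /andP[c' d']].
apply: le_trans (mag_leD _) _ => /=; apply: lerD; rewrite ler_norml; apply/andP; split; lra.
Qed.

(** Nested rectangles, each violating a bound that is additive under
    quartering. If they shrink to a point of differentiability, the boundary
    sums are of smaller order than the area; if they shrink to [c0], where
    only boundedness is available, the boundary sums are of the order of the
    diameter, which the increments of [root4] still dominate. *)
Lemma goursat F z0 (w h K : R) c0 : 0 < w -> 0 < h ->
  (forall x, rect z0 w h x -> mag (F x) <= K) ->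
  (forall x, rect z0 w h x -> x != c0 -> cdiff F x) ->
  forall e, 0 < e -> eventually_le (fun n => bd n F z0 w h) e.
Proof.
move=> w0 h0 FK Fd e e0.
have K0 : 0 <= K.
  apply: le_trans (mag_ge0 _) (FK z0 _); rewrite /rect lexx /=.
  by split; rewrite ?lexx /= lerDl ltW.
pose xc := complex.Re c0; pose yc := complex.Im c0.
(* The gauge of a rectangle: its area plus a term that is additive under
   quartering and large only near [c0]. *)
pose nu z u v := u * v + inc4 (complex.Re z) u xc * inc4 (complex.Im z) v yc.
have nu_ge0 z u v : 0 <= u -> 0 <= v -> u * v <= nu z u v.
  by move=> u0 v0; rewrite lerDl mulr_ge0// inc4_ge0.
pose eta := e / nu z0 w h.
have nu0 : 0 < nu z0 w h by rewrite (lt_le_trans _ (nu_ge0 _ _ _ _ _)) ?mulr_gt0// ltW.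
have eta0 : 0 < eta by rewrite divr_gt0.
pose wm m := w / 2 ^+ m; pose hm m := h / 2 ^+ m.
have wm0 m : 0 < wm m by rewrite divr_gt0// exprn_gt0.
have hm0 m : 0 < hm m by rewrite divr_gt0// exprn_gt0.
have wmS m : wm m.+1 = wm m / 2 by rewrite /wm exprSr invfM mulrA.
have hmS m : hm m.+1 = hm m / 2 by rewrite /hm exprSr invfM mulrA.
pose good m z := eventually_le (fun n => bd n F z (wm m) (hm m)) (eta * nu z (wm m) (hm m)).
suff : good 0%N z0.
  by rewrite /good /wm /hm !expr0 !divr1 /eta divfK// gt_eqF.
apply: contrapT => bad0.
have step m z : exists z', (~ good m z -> ~ good m.+1 z') /\
    (complex.Re z <= complex.Re z' /\ complex.Re z' + wm m.+1 <= complex.Re z + wm m) /\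
    (complex.Im z <= complex.Im z' /\ complex.Im z' + hm m.+1 <= complex.Im z + hm m).
  have := wm0 m; have := hm0 m; move=> hm0' wm0'.
  have [gz|bz] := pselect (good m z).
    by exists z; split=> //; rewrite wmS hmS; split; split=> //; lra.
  apply: contrapT => nex; apply: bz.
  have q z' : (complex.Re z' = complex.Re z \/ complex.Re z' = complex.Re z + wm m / 2) ->
      (complex.Im z' = complex.Im z \/ complex.Im z' = complex.Im z + hm m / 2) ->
      good m.+1 z'.
    move=> hr hi; apply: contrapT => bz'; apply: nex; exists z'; split=> //.
    by rewrite wmS hmS; split; [case: hr => ->|case: hi => ->]; split; lra.
  have r1 (u v : R) (x : R[i]) : complex.Re (x + u%:C + 'i * v%:C) = complex.Re x + u.
    by case: x => a b /=; ring.
  have i1 (u v : R) (x : R[i]) : complex.Im (x + u%:C + 'i * v%:C) = complex.Im x + v.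
    by case: x => a b /=; ring.
  have r2 (v : R) (x : R[i]) : complex.Re (x + 'i * v%:C) = complex.Re x.
    by case: x => a b /=; ring.
  have i2 (v : R) (x : R[i]) : complex.Im (x + 'i * v%:C) = complex.Im x + v.
    by case: x => a b /=; ring.
  have r3 (u : R) (x : R[i]) : complex.Re (x + u%:C) = complex.Re x + u.
    by case: x.
  have i3 (u : R) (x : R[i]) : complex.Im (x + u%:C) = complex.Im x.
    by case: x => a b /=; ring.
  have q1 : good m.+1 z by apply: q; left.
  have q2 : good m.+1 (z + 'i * (hm m / 2)%:C).
    by apply: q; [left; rewrite r2|right; rewrite i2].
  have q3 : good m.+1 (z + (wm m / 2)%:C).
    by apply: q; [right; rewrite r3|left; rewrite i3].
  have q4 : good m.+1 (z + (wm m / 2)%:C + 'i * (hm m / 2)%:C).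
    by apply: q; [right; rewrite r1|right; rewrite i1].
  move: q1 q2 q3 q4; rewrite /good wmS hmS => q1 q2 q3 q4.
  have := bd_quarters q1 q2 q3 q4.
  rewrite -!mulrDr; congr (eventually_le _ (_ * _)).
  rewrite /nu r1 i1 r2 i2 r3 i3 (inc4_split _ (wm m)) (inc4_split _ (hm m)).
  by field.
have [nxt nxtP] := choice (fun mz : nat * R[i] => step mz.1 mz.2).
pose u := fix u n := if n is m.+1 then nxt (m, u m) else z0.
have uP m := nxtP (m, u m).
have bad m : ~ good m (u m).
  by elim: m => [//|m IH]; apply: (uP m).1.
have [xx xxP] : exists xx, forall n, complex.Re (u n) <= xx <= complex.Re (u n) + wm n.
  apply: nested_intervals => n; [exact: (uP n).2.1.1|exact: (uP n).2.1.2|].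
  by rewrite lerDl ltW.
have [yy yyP] : exists yy, forall n, complex.Im (u n) <= yy <= complex.Im (u n) + hm n.
  apply: nested_intervals => n; [exact: (uP n).2.2.1|exact: (uP n).2.2.2|].
  by rewrite lerDl ltW.
pose c := xx +i* yy.
have cr m : rect (u m) (wm m) (hm m) c by split; [exact: xxP|exact: yyP].
have sub m x : rect (u m) (wm m) (hm m) x -> rect z0 w h x.
  elim: m => [|m IH]; first by rewrite /wm /hm !expr0 !divr1.
  move=> [/andP[a b] /andP[a' b']]; apply: IH.
  have [_ [[p1 p2] [p3 p4]]] := uP m; move: p1 p2 p3 p4; rewrite /= => p1 p2 p3 p4.
  split; apply/andP; split.
  - exact: le_trans p1 a.
  - exact: le_trans b p2.
  - exact: le_trans p3 a'.
  - exact: le_trans b' p4.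
have cz0 : rect z0 w h c by apply: (sub 0%N); exact: cr.
have [cc0|cc0] := eqVneq c c0.
  pose q := Num.sqrt (Num.sqrt (w / 2)) * Num.sqrt (Num.sqrt (h / 2)).
  have w2 : 0 < w / 2 by rewrite divr_gt0.
  have h2 : 0 < h / 2 by rewrite divr_gt0.
  have q0 : 0 < q by rewrite mulr_gt0 ?sqrtr_gt0.
  have [j hj] := geom_small (2 * (w + h) * K) (mulr_gt0 eta0 q0).
  (* A multiple of four makes the two fourth roots explicit. *)
  apply: (bad (4 * j)%N); exists 0%N => n _.
  set m := (4 * j)%N.
  have m16 : 2 ^+ m = 16 ^+ j :> R.
    by rewrite /m exprM; congr (_ ^+ j); ring.
  have j0 : 0 < (2 : R) ^+ j by rewrite exprn_gt0.
  have i1 : Num.sqrt (Num.sqrt (w / 2)) / 2 ^+ j <= inc4 (complex.Re (u m)) (wm m) xc.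
    rewrite -sqrt_sqrt_16; last exact: ltW.
    have /andP[a b] := xxP m; rewrite /inc4 /xc -cc0 /=.
    apply: le_trans (root4_inc _ _); [|lra|lra].
    rewrite le_eqVlt; apply/orP; left; apply/eqP; do 2!congr Num.sqrt.
    by rewrite /wm m16; ring.
  have i2 : Num.sqrt (Num.sqrt (h / 2)) / 2 ^+ j <= inc4 (complex.Im (u m)) (hm m) yc.
    rewrite -sqrt_sqrt_16; last exact: ltW.
    have /andP[a b] := yyP m; rewrite /inc4 /yc -cc0 /=.
    apply: le_trans (root4_inc _ _); [|lra|lra].
    rewrite le_eqVlt; apply/orP; left; apply/eqP; do 2!congr Num.sqrt.
    by rewrite /hm m16; ring.
  have ii : q / (2 ^+ j * 2 ^+ j) <= nu (u m) (wm m) (hm m).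
    rewrite /nu (@le_trans _ _ (inc4 (complex.Re (u m)) (wm m) xc *
      inc4 (complex.Im (u m)) (hm m) yc))//; last first.
      by rewrite lerDr mulr_ge0// ltW.
    have -> : q / (2 ^+ j * 2 ^+ j) = Num.sqrt (Num.sqrt (w / 2)) / 2 ^+ j *
        (Num.sqrt (Num.sqrt (h / 2)) / 2 ^+ j).
      by rewrite /q; field; rewrite gt_eqF.
    by apply: ler_pM => //; rewrite divr_ge0// ?sqrtr_ge0 ?ltW.
  apply: le_trans (ler_wpM2l (ltW eta0) ii).
  apply: le_trans (bd_bound (M := K) _ _ _ _) _.
  - exact: ltW.
  - exact: ltW.
  - by move=> x /sub; apply: FK.
  rewrite /wm /hm m16 -mulrDl.
  have -> : (16 : R) ^+ j = 2 ^+ j * 2 ^+ j * (2 ^+ j * 2 ^+ j).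
    by rewrite -!exprMn; congr (_ ^+ j); ring.
  move: hj; rewrite ltr_pdivrMr// => hj.
  set g := 2 ^+ j in j0 hj *.
  have g1 : 1 <= g by rewrite /g exprn_ege1// ler1n.
  have -> : 2 * ((w + h) / (g * g * (g * g))) * K = (2 * (w + h) * K) / (g * g * (g * g)).
    by field; rewrite gt_eqF.
  rewrite ler_pdivrMr ?mulr_gt0//.
  have -> : eta * (q / (g * g)) * (g * g * (g * g)) = eta * q * (g * g).
    by field; rewrite gt_eqF.
  apply: le_trans (ltW hj) _; apply: ler_wpM2l; first exact: ltW (mulr_gt0 eta0 q0).
  by rewrite ler_peMl// ltW.
have [l hl] := Fd c cz0 cc0.
pose th := eta * (w * h) / (2 * (w + h) * (w + h)).
have wh0 : 0 < w + h by rewrite addr_gt0.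
have th0 : 0 < th.
  by apply: divr_gt0; [exact: mulr_gt0 eta0 (mulr_gt0 w0 h0)|rewrite !mulr_gt0].
have [d d0 hd] := hl th th0.
have [m hm'] := geom_small (w + h) d0.
apply: (bad m); exists 0%N => n _.
have -> : bd n F (u m) (wm m) (hm m) =
    bd n (fun x => F x - (F c + (x - c) *: l)) (u m) (wm m) (hm m).
  by rewrite bdB bd_affine subr0.
have tm : 0 < (2 : R) ^+ m by rewrite exprn_gt0.
apply: le_trans (bd_bound (M := th * (wm m + hm m)) _ _ _ _) _.
- exact: ltW.
- exact: ltW.
- move=> x rx; have xc' := mag_rect (ltW (wm0 m)) (ltW (hm0 m)) rx (cr m).
  have := hd (x - c); rewrite (addrC c) subrK opprD addrA => hh.
  apply: le_trans (hh _) _; last by rewrite ler_wpM2l// ltW.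
  by apply: le_lt_trans xc' _; rewrite /wm /hm -mulrDl.
apply: le_trans (ler_wpM2l (ltW eta0) (nu_ge0 (u m) _ _ (ltW (wm0 m)) (ltW (hm0 m)))).
rewrite le_eqVlt; apply/orP; left; apply/eqP.
rewrite /wm /hm /th; field.
by rewrite !gt_eqF.
Qed.

End Goursat.

(** * Differentiability in one complex variable *)

Section CDiff.
Variables (R : realType).
Implicit Types (V W : normedModType R[i]).

Lemma continuousP_mag V W (f : V -> W) (x : V) : {for x, continuous f} <->
  forall e : R, 0 < e -> exists2 d : R, 0 < d &
    forall y, mag (y - x) < d -> mag (f y - f x) <= e.
Proof.
split.
  move=> /cvgrPdist_le fx e e0.
  have /fx : 0 < e%:C by rewrite ltcR.
  move=> /nbhs_ballP[d /= d0 hd].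
  have dr : d = (complex.Re d)%:C by rewrite RRe_real// gtr0_real.
  exists (complex.Re d); first by rewrite -ltcR -dr.
  move=> y yx; rewrite magB -lecR -magE; apply: hd.
  by rewrite -ball_normE /= dr distrC magE ltcR.
move=> h; apply/cvgrPdist_le => e e0.
have er : e = (complex.Re e)%:C by rewrite RRe_real// gtr0_real.
have [|d d0 hd] := h (complex.Re e); first by rewrite -ltcR -er.
apply/nbhs_ballP; exists d%:C; first by rewrite /= ltcR.
move=> y; rewrite -ball_normE /= magE ltcR => xy.
by rewrite er magE lecR magB hd// magB.
Qed.

Definition ccont V (f : R[i] -> V) (z : R[i]) := forall e : R, 0 < e ->
  exists2 d : R, 0 < d & forall y, mag (y - z) < d -> mag (f y - f z) <= e.

Lemma ccont_cst V (v : V) z : ccont (fun=> v) z.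
Proof. by move=> e e0; exists 1 => // y _; rewrite subrr mag0 ltW. Qed.

Lemma ccont_id z : ccont (fun x => x : R[i]^o) z.
Proof. by move=> e e0; exists e => // y /ltW. Qed.

Lemma ccontD V (f g : R[i] -> V) z : ccont f z -> ccont g z ->
  ccont (fun x => f x + g x) z.
Proof.
move=> fc gc e e0; have e2 : 0 < e / 2 by rewrite divr_gt0.
have [d1 d10 h1] := fc _ e2; have [d2 d20 h2] := gc _ e2.
exists (Num.min d1 d2) => [|y]; rewrite lt_min ?d10// => /andP[y1 y2].
rewrite opprD addrACA; apply: le_trans (magD _ _) _.
by rewrite [e]splitr lerD ?h1 ?h2.
Qed.

Lemma ccontZ V (a : R[i] -> R[i]^o) (g : R[i] -> V) z : ccont a z -> ccont g z ->
  ccont (fun x => a x *: g x) z.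
Proof.
move=> ac gc e e0; set A := mag (a z : R[i]); set B := mag (g z).
have A0 : 0 <= A by apply: mag_ge0.
have B0 : 0 <= B by apply: mag_ge0.
have e1 : 0 < e / (2 * (B + 1)) by rewrite divr_gt0// mulr_gt0// ltr_wpDl.
have e2 : 0 < Num.min 1 (e / (2 * (A + 1))).
  by rewrite lt_min ltr01 divr_gt0// mulr_gt0// ltr_wpDl.
have [d1 d10 h1] := ac _ e1; have [d2 d20 h2] := gc _ e2.
exists (Num.min d1 d2) => [|y]; rewrite lt_min ?d10// => /andP[/h1 y1 /h2].
rewrite le_min => /andP[y2 y3].
have -> : a y *: g y - a z *: g z = (a y - a z) *: g y + a z *: (g y - g z).
  by rewrite scalerBl scalerBr addrA subrK.
apply: le_trans (magD _ _) _; rewrite !magZ -/A.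
have gy : mag (g y) <= B + 1.
  by rewrite -lerBlDl; apply: le_trans (mag_subl _ _) _.
have := ler_pM (mag_ge0 _) (mag_ge0 _) y1 gy.
have -> : e / (2 * (B + 1)) * (B + 1) = e / 2 by field; rewrite gt_eqF// ltr_wpDl.
have : A * mag (g y - g z) <= (A + 1) * (e / (2 * (A + 1))).
  by apply: ler_pM => //; [apply: mag_ge0|rewrite lerDl].
have -> : (A + 1) * (e / (2 * (A + 1))) = e / 2 by field; rewrite gt_eqF// ltr_wpDl.
rewrite -[mag (a y - a z)]/(mag ((a y - a z) : R[i]^o)).
lra.
Qed.

Lemma ccont_comp V (g : R[i] -> V) (a : R[i] -> R[i]^o) z :
  ccont a z -> ccont g (a z) -> ccont (fun x => g (a x)) z.
Proof.
move=> ac gc e e0; have [d d0 hd] := gc e e0.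
have d2 : 0 < d / 2 by rewrite divr_gt0.
have [d1 d10 h1] := ac _ d2; exists d1 => // y /h1 yd; apply: hd.
by apply: le_lt_trans yd _; rewrite ltr_pdivrMr// mulr_natr mulr2n ltrDl.
Qed.

(** Caratheodory's form of differentiability, for which the chain and product
    rules are algebraic identities. *)
Lemma cdiffP V (f : R[i] -> V) (z : R[i]) : cdiff f z <->
  exists2 phi : R[i] -> V, ccont phi z & forall x, f x = f z + (x - z) *: phi x.
Proof.
split.
  move=> [l hl].
  pose phi (x : R[i]) : V := if x == z then l else (x - z)^-1 *: (f x - f z).
  exists phi.
    move=> e e0; have [d d0 hd] := hl e e0.
    exists d => // y yz; rewrite /phi eqxx; case: ifPn => [_|nyz].
      by rewrite subrr mag0 ltW.
    have yz0 : y - z != 0 by rewrite subr_eq0.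
    have := hd (y - z) yz; rewrite (addrC z) subrK.
    have -> : f y - f z - (y - z) *: l = (y - z) *: ((y - z)^-1 *: (f y - f z) - l).
      by rewrite scalerBr scalerA divff// scale1r.
    by rewrite (magZ (y - z)) mulrC ler_pM2r// mag_gt0.
  move=> x; rewrite /phi; have [->|xz] := eqVneq x z.
    by rewrite subrr scale0r addr0.
  by rewrite scalerA divff ?subr_eq0// scale1r addrC subrK.
move=> [phi phic fE]; exists (phi z) => e e0.
have [d d0 hd] := phic e e0; exists d => // k kd.
have -> : f (z + k) - f z - k *: phi z = k *: (phi (z + k) - phi z).
  by rewrite fE (addrC z k) addrK scalerBr (addrC (f z)) addrK.
by rewrite magZ mulrC ler_wpM2r ?mag_ge0// hd// (addrC z k) addrK.
Qed.

Lemma cdiff_ccont V (f : R[i] -> V) (z : R[i]) : cdiff f z -> ccont f z.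
Proof.
move=> /cdiffP[phi phic fE].
rewrite (_ : f = fun x => f z + (x - z : R[i]^o) *: phi x); last exact/funext.
apply: ccontD; first exact: ccont_cst.
by apply: ccontZ => //; apply: ccontD; [exact: ccont_id|exact: ccont_cst].
Qed.

Lemma cdiff_eq V (f g : R[i] -> V) z : (forall x, f x = g x) -> cdiff f z -> cdiff g z.
Proof. by move=> fg; rewrite (_ : f = g) //; apply/funext. Qed.

Lemma cdiff_cst V (v : V) z : cdiff (fun=> v) z.
Proof.
apply/cdiffP; exists (fun=> 0); first exact: ccont_cst.
by move=> x; rewrite scaler0 addr0.
Qed.

Lemma cdiff_id z : cdiff (fun x => x : R[i]^o) z.
Proof.
apply/cdiffP; exists (fun=> 1); first exact: ccont_cst.
by move=> x; rewrite [_ *: _]mulr1 addrC subrK.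
Qed.

Lemma cdiffD V (f g : R[i] -> V) z : cdiff f z -> cdiff g z ->
  cdiff (fun x => f x + g x) z.
Proof.
move=> /cdiffP[p pc pE] /cdiffP[q qc qE]; apply/cdiffP.
exists (fun x => p x + q x); first exact: ccontD.
by move=> x; rewrite pE qE scalerDr addrACA.
Qed.

Lemma cdiffZ V (a : R[i] -> R[i]^o) (g : R[i] -> V) z : cdiff a z -> cdiff g z ->
  cdiff (fun x => a x *: g x) z.
Proof.
move=> da dg; have gc := cdiff_ccont dg.
move: da dg => /cdiffP[p pc pE] /cdiffP[q qc qE]; apply/cdiffP.
exists (fun x => p x *: g x + a z *: q x).
  apply: ccontD; first exact: ccontZ.
  by apply: ccontZ => //; exact: ccont_cst.
move=> x; rewrite scalerDr !scalerA.
rewrite -[p x]/(p x : R[i]) -[a x]/(a x : R[i]).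
have -> : a x = a z + (x - z) * p x by rewrite pE.
rewrite scalerDl [RHS]addrCA [RHS]addrC; congr (_ + _).
by rewrite {1}qE scalerDr scalerA mulrC.
Qed.

Lemma cdiffN V (g : R[i] -> V) z : cdiff g z -> cdiff (fun x => - g x) z.
Proof.
move=> dg; apply: (@cdiff_eq _ (fun x => (-1 : R[i]^o) *: g x)).
  by move=> x; rewrite scaleN1r.
by apply: cdiffZ => //; apply: cdiff_cst.
Qed.

Lemma cdiffB V (f g : R[i] -> V) z : cdiff f z -> cdiff g z ->
  cdiff (fun x => f x - g x) z.
Proof. by move=> df dg; apply: cdiffD => //; apply: cdiffN. Qed.

Lemma cdiff_comp V (g : R[i] -> V) (a : R[i] -> R[i]^o) z :
  cdiff a z -> cdiff g (a z) -> cdiff (fun x => g (a x)) z.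
Proof.
move=> da; have ac := cdiff_ccont da.
move: da => /cdiffP[p pc pE] /cdiffP[q qc qE]; apply/cdiffP.
exists (fun x => p x *: q (a x)).
  by apply: ccontZ => //; exact: ccont_comp.
move=> x; rewrite qE scalerA.
have -> : a x - a z = (x - z) * p x by rewrite pE addrC addKr.
by [].
Qed.

Lemma cdiff_inv z : z != 0 -> cdiff (fun x => x^-1 : R[i]^o) z.
Proof.
move=> z0.
have zc : ccont (fun x => x^-1 : R[i]^o) z.
  have mz : 0 < mag z by rewrite mag_gt0.
  move=> e e0; exists (Num.min (mag z / 2) (e * (mag z * mag z) / 2)).
    by rewrite lt_min !divr_gt0// !mulr_gt0.
  move=> y; rewrite lt_min => /andP[y1 y2].
  have my : mag z / 2 <= mag y.
    have := mag_subl z (z - y); rewrite (_ : z - (z - y) = y); last by ring.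
    rewrite (magB z y); lra.
  have y0 : y != 0 by rewrite -mag_gt0 (lt_le_trans _ my)// divr_gt0.
  have -> : y^-1 - z^-1 = (z - y) / (y * z) by field; rewrite z0 y0.
  rewrite magM magV magM magB ler_pdivrMr; last by rewrite mulr_gt0 ?mag_gt0.
  apply: le_trans (ltW y2) _; rewrite -!mulrA; apply: ler_wpM2l; first exact: ltW.
  have := ler_wpM2r (ltW mz) my; lra.
exists (- z ^- 2) => e e0.
have [|d d0 hd] := zc (e * mag z); first by rewrite mulr_gt0// mag_gt0.
exists (Num.min d (mag z)); first by rewrite lt_min d0 mag_gt0.
move=> k; rewrite lt_min => /andP[kd kz].
have zk0 : z + k != 0.
  apply/eqP => zk; move: kz; rewrite (_ : k = - z) ?magN ?ltxx//.
  by apply/eqP; rewrite -addr_eq0 addrC zk.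
have -> : (z + k)^-1 - z^-1 - k *: - z ^- 2 = - k / z * ((z + k)^-1 - z^-1).
  rewrite -[k *: _]/(k * _); field.
  by rewrite z0 zk0.
rewrite !magM magN magV.
have := hd (z + k); rewrite addrAC subrr add0r => /(_ kd) hh.
have mz : 0 < mag z by rewrite mag_gt0.
apply: le_trans (ler_wpM2l _ hh) _; first by rewrite divr_ge0// mag_ge0.
by rewrite le_eqVlt; apply/orP; left; apply/eqP; field; rewrite gt_eqF.
Qed.

Lemma cdiff_cexp z : cdiff (@cexp R : R[i] -> R[i]^o) z.
Proof.
exists (cexp z) => e e0.
have mz : 0 < mag (cexp z) by rewrite mag_gt0 cexp_neq0.
have [d d0 hd] := cexp_near0 (divr_gt0 e0 mz).
exists d => // k kd; rewrite cexpD.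
have -> : cexp z * cexp k - cexp z - k *: cexp z = cexp z * (cexp k - 1 - k).
  by rewrite -[k *: _]/(k * _); ring.
rewrite magM mulrC -ler_pdivlMr//.
by apply: le_trans (hd k kd) _; rewrite mulrAC.
Qed.

End CDiff.

(** * Averages over circles *)

Section Circle.
Variables (R : realType) (V : normedModType R[i]).
Implicit Types (G : R[i] -> V).

Definition mcvg (u : nat -> V) (l : V) := forall e : R, 0 < e -> eventually_le (fun n => u n - l) e.

(** The average of [G] over the [2 ^ n] vertices of a regular polygon
    inscribed in the circle of radius [r], one of them on the positive real
    axis. *)
Definition circ n G (r : R) : V :=
  avg n (fun z => G (cexp z)) (ln r)%:C ('i * (pi *+ 2)%:C).

Lemma mag_circ (r t : R) : 0 < r ->
  mag (cexp ((ln r)%:C + t%:C * ('i * (pi *+ 2)%:C))) = r.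
Proof.
move=> r0; rewrite mag_cexp (_ : complex.Re _ = ln r) ?lnK//.
by rewrite /=; ring.
Qed.

Lemma circ_eq n G G' (r : R) : 0 < r -> (forall z, mag z = r -> G z = G' z) ->
  circ n G r = circ n G' r.
Proof. by move=> r0 h; apply: avg_segment => t _; apply: h; rewrite mag_circ. Qed.

Lemma circ_bound n G (r M : R) : 0 < r -> (forall z, mag z = r -> mag (G z) <= M) ->
  mag (circ n G r) <= M.
Proof. by move=> r0 h; apply: avg_bound => t _; apply: h; rewrite mag_circ. Qed.

Lemma circD n G G' r : circ n (fun x => G x + G' x) r = circ n G r + circ n G' r.
Proof. exact: avgD. Qed.
Lemma circB n G G' r : circ n (fun x => G x - G' x) r = circ n G r - circ n G' r.
Proof. exact: avgB. Qed.
Lemma circZ n (a : R[i]) G r : circ n (fun x => a *: G x) r = a *: circ n G r.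
Proof. exact: avgZ. Qed.
Lemma circ_cst n (v : V) r : circ n (fun=> v) r = v.
Proof. exact: avg_cst. Qed.

Lemma avg_shift n (F : R[i] -> V) (z c d : R[i]) :
  avg n F (z + c) d = avg n (fun x => F (x + c)) z d.
Proof. by elim: n z d => [//|n IH] z d /=; rewrite IH [z + c + _]addrAC IH. Qed.

(** The exponential maps a rectangle onto the annulus cut along the positive
    ray. By periodicity the two sides on the cut cancel, and the boundary sum
    that remains is the difference of the two averages. *)
Lemma circ_diff G (r1 r2 K : R) w : 0 < r1 -> r1 < r2 -> ~ (0 <= w) ->
  (forall z, r1 <= mag z <= r2 -> mag (G z) <= K) ->
  (forall z, r1 <= mag z <= r2 -> z != w -> cdiff G z) ->
  forall e : R, 0 < e -> eventually_le (fun n => circ n G r2 - circ n G r1) e.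
Proof.
move=> r10 r12 wn GK Gd e e0.
have r20 : 0 < r2 by rewrite (lt_trans r10).
have [c0 c0w c0i] := cexp_surj wn.
have p0 : 0 < (pi : R) *+ 2 by rewrite pmulrn_lgt0// pi_gt0.
have lr : 0 < ln r2 - ln r1 by rewrite subr_gt0 ltr_ln.
pose F (z : R[i]) := G (cexp z).
have rc z : rect (ln r1)%:C (ln r2 - ln r1) (pi *+ 2) z -> r1 <= mag (cexp z) <= r2.
  move=> [/= /andP[a b] _]; rewrite mag_cexp; apply/andP; split.
    by rewrite -(lnK r10) ler_expR.
  by rewrite -(lnK r20) ler_expR; lra.
have e2 : 0 < e * (pi *+ 2) by rewrite mulr_gt0.
have [N hN] : eventually_le (fun n => bd n F (ln r1)%:C (ln r2 - ln r1) (pi *+ 2)) (e * (pi *+ 2)).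
  apply: (@goursat _ _ F _ _ _ K c0) => //.
    by move=> x /rc; apply: GK.
  move=> x rx xc0; apply: cdiff_comp; first exact: cdiff_cexp.
  apply: Gd; first exact: rc.
  apply/eqP => xw; move/eqP: xc0; apply; apply: cexp_inj; last by rewrite xw.
  case: rx => _ /= /andP[a b]; case/andP: c0i => c d.
  by rewrite ltr_norml; apply/andP; split; lra.
exists N => n /hN; rewrite /bd.
rewrite avg_shift (@avg_segment _ _ n (fun x => F (x + 'i * (pi *+ 2)%:C)) F); last first.
  move=> t _; rewrite /F (_ : 'i * _ = 0 +i* (pi *+ 2)) ?cexp_periodic//.
  by apply: complexP2 => /=; ring.
rewrite subrr scaler0 add0r magZ magM magi mul1r magR (ger0_norm (ltW p0)).
by rewrite mulrC ler_pM2r// -rmorphD (addrC (ln r1)) subrK.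
Qed.

(** Compare with a circle so small that [G] is nearly [v] on it. *)
Lemma circ_mean G (r K : R) w (v : V) : 0 < r -> ~ (0 <= w) ->
  (forall z, 0 < mag z <= r -> mag (G z) <= K) ->
  (forall z, 0 < mag z <= r -> z != w -> cdiff G z) ->
  (forall e : R, 0 < e -> exists2 d : R, 0 < d & forall z, 0 < mag z < d -> mag (G z - v) <= e) ->
  mcvg (fun n => circ n G r) v.
Proof.
move=> r0 wn GK Gd Gc e e0.
have e20 : 0 < e / 2 by rewrite divr_gt0.
have [d d0 hd] := Gc _ e20.
pose r1 := Num.min (d / 2) (r / 2).
have r10 : 0 < r1 by rewrite lt_min !divr_gt0.
have r1d : r1 <= d / 2 by rewrite ge_min lexx.
have r1r : r1 <= r / 2 by rewrite ge_min lexx orbT.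
clearbody r1.
have r1lt : r1 < r by lra.
have [N hN] : eventually_le (fun n => circ n G r - circ n G r1) (e / 2).
  apply: (@circ_diff G r1 r K w) => //.
    by move=> z /andP[a b]; apply: (GK z); rewrite b (lt_le_trans r10).
  by move=> z /andP[a b]; apply: (Gd z); rewrite b (lt_le_trans r10).
exists N => n /hN h.
apply: le_trans (magDB _ (circ n G r1) _) _; rewrite [e]splitr lerD//.
rewrite -[X in circ n G r1 - X](circ_cst n v r1) -circB.
apply: circ_bound => // z zr; apply: hd; rewrite zr r10 /=; lra.
Qed.

End Circle.

Section Mcvg.
Variables (R : realType) (V : normedModType R[i]).
Implicit Types (u v : nat -> V).

Lemma mcvg_eq u v l : (forall n, u n = v n) -> mcvg u l -> mcvg v l.
Proof. by move=> uv; rewrite (_ : u = v) //; apply/funext. Qed.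

Lemma mcvg_cst (l : V) : mcvg (fun=> l) l.
Proof. by move=> e e0; exists 0%N => n _; rewrite subrr mag0 ltW. Qed.

Lemma mcvgD u v l k : mcvg u l -> mcvg v k -> mcvg (fun n => u n + v n) (l + k).
Proof.
move=> ul vk e e0; have e2 : 0 < e / 2 by rewrite divr_gt0.
have [N1 h1] := ul _ e2; have [N2 h2] := vk _ e2.
exists (maxn N1 N2) => n; rewrite geq_max => /andP[/h1 n1 /h2 n2].
by rewrite opprD addrACA; apply: le_trans (magD _ _) _; rewrite [e]splitr lerD.
Qed.

Lemma mcvgZ (a : R[i]) u l : mcvg u l -> mcvg (fun n => a *: u n) (a *: l).
Proof.
move=> ul e e0; have a1 : 0 < mag a + 1 by rewrite ltr_wpDl// mag_ge0.
have [N h] := ul _ (divr_gt0 e0 a1); exists N => n /h hn.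
rewrite -scalerBr magZ; apply: le_trans (ler_wpM2l (mag_ge0 a) hn) _.
by rewrite mulrA ler_pdivrMr// mulrC ler_pM2l// lerDl.
Qed.

Lemma mcvgN u l : mcvg u l -> mcvg (fun n => - u n) (- l).
Proof.
by move=> ul e /ul[N h]; exists N => n /h; rewrite -opprD magN.
Qed.

Lemma mcvgB u v l k : mcvg u l -> mcvg v k -> mcvg (fun n => u n - v n) (l - k).
Proof. by move=> ul vk; apply: mcvgD => //; apply: mcvgN. Qed.

Lemma mcvg_bound u l (M : R) : (forall n, mag (u n) <= M) -> mcvg u l -> mag l <= M.
Proof.
move=> uM ul; apply/ler_addgt0Pl => e e0; have [N /(_ N (leqnn _)) h] := ul e e0.
have := mag_subl l (u N); rewrite magB.
have := uM N; lra.
Qed.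

Lemma mcvg_unique u l k : mcvg u l -> mcvg u k -> l = k.
Proof.
move=> ul uk; apply/eqP; rewrite -subr_eq0; apply/eqP/mag0_eq/eqP.
rewrite eq_le mag_ge0 andbT.
have := mcvgB ul uk; apply: mcvg_bound => n.
by rewrite subrr mag0.
Qed.

Definition mcauchy u := forall e : R, 0 < e ->
  exists N, forall m n, (N <= m)%N -> (N <= n)%N -> mag (u m - u n) <= e.

End Mcvg.

Lemma mcauchy_mcvg (R : realType) (V : completeNormedModType R[i]) (u : nat -> V) :
  mcauchy u -> exists l, mcvg u l.
Proof.
move=> uc.
have : cvg (u @ \oo).
  apply: cauchy_cvg; apply: cauchy_exP => e e0.
  have er : e = (complex.Re e)%:C by rewrite RRe_real// gtr0_real.
  have re0 : 0 < complex.Re e by rewrite -ltcR -er.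
  have [|N hN] := uc (complex.Re e / 2); first by rewrite divr_gt0.
  exists (u N); exists N => // m /= Nm.
  rewrite -ball_normE /= er magE ltcR.
  by apply: le_lt_trans (hN _ _ (leqnn _) Nm) _; lra.
move=> uv; exists (lim (u @ \oo)) => e e0.
have /cvgrPdist_le /(_ e%:C) := uv; rewrite ltcR => /(_ e0)[N _ hN].
by exists N => n Nn; rewrite magB -lecR -magE; apply: hN.
Qed.

Section Kernels.
Variable R : realType.
Implicit Types (r : R) (w z : R[i]).

Lemma conjcM (a b : R[i]) : ((a * b)^*)%C = ((a^*)%C * (b^*)%C).
Proof. exact: rmorphM. Qed.
Lemma conjcD (a b : R[i]) : ((a + b)^*)%C = ((a^*)%C + (b^*)%C).
Proof. exact: rmorphD. Qed.
Lemma conjcB (a b : R[i]) : ((a - b)^*)%C = ((a^*)%C - (b^*)%C).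
Proof. exact: rmorphB. Qed.
Lemma conjcV (a : R[i]) : ((a^-1)^*)%C = ((a^*)%C)^-1.
Proof. exact: fmorphV. Qed.
Lemma conjcX (a : R[i]) k : ((a ^+ k)^*)%C = ((a^*)%C) ^+ k.
Proof. exact: rmorphXn. Qed.
Lemma conjc_one : ((1 : R[i])^*)%C = 1.
Proof. exact: rmorph1. Qed.

Lemma avg_conj n (F : R[i] -> R[i]^o) z d :
  avg n (fun x => ((F x)^*)%C : R[i]^o) z d = ((avg n F z d)^*)%C.
Proof.
elim: n z d => [//|n IH] z d /=; rewrite !IH -!rmorphD /=.
rewrite -[LHS]/(2^-1 * (avg n F z (d / 2) + avg n F (z + d / 2) (d / 2))^*)%C.
by rewrite -[X in (X^*)%C]/(2^-1 * (avg n F z (d / 2) + avg n F (z + d / 2) (d / 2))) rmorphM fmorphV rmorph_nat.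
Qed.

Lemma avg_scalel n (V : normedModType R[i]) (a : R[i] -> R[i]^o) (v : V) z d :
  avg n (fun x => a x *: v) z d = (avg n a z d : R[i]) *: v.
Proof.
by elim: n z d => [//|n IH] z d /=; rewrite !IH -scalerDl scalerA.
Qed.

Lemma not_ge0_N1 : ~ (0 <= (-1 : R[i])).
Proof. by rewrite oppr_ge0 ler10. Qed.

Lemma circ_holo (V : normedModType R[i]) (G : R[i] -> V) r (K : R) : 0 < r ->
  (forall z, mag z <= r -> mag (G z) <= K) -> (forall z, mag z <= r -> cdiff G z) ->
  mcvg (fun n => circ n G r) (G 0).
Proof.
move=> r0 GK Gd; apply: (@circ_mean _ _ _ _ K (-1)) => //.
- exact: not_ge0_N1.
- by move=> z /andP[_]; apply: GK.
- by move=> z /andP[_ /Gd].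
- move=> e e0; have [|d d0 hd] := @cdiff_ccont _ _ G 0 _ e e0.
    by apply: Gd; rewrite mag0 ltW.
  by exists d => // z /andP[_ zd]; apply: hd; rewrite subr0.
Qed.

Lemma circ_holo_conj (G : R[i] -> R[i]^o) r (K : R) : 0 < r ->
  (forall z, mag z <= r -> mag (G z) <= K) -> (forall z, mag z <= r -> cdiff G z) ->
  mcvg (fun n => circ n (fun z => ((G z)^*)%C : R[i]^o) r) ((G 0)^*)%C.
Proof.
move=> r0 GK Gd e e0; have [N hN] := circ_holo r0 GK Gd e0.
exists N => n /hN; rewrite /circ avg_conj -rmorphB.
by rewrite [X in _ -> X <= _]mag_conj.
Qed.

Lemma cdiffX k z : cdiff (fun x => x ^+ k : R[i]^o) z.
Proof.
elim: k => [|k IH]; first exact: cdiff_cst.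
apply: (@cdiff_eq _ _ (fun x => (x : R[i]^o) *: (x ^+ k : R[i]^o))).
  by move=> x; rewrite exprS.
by apply: cdiffZ => //; apply: cdiff_id.
Qed.

Lemma circ_expn k r : 0 < r -> mcvg (fun n => circ n (fun z => z ^+ k.+1 : R[i]^o) r) 0.
Proof.
move=> r0; have := @circ_holo R[i]^o (fun z => z ^+ k.+1) r (r ^+ k.+1) r0.
rewrite expr0n /=; apply.
  by move=> z zr; rewrite [mag _]magX lerXn2r ?nnegrE ?mag_ge0// ltW.
by move=> z _; apply: cdiffX.
Qed.

Lemma circ_expn_conj k r : 0 < r ->
  mcvg (fun n => circ n (fun z => ((z ^+ k.+1)^*)%C : R[i]^o) r) 0.
Proof.
move=> r0; have := @circ_holo_conj (fun z => z ^+ k.+1) r (r ^+ k.+1) r0.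
rewrite expr0n /= oppr0; apply.
  by move=> z zr; rewrite [mag _]magX lerXn2r ?nnegrE ?mag_ge0// ltW.
by move=> z _; apply: cdiffX.
Qed.

Lemma conj_circle z : (z^*)%C * z = (mag z ^+ 2)%:C.
Proof. by case: z => x y; rewrite mag_sqr /=; apply: complexP2 => /=; ring. Qed.

(** On the circle the Cauchy kernel is the conjugate of a function holomorphic
    in the closed disc, so its averages tend to the conjugate of the value of
    that function at the centre. *)
Lemma circ_kernel r w : 0 < r -> mag w < r ->
  mcvg (fun n => circ n (fun z => z / (z - w) : R[i]^o) r) 1.
Proof.
move=> r0 wr.
pose H z : R[i]^o := (1 - (w^*)%C / (r ^+ 2)%:C * z)^-1.
have r2 : (r ^+ 2)%:C != 0 :> R[i].
  by rewrite -mag_gt0 magR ger0_norm ?exprn_gt0// exprn_ge0// ltW.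
pose q := mag w / r.
have q1 : q < 1 by rewrite ltr_pdivrMr// mul1r.
have lb z : mag z <= r -> 1 - q <= mag (1 - (w^*)%C / (r ^+ 2)%:C * z).
  move=> zr; have := mag_subl 1 ((w^*)%C / (r ^+ 2)%:C * z); rewrite mag1.
  apply: le_trans; rewrite lerD2l lerN2 !magM magV mag_conj magR ger0_norm ?exprn_ge0 ?(ltW r0)//.
  rewrite /q expr2 invfM mulrA -mulrA; apply: ler_piMr.
    by rewrite divr_ge0 ?mag_ge0// ltW.
  by rewrite mulrC ler_pdivrMr// mul1r.
have nz z : mag z <= r -> 1 - (w^*)%C / (r ^+ 2)%:C * z != 0.
  by move=> /lb h; rewrite -mag_gt0 (lt_le_trans _ h)// subr_gt0.
have := @circ_holo_conj H r (1 - q)^-1 r0.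
have H0 : ((H 0)^*)%C = 1 by rewrite /H mulr0 subr0 invr1 rmorph1.
rewrite H0 => h.
apply: mcvg_eq (h _ _).
- move=> n; apply: circ_eq => // z zr; rewrite /H conjcV conjcB conjc_one !conjcM conjcV conjcK conjc_real.
  have z0 : z != 0 by rewrite -mag_gt0 zr.
  have zw : z - w != 0.
    by rewrite subr_eq0; apply/eqP => zw; move: wr; rewrite -zw zr ltxx.
  have E : (r ^+ 2)%:C = (z^*)%C * z by rewrite conj_circle zr.
  have zc0 : (z^*)%C != 0 by rewrite conjc_eq0.
  rewrite E; field.
  by rewrite zw z0 zc0.
- move=> z zr; rewrite /H [mag _]magV lef_pV2 ?posrE ?lb// ?subr_gt0//.
  by rewrite mag_gt0 nz.
- move=> z zr; apply: (@cdiff_comp _ _ (fun x => x^-1 : R[i]^o) (fun x => 1 - (w^*)%C / (r ^+ 2)%:C * x)).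
    apply: cdiffB; first exact: cdiff_cst.
    apply: (@cdiffZ _ R[i]^o (fun=> _) (fun x => x)); first exact: cdiff_cst.
    exact: cdiff_id.
  by apply: cdiff_inv; apply: nz.
Qed.

End Kernels.

(** * Cauchy's formula and Taylor expansions *)

Section Taylor.
Variables (R : realType) (V : completeNormedModType R[i]).
Implicit Types (g : R[i] -> V) (r K : R).

(** What is left of the Cauchy kernel after [m] steps of its expansion in
    powers of [w / z]. *)
Definition cker g m (w z : R[i]) : V := (z ^- m * (z / (z - w))) *: g z.

(** The function [z / (z - w) *: (g z - g w)] is bounded, is differentiable
    except at [w], and tends to zero at the origin; its averages tend to zero,
    which leaves those of [z / (z - w) *: g w]. *)
Lemma cauchy_formula g r K w : 0 < r -> mag w < r -> ~ (0 <= w) ->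
  (forall z, mag z <= r -> mag (g z) <= K) -> (forall z, mag z <= r -> cdiff g z) ->
  mcvg (fun n => circ n (cker g 0 w) r) (g w).
Proof.
move=> r0 wr wn gK gd.
have K0 : 0 <= K by apply: le_trans (mag_ge0 _) (gK w (ltW wr)).
have w0 : 0 < mag w by rewrite mag_gt0; apply/eqP => ww; apply: wn; rewrite ww.
pose G z : V := (z / (z - w) : R[i]^o) *: (g z - g w).
have [l hl] := gd w (ltW wr).
have [d d0 hd] := hl 1 ltr01.
have GB z : mag (g z - g w) <= 2 * K -> mag z <= r ->
    mag (G z) <= r * ((mag l + 1) + 2 * K / d).
  move=> gz zr; rewrite /G magZ.
  have [zd|zd] := ltP (mag (z - w)) d.
    have := hd _ zd; rewrite (addrC w) subrK mul1r => h1.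
    have h2 : mag (g z - g w) <= mag (z - w) * (mag l + 1).
      have := magD (g z - g w - (z - w) *: l) ((z - w) *: l).
      rewrite subrK magZ; lra.
    have [->|zw] := eqVneq z w.
      rewrite !subrr mag0 mulr0 mulr_ge0 ?addr_ge0 ?mag_ge0 ?(ltW r0)//.
      by rewrite divr_ge0 ?mulr_ge0// ltW.
    have mzw : 0 < mag (z - w) by rewrite mag_gt0 subr_eq0.
    rewrite [mag _]magM magV -mulrA; apply: ler_pM => //; rewrite ?mag_ge0//.
      by rewrite mulr_ge0 ?invr_ge0 ?mag_ge0.
    rewrite mulrC ler_pdivrMr// mulrC; apply: le_trans h2 _; rewrite ler_wpM2l ?mag_ge0// lerDl.
    by rewrite divr_ge0 ?mulr_ge0// ltW.
  rewrite [mag _]magM magV -mulrA; apply: ler_pM => //; rewrite ?mag_ge0//.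
    by rewrite mulr_ge0 ?invr_ge0 ?mag_ge0.
  apply: (@le_trans _ _ (2 * K / d)); last by rewrite lerDr addr_ge0 ?mag_ge0.
  rewrite mulrC; apply: ler_pM => //; rewrite ?mag_ge0 ?invr_ge0 ?mag_ge0//.
  by rewrite lef_pV2 ?posrE// (lt_le_trans d0).
have g2K z : mag z <= r -> mag (g z - g w) <= 2 * K.
  move=> zr; apply: le_trans (magD _ _) _; rewrite magN.
  have := gK _ zr; have := gK _ (ltW wr); lra.
have Gm : mcvg (fun n => circ n G r) 0.
  apply: (@circ_mean _ _ _ _ (r * ((mag l + 1) + 2 * K / d)) w) => //.
  - by move=> z /andP[_ zr]; apply: GB => //; apply: g2K.
  - move=> z /andP[_ zr] zw; apply: cdiffZ; last first.
      by apply: cdiffB; [exact: gd|exact: cdiff_cst].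
    apply: (@cdiffZ _ R[i]^o (fun x => x) (fun x => (x - w)^-1)); first exact: cdiff_id.
    apply: (@cdiff_comp _ _ (fun x => x^-1 : R[i]^o) (fun x => x - w)).
      by apply: cdiffB; [exact: cdiff_id|exact: cdiff_cst].
    by apply: cdiff_inv; rewrite subr_eq0.
  - move=> e e0; pose A := 4 * K / mag w + 1.
    have A0 : 0 < A by rewrite ltr_wpDl// divr_ge0 ?mulr_ge0// ltW.
    exists (Num.min (mag w / 2) (Num.min r (e / A))).
      by rewrite !lt_min r0 !divr_gt0.
    move=> z; rewrite !lt_min => /andP[z0 /andP[z1 /andP[z2 z3]]].
    rewrite subr0 /G magZ [mag _]magM magV.
    have zw : mag w / 2 <= mag (z - w).
      have := mag_subl w z; rewrite magB; lra.
    have zw0 : 0 < mag (z - w) by apply: lt_le_trans zw; rewrite divr_gt0.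
    have h1 := g2K _ (ltW z2).
    have h2 : (mag (z - w))^-1 * mag (g z - g w) <= A.
      apply: (@le_trans _ _ (4 * K / mag w)); last by rewrite lerDl.
      have -> : 4 * K / mag w = (mag w / 2)^-1 * (2 * K) by field; rewrite gt_eqF.
      apply: ler_pM => //; rewrite ?invr_ge0 ?mag_ge0//.
      by rewrite lef_pV2 ?posrE// divr_gt0.
    rewrite -mulrA; apply: le_trans (ler_wpM2l (mag_ge0 z) h2) _.
    by rewrite -ler_pdivlMr// ltW.
have := @circ_kernel R r w r0 wr => hk.
have hk2 : mcvg (fun n => (circ n (fun z => z / (z - w) : R[i]^o) r : R[i]) *: g w) (g w).
  have B1 : 0 < mag (g w) + 1 by rewrite ltr_wpDl// mag_ge0.
  move=> e e0; have [N hN] := hk _ (divr_gt0 e0 B1); exists N => n /hN hn.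
  rewrite -{2}(scale1r (g w)) -scalerBl magZ.
  apply: le_trans (ler_wpM2r (mag_ge0 _) hn) _.
  by rewrite mulrAC ler_pdivrMr// ler_pM2l// lerDl.
have := mcvgD Gm hk2; rewrite add0r; apply: mcvg_eq => n.
rewrite (_ : _ *: g w = circ n (fun z => (z / (z - w) : R[i]^o) *: g w) r); last first.
  by rewrite /circ -avg_scalel.
rewrite -circD; apply: circ_eq => // z zr.
by rewrite /cker /G expr0 invr1 mul1r scalerBr subrK.
Qed.

Lemma cker_split g m w z : z != 0 -> z != w ->
  cker g m w z = z ^- m *: g z + w *: cker g m.+1 w z.
Proof.
move=> z0 zw; rewrite /cker scalerA -scalerDl; congr (_ *: _).
rewrite exprS; field.
by rewrite z0 subr_eq0 zw expf_neq0.
Qed.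

Lemma cker_bound g m w r K n : 0 < r -> mag w < r ->
  (forall z, mag z <= r -> mag (g z) <= K) ->
  mag (circ n (cker g m w) r) <= r ^- m * (r / (r - mag w)) * K.
Proof.
move=> r0 wr gK; apply: circ_bound => // z zr.
have rw : 0 < r - mag w by rewrite subr_gt0.
have zw : r - mag w <= mag (z - w) by rewrite -zr mag_subl.
have zw0 : 0 < mag (z - w) by rewrite (lt_le_trans rw).
rewrite /cker magZ !magM !magV magX zr; apply: ler_pM; rewrite ?mag_ge0//.
- by rewrite !mulr_ge0 ?invr_ge0 ?exprn_ge0 ?mag_ge0 ?(ltW r0).
- apply: ler_pM; rewrite ?invr_ge0 ?exprn_ge0 ?(ltW r0)//.
    by rewrite mulr_ge0 ?invr_ge0 ?mag_ge0 ?(ltW r0).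
  by apply: ler_wpM2l; [exact: ltW|rewrite lef_pV2].
- by apply: gK; rewrite zr.
Qed.

(** The Taylor coefficients are limits of Cauchy sums. Expanding the kernel
    step by step, the sum for the [m]-th coefficient differs from the [m]-th
    remainder at [w] by [O(w)], which forces it to be a Cauchy sequence. *)
Lemma taylor_step g r K m : 0 < r ->
  (forall z, mag z <= r -> mag (g z) <= K) ->
  (forall w, mag w < r -> ~ (0 <= w) -> exists l, mcvg (fun n => circ n (cker g m w) r) l) ->
  exists2 c, mcvg (fun n => circ n (fun z => z ^- m *: g z) r) c &
    forall w, mag w < r -> ~ (0 <= w) -> forall l,
      mcvg (fun n => circ n (cker g m w) r) l ->
      mcvg (fun n => circ n (cker g m.+1 w) r) (w^-1 *: (l - c)).
Proof.
move=> r0 gK ex.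
have K0 : 0 <= K by apply: le_trans (mag_ge0 _) (gK 0 _); rewrite mag0 ltW.
have E n w : mag w < r -> circ n (cker g m w) r =
    circ n (fun z => z ^- m *: g z) r + w *: circ n (cker g m.+1 w) r.
  move=> wr; rewrite -circZ -circD; apply: circ_eq => // z zr; apply: cker_split.
    by rewrite -mag_gt0 zr.
  by apply/eqP => zw; move: wr; rewrite -zw zr ltxx.
(* Choose [w] so small that the remainder term in [E] is negligible; then the
   sums follow a convergent sequence. *)
have [c hc] : exists c, mcvg (fun n => circ n (fun z => z ^- m *: g z) r) c.
  apply: mcauchy_mcvg => e e0.
  pose B := r ^- m.+1 * (r / (r - r / 2)) * K + 1.
  have B0 : 0 < B.
    rewrite ltr_wpDl// mulr_ge0// mulr_ge0 ?invr_ge0 ?exprn_ge0 ?(ltW r0)//.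
    by rewrite divr_ge0 ?(ltW r0)// subr_ge0; lra.
  pose s := Num.min (r / 2) (e / (4 * B)).
  have s0 : 0 < s by rewrite lt_min !divr_gt0// mulr_gt0.
  have sr : s <= r / 2 by rewrite ge_min lexx.
  have sB : s * (4 * B) <= e by rewrite -ler_pdivlMr ?mulr_gt0// ge_min lexx orbT.
  clearbody s.
  pose w : R[i] := - s%:C.
  have mw : mag w = s by rewrite magN magR gtr0_norm.
  have wr : mag w < r by rewrite mw; lra.
  have wn : ~ 0 <= w by rewrite oppr_ge0 -[0]/(0%:C) lecR leNgt s0.
  have wE n : mag (w *: circ n (cker g m.+1 w) r) <= e / 4.
    rewrite magZ mw; apply: le_trans (ler_wpM2l (ltW s0) (cker_bound m.+1 n r0 wr gK)) _.
    apply: (@le_trans _ _ (s * B)); last by lra.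
    apply: ler_wpM2l; first exact: ltW.
    apply: ler_wpDr => //; apply: ler_wpM2r => //; apply: ler_wpM2l.
      by rewrite invr_ge0 exprn_ge0// ltW.
    apply: ler_wpM2l; first exact: ltW.
    by rewrite lef_pV2 ?posrE ?subr_gt0 ?mw//; lra.
  have [l hl] := ex w wr wn.
  have e4 : 0 < e / 4 by rewrite divr_gt0.
  have [N hN] := hl _ e4.
  exists N => p q /hN hp /hN hq.
  have A n : circ n (fun z => z ^- m *: g z) r - l =
      (circ n (cker g m w) r - l) - w *: circ n (cker g m.+1 w) r.
    by rewrite (E n w wr) addrAC addrK.
  have bA n : mag (circ n (cker g m w) r - l) <= e / 4 ->
      mag (circ n (fun z => z ^- m *: g z) r - l) <= e / 2.
    move=> h; rewrite A; apply: le_trans (magD _ _) _; rewrite magN.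
    by have := wE n; lra.
  have := magDB (circ p (fun z => z ^- m *: g z) r) l (circ q (fun z => z ^- m *: g z) r).
  rewrite (magB l); have := bA _ hp; have := bA _ hq; lra.
exists c => // w wr wn l hl.
have w0 : w != 0 by apply/eqP => ww; apply: wn; rewrite ww.
have := mcvgZ w^-1 (mcvgB hl hc); apply: mcvg_eq => n.
by rewrite (E n w wr) addrAC subrr add0r scalerA mulVf// scale1r.
Qed.

(** The positive ray is exempt because circles are cut along it. *)
Lemma taylor_circle g r K : 0 < r ->
  (forall z, mag z <= r -> mag (g z) <= K) -> (forall z, mag z <= r -> cdiff g z) ->
  exists2 c : nat -> V, forall m, mcvg (fun n => circ n (fun z => z ^- m *: g z) r) (c m) &
    forall m w, mag w < r -> ~ (0 <= w) ->
      mag (g w - \sum_(k < m) w ^+ k *: c k) <= mag w ^+ m * (r ^- m * (r / (r - mag w)) * K).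
Proof.
move=> r0 gK gd.
have ex m : forall w, mag w < r -> ~ (0 <= w) -> exists l, mcvg (fun n => circ n (cker g m w) r) l.
  elim: m => [|m IH] w wr wn; first by exists (g w); apply: cauchy_formula gK gd.
  have [c hc h] := taylor_step r0 gK IH.
  have [l hl] := IH w wr wn.
  by exists (w^-1 *: (l - c)); apply: h.
have step m := taylor_step r0 gK (ex m).
have exc m : exists c, mcvg (fun n => circ n (fun z => z ^- m *: g z) r) c.
  by have [c hc _] := step m; exists c.
have [c cP] := choice exc.
exists c => // m w wr wn.
have w0 : w != 0 by apply/eqP => ww; apply: wn; rewrite ww.
suff [l hl ->] : exists2 l, mcvg (fun n => circ n (cker g m w) r) l &
    g w - \sum_(k < m) w ^+ k *: c k = w ^+ m *: l.
  rewrite magZ magX; apply: ler_wpM2l; first by rewrite exprn_ge0// mag_ge0.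
  by apply: (mcvg_bound _ hl) => n; apply: cker_bound.
elim: m => [|m [l hl lE]].
  exists (g w); first exact: cauchy_formula gK gd.
  by rewrite big_ord0 subr0 expr0 scale1r.
have [c' hc' h] := step m.
exists (w^-1 *: (l - c m)).
  by rewrite (mcvg_unique (cP m) hc'); apply: h.
rewrite big_ord_recr /= opprD addrA lE -scalerBr scalerA exprSr -mulrA divff//.
by rewrite mulr1.
Qed.

End Taylor.

Section Disc.
Variables (R : realType) (V : completeNormedModType R[i]).
Implicit Types (g : R[i] -> V) (r K : R).

Lemma le_limit1 (r0 x y C : R) : r0 < 1 ->
  (forall r, r0 < r -> r < 1 -> x <= y + (1 - r) * C) -> x <= y.
Proof.
move=> r01 h; apply/ler_addgt0Pl => e e0.
have C0 : 0 < `|C| + 1 by rewrite ltr_wpDl.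
pose t := Num.min ((1 - r0) / 2) (e / (`|C| + 1)).
have t0 : 0 < t by rewrite lt_min !divr_gt0// subr_gt0.
have t1 : t <= (1 - r0) / 2 by rewrite ge_min lexx.
have t2 : t * (`|C| + 1) <= e by rewrite -ler_pdivlMr// ge_min lexx orbT.
clearbody t.
have := h (1 - t); rewrite (_ : 1 - (1 - t) = t); last by ring.
move=> hh; have {hh} : x <= y + t * C by apply: hh; lra.
have : t * C <= t * (`|C| + 1).
  by apply: ler_wpM2l; [exact: ltW|apply: le_trans (ler_norm C) _; rewrite lerDl].
lra.
Qed.

Lemma bernoulli_sub r n : 0 <= r -> r <= 1 -> 1 - r ^+ n <= n%:R * (1 - r).
Proof.
move=> r0 r1; elim: n => [|n IH]; first by rewrite expr0 subrr mul0r.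
rewrite exprS -natr1.
have : 0 <= r ^+ n by rewrite exprn_ge0.
have : r ^+ n <= 1 by rewrite exprn_ile1.
set p := r ^+ n in IH *; move: IH; set q := n%:R * (1 - r) => IH p1 p0.
rewrite mulrDl -/q mul1r; nra.
Qed.

Lemma avg_weight n (F : R[i] -> V) (W : R[i] -> R) z d K :
  (forall t : R, 0 <= t < 1 -> mag (F (z + t%:C * d)) <= K * W (z + t%:C * d)) ->
  mag (avg n F z d) <= K * complex.Re (avg n (fun x => (W x)%:C : R[i]^o) z d).
Proof.
have two : (2 : R[i])^-1 = (2^-1 : R)%:C by rewrite fmorphV rmorph_nat.
have m2 : mag (2^-1 : R[i]) = 2^-1 by rewrite two magR ger0_norm ?invr_ge0.
elim: n z d => [|n IH] z d h /=.
  by have := h 0; rewrite mul0r addr0; apply; rewrite lexx ltr01.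
have h1 : mag (avg n F z (d / 2)) <= K * complex.Re (avg n (fun x => (W x)%:C : R[i]^o) z (d / 2)).
  apply: IH => t /andP[t0 t1].
  have := h (t / 2); rewrite rmorphM /= -two -mulrA [_^-1 * d]mulrC; apply.
  by apply/andP; split; lra.
have h2 : mag (avg n F (z + d / 2) (d / 2)) <=
    K * complex.Re (avg n (fun x => (W x)%:C : R[i]^o) (z + d / 2) (d / 2)).
  apply: IH => t /andP[t0 t1].
  have := h ((1 + t) / 2).
  have -> : z + ((1 + t) / 2)%:C * d = z + d / 2 + t%:C * (d / 2).
    by rewrite rmorphM rmorphD /= -two; ring.
  by apply; apply/andP; split; lra.
have ReE (x y : R[i]^o) : complex.Re (2^-1 *: (x + y)) = 2^-1 * (complex.Re x + complex.Re y).
  rewrite -[_ *: _]/(2^-1 * (x + y)) two.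
  by case: x => a b; case: y => a' b' /=; ring.
rewrite magZ m2 ReE.
have := magD (avg n F z (d / 2)) (avg n F (z + d / 2) (d / 2)); lra.
Qed.

(** Averages against the weight [2 + 2 Re (a z ^ k.+1)], which is non-negative
    when [a z ^ k.+1] has modulus one on the circle, and has mean [2] because
    powers and their conjugates have mean zero. *)
Lemma circ_weight (G : R[i] -> V) (a : R[i]) k r K l : 0 < r -> 0 <= K ->
  mag a * r ^+ k.+1 = 1 ->
  (forall z, mag z = r -> mag (G z) <= K * mag (2 + a * z ^+ k.+1 + ((a * z ^+ k.+1)^*)%C)) ->
  mcvg (fun n => circ n G r) l -> mag l <= 2 * K.
Proof.
move=> r0 K0 ar GK Gl.
pose W z : R := 2 + 2 * complex.Re (a * z ^+ k.+1).
have WE z : (W z)%:C = 2 + a * z ^+ k.+1 + ((a * z ^+ k.+1)^*)%C.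
  by rewrite /W; case: (a * _) => x y; apply: complexP2 => /=; ring.
have bd n : mag (circ n G r) <= K * complex.Re (circ n (fun x => (W x)%:C : R[i]^o) r).
  apply: avg_weight => t _; set z := cexp _.
  have zr : mag z = r by apply: mag_circ.
  apply: le_trans (GK z zr) _; apply: ler_wpM2l => //.
  rewrite -WE magR ger0_norm// /W.
  have : `|complex.Re (a * z ^+ k.+1)| <= 1.
    by apply: le_trans (mag_Re _) _; rewrite magM magX zr ar.
  by rewrite ler_norml => /andP[]; lra.
have W2 : mcvg (fun n => circ n (fun x => (W x)%:C : R[i]^o) r) 2.
  have h1 := mcvgZ a (@circ_expn R k r r0).
  have h2 := mcvgZ (a^*)%C (@circ_expn_conj R k r r0).
  have := mcvgD (mcvgD (@mcvg_cst R R[i]^o 2) h1) h2.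
  rewrite !scaler0 !addr0; apply: mcvg_eq => n.
  rewrite -!circZ -{1}(circ_cst n (2 : R[i]^o) r) -!circD; apply: circ_eq => // z _.
  by rewrite WE conjcM.
apply/ler_addgt0Pl => e e0.
have K1 : 0 < 2 * (K + 1) by rewrite mulr_gt0// ltr_wpDl.
have [N1 h1] := Gl _ (divr_gt0 e0 (ltr0Sn R 1)).
have [N2 h2] := W2 _ (divr_gt0 e0 K1).
pose n := maxn N1 N2.
have {}h1 := h1 n (leq_maxl _ _); have {}h2 := h2 n (leq_maxr _ _).
have := mag_subl l (circ n G r); rewrite magB.
have := bd n.
set ww := complex.Re _.
have : ww - 2 <= e / (2 * (K + 1)).
  apply: le_trans h2; apply: le_trans (mag_Re _); apply: le_trans (ler_norm _).
  by rewrite /ww; case: (circ _ _ _) => x y /=.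
move=> wb.
have : K * ww <= 2 * K + e / 2.
  have : K * (ww - 2) <= K * (e / (2 * (K + 1))) by apply: ler_wpM2l.
  have : K * (e / (2 * (K + 1))) <= e / 2.
    have -> : K * (e / (2 * (K + 1))) = e / 2 * (K / (K + 1)).
      by field; rewrite gt_eqF// ltr_wpDl.
    by rewrite ler_piMr ?divr_ge0 ?ltW// ltr_pdivrMr ?ltr_wpDl// mul1r ltrDl.
  lra.
lra.
Qed.

Lemma mag_bound_ge0 g K : (forall z, mag z < 1 -> mag (g z) <= K) -> 0 <= K.
Proof. by move=> gK; apply: le_trans (mag_ge0 _) (gK 0 _); rewrite mag0. Qed.

Definition taylor_tail g K (c : nat -> V) := forall m w, mag w < 1 ->
  mag (g w - \sum_(k < m) w ^+ k *: c k) <= K * mag w ^+ m / (1 - mag w).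

(** The first bound is Cauchy's estimate. The last two compare coefficients
    with one another; they come from averaging [g], multiplied by a power of
    [z], against a weight as in [circ_weight]. *)
Theorem taylor_disc g K :
  (forall z, mag z < 1 -> mag (g z) <= K) -> (forall z, mag z < 1 -> cdiff g z) ->
  exists c : nat -> V,
  [/\ forall k, mag (c k) <= K,
      taylor_tail g K c,
      forall e : R[i], mag e = 1 -> mag (2 *: c 1%N + e *: c 0%N + (e^*)%C *: c 2) <= 2 * K &
      forall (e : R[i]) k, mag e = 1 -> mag (2 *: c 0%N + (e^*)%C *: c k.+1) <= 2 * K].
Proof.
move=> gK gd; have K0 := mag_bound_ge0 gK.
have gKr r : r < 1 -> forall z, mag z <= r -> mag (g z) <= K.
  by move=> r1 z zr; apply: gK; apply: le_lt_trans r1.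
have gdr r : r < 1 -> forall z, mag z <= r -> cdiff g z.
  by move=> r1 z zr; apply: gd; apply: le_lt_trans r1.
have h0 : (0 : R) < 2^-1 by rewrite invr_gt0.
have h1 : (2^-1 : R) < 1 by rewrite invf_lt1// ltr1n.
have [c hc _] := taylor_circle h0 (gKr _ h1) (gdr _ h1).
(* Averages of [z ^- m *: g z] over two circles have the same limit, so the
   coefficients found on the circle of radius one half serve for all radii. *)
have cr r : 2^-1 < r -> r < 1 -> forall m, mcvg (fun n => circ n (fun z => z ^- m *: g z) r) (c m).
  move=> r2 r1 m; have r0 : 0 < r by apply: lt_trans r2.
  have d0 : mcvg (fun n => circ n (fun z => z ^- m *: g z) r - circ n (fun z => z ^- m *: g z) 2^-1) 0.
    move=> e e0.
    have [N hN] : eventually_le (fun n => circ n (fun z => z ^- m *: g z) r -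
        circ n (fun z => z ^- m *: g z) 2^-1) e.
      apply: (@circ_diff _ _ _ _ _ ((2^-1) ^- m * K) (-1)) => //.
      - exact: not_ge0_N1.
      - move=> z /andP[z1 z2]; rewrite magZ magV magX; apply: ler_pM; rewrite ?mag_ge0//.
          by rewrite invr_ge0 exprn_ge0// mag_ge0.
          rewrite lef_pV2 ?posrE ?exprn_gt0//; last by apply: lt_le_trans z1.
          by rewrite lerXn2r ?nnegrE ?mag_ge0// ltW.
        by apply: gKr z2.
      - move=> z /andP[z1 z2] _; apply: (@cdiffZ _ _ (fun x => x ^- m)); last exact: gdr z2.
        apply: (@cdiff_comp _ _ (fun x => x^-1 : R[i]^o) (fun x => x ^+ m : R[i]^o)).
          exact: cdiffX.
        by apply: cdiff_inv; rewrite expf_neq0// -mag_gt0 (lt_le_trans h0).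
    by exists N => n /hN; rewrite subr0.
  have := mcvgD d0 (hc m); rewrite add0r; apply: mcvg_eq => n.
  by rewrite subrK.
have tail m w r : 2^-1 < r -> r < 1 -> mag w < r -> ~ (0 <= w) ->
    mag (g w - \sum_(k < m) w ^+ k *: c k) <= mag w ^+ m * (r ^- m * (r / (r - mag w)) * K).
  move=> r2 r1 wr wn; have r0 : 0 < r by apply: lt_trans r2.
  have [c' hc' ht] := taylor_circle r0 (gKr _ r1) (gdr _ r1).
  rewrite (_ : \sum_(k < m) w ^+ k *: c k = \sum_(k < m) w ^+ k *: c' k); first exact: ht.
  by apply: eq_bigr => k _; rewrite (mcvg_unique (cr r r2 r1 k) (hc' k)).
exists c; split.
- move=> k; apply: (@le_limit1 2^-1 _ _ (k%:R * mag (c k)) h1) => r r2 r1.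
  have r0 : 0 < r by apply: lt_trans r2.
  have : mag (c k) <= r ^- k * K.
    apply: (mcvg_bound _ (cr r r2 r1 k)) => n; apply: circ_bound => // z zr.
    rewrite magZ magV magX zr; apply: ler_wpM2l; first by rewrite invr_ge0 exprn_ge0// ltW.
    by apply: gK; rewrite zr.
  rewrite mulrC ler_pdivlMr ?exprn_gt0// => h.
  have := bernoulli_sub k (ltW r0) (ltW r1); have := mag_ge0 (c k).
  move: h; set p := r ^+ k; set x := mag (c k); set n := k%:R => h x0 hb.
  have := ler_wpM2r x0 hb; lra.
- move=> m w w1.
  have w1' : 0 < 1 - mag w by rewrite subr_gt0.
  rewrite ler_pdivlMr//.
  set D := fun w => g w - \sum_(k < m) w ^+ k *: c k.
  (* Off the cut, let the radius tend to one. *)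
  have offray w' : mag w' < 1 -> ~ (0 <= w') -> mag (D w') * (1 - mag w') <= K * mag w' ^+ m.
    move=> w1'' wn.
    pose r0 := Num.max 2^-1 (mag w').
    have r01 : r0 < 1 by rewrite gt_max h1.
    apply: (@le_limit1 r0 _ _ ((1 + m%:R) * mag (D w')) r01) => r.
    rewrite gt_max => /andP[r2 wr] r1.
    have rp : 0 < r by apply: lt_trans r2.
    have rw : 0 < r - mag w' by rewrite subr_gt0.
    have := tail m w' r r2 r1 wr wn; rewrite -/(D w').
    have -> : mag w' ^+ m * (r ^- m * (r / (r - mag w')) * K) =
        (K * mag w' ^+ m * r) / ((r - mag w') * r ^+ m).
      by field; rewrite !gt_eqF ?exprn_gt0.
    rewrite ler_pdivlMr ?mulr_gt0 ?exprn_gt0// => h.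
    have := bernoulli_sub m (ltW rp) (ltW r1); have := mag_ge0 (D w').
    have A0 : 0 <= K * mag w' ^+ m by rewrite mulr_ge0// exprn_ge0// mag_ge0.
    have A1 : K * mag w' ^+ m * r <= K * mag w' ^+ m by rewrite ler_piMr// ltW.
    have p0 : 0 <= r ^+ m by rewrite exprn_ge0// ltW.
    have p1 : r ^+ m <= 1 by rewrite exprn_ile1// ltW.
    have := mag_ge0 w'.
    move: h A0 A1 p0 p1 rw; set p := r ^+ m; set x := mag (D w'); set n := m%:R; set y := mag w'.
    set A := K * y ^+ m => h A0 A1 p0 p1 rw y0 x0 hb.
    have k1 : (1 - y) - (r - y) * p <= (1 - r) * (1 + n).
      have : (r - y) * (1 - p) <= 1 * (n * (1 - r)).
        by apply: ler_pM => //; lra.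
      lra.
    have := ler_wpM2r x0 k1; lra.
  have [wn|] := pselect (~ (0 <= w)); first exact: offray.
  move/contrapT => w0.
  have [ww|ww] := eqVneq w 0.
    rewrite ww mag0 subr0 mulr1.
    case: m @D offray => [|m] D offray.
      by rewrite /D big_ord0 subr0 expr0 mulr1; apply: gK; rewrite mag0.
    rewrite /D big_ord_recl /= expr0 scale1r big1 ?addr0; last first.
      by move=> k _; rewrite /= expr0n scale0r.
    have -> : c 0%N = g 0; last by rewrite subrr mag0 expr0n mulr0.
    apply: mcvg_unique (hc 0%N) _.
    apply: mcvg_eq (circ_holo h0 (gKr _ h1) (gdr _ h1)) => n.
    by apply: circ_eq => // z _; rewrite expr0 invr1 scale1r.
  (* On the cut, approach [w] by rotating it. *)
  have Dc : ccont D w.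
    apply: cdiff_ccont; apply: cdiffB; first exact: gd.
    rewrite /D; elim: (m) => [|p IH].
      by apply: (@cdiff_eq _ _ (fun=> 0)); [move=> x; rewrite big_ord0|exact: cdiff_cst].
    apply: (@cdiff_eq _ _ (fun x => \sum_(k < p) x ^+ k *: c k + (x ^+ p : R[i]^o) *: c p)).
      by move=> x; rewrite big_ord_recr.
    apply: cdiffD => //; apply: cdiffZ; [exact: cdiffX|exact: cdiff_cst].
  apply/ler_addgt0Pl => e e0.
  have [d d0 hd] := Dc e e0.
  have mw : 0 < mag w by rewrite mag_gt0.
  have wr : w = (mag w)%:C by rewrite -magE ger0_norm.
  pose f (t : R) := cexp (0 +i* t).
  have [d' d'0 hd'] := @cdiff_ccont _ _ _ _ (cdiff_cexp (0 : R[i])) (d / (2 * mag w)) (divr_gt0 d0 (mulr_gt0 (ltr0Sn R 1) mw)).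
  pose t := Num.min (d' / 2) 1.
  have t0 : 0 < t by rewrite lt_min divr_gt0//=.
  have td : t <= d' / 2 by rewrite ge_min lexx.
  have t1 : t <= 1 by rewrite ge_min lexx orbT.
  pose w' := w * f t.
  have mf : mag (f t) = 1 by rewrite mag_cexp /= expR0.
  have mw' : mag w' = mag w by rewrite magM mf mulr1.
  have w'n : ~ (0 <= w').
    rewrite /w' wr /f /cexp /= expR0 !mul1r lecE /= => /andP[/eqP h _]; move: h.
    rewrite mul0r addr0 => h.
    have : 0 < mag w * sin t.
      rewrite mulr_gt0// sin_gt0_pi// t0 /=.
      by apply: le_lt_trans t1 _; apply: lt_le_trans (pi_ge2 R); rewrite ltr1n.
    by rewrite h ltxx.
  have := offray w'; rewrite mw' => /(_ w1 w'n) h.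
  have := hd w'; rewrite (_ : w' - w = w * (f t - 1)) ?magM; last first.
    by rewrite mulrBr mulr1.
  move=> hh.
  have {hh} : mag (D w' - D w) <= e.
    apply: hh.
    have := hd' (0 +i* t); rewrite subr0 cexp0 -/(f t) => /(_ _) h'.
    have {h'} : mag (f t - 1) <= d / (2 * mag w).
      apply: h'; rewrite mag_complex expr0n add0r sqrtr_sqr gtr0_norm//; lra.
    rewrite ler_pdivlMr ?mulr_gt0// => h'; lra.
  have := mag_subl (D w) (D w'); rewrite (magB (D w)) => h2 h3.
  have h4 : mag (D w) <= mag (D w') + e by lra.
  have := ler_wpM2r (ltW w1') h4; rewrite mulrDl.
  have : e * (1 - mag w) <= e by rewrite ler_piMr ?(ltW e0)// lerBlDr lerDl mag_ge0.
  lra.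
- move=> e e1.
  apply: (@le_limit1 2^-1 _ _ (2 * mag (c 1%N) + 2 * mag (c 2)) h1) => r r2 r1.
  have r0 : 0 < r by apply: lt_trans r2.
  have rc0 : r%:C != 0 :> R[i] by rewrite -mag_gt0 magR ger0_norm ?(ltW r0).
  have H : mag ((2 * r%:C) *: c 1%N + e *: c 0%N + ((e^*)%C * r%:C ^+ 2) *: c 2) <= 2 * K.
    pose G z : V := (2 * r%:C) *: (z ^- 1 *: g z) + e *: (z ^- 0 *: g z) +
      ((e^*)%C * r%:C ^+ 2) *: (z ^- 2 *: g z).
    apply: (@circ_weight G (e / r%:C) 0 r) => //.
    + by rewrite magM magV e1 mul1r magR (gtr0_norm r0) expr1 mulVf// gt_eqF.
    + move=> z zr.
      have z0 : z != 0 by rewrite -mag_gt0 zr.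
      have -> : G z = (r%:C / z * (2 + e / r%:C * z ^+ 1 + ((e / r%:C * z ^+ 1)^*)%C)) *: g z.
        rewrite /G !scalerA -!scalerDl; congr (_ *: _).
        rewrite expr0 invr1 !expr1 !conjcM conjcV conjc_real.
        have -> : (z^*)%C = r%:C ^+ 2 / z.
          by apply: (mulIf z0); rewrite divfK// conj_circle zr rmorphXn.
        by field; rewrite z0 rc0.
      rewrite magZ [mag (_ * (_ + _))]magM magM magV zr magR (gtr0_norm r0) divff ?gt_eqF// mul1r mulrC.
      by apply: ler_wpM2r; [exact: mag_ge0|apply: gK; rewrite zr].
    + have := mcvgD (mcvgD (mcvgZ (2 * r%:C) (cr r r2 r1 1%N)) (mcvgZ e (cr r r2 r1 0%N))) (mcvgZ ((e^*)%C * r%:C ^+ 2) (cr r r2 r1 2)).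
      by apply: mcvg_eq => n; rewrite -!circZ -!circD.
  have -> : 2 *: c 1%N + e *: c 0%N + (e^*)%C *: c 2 =
      ((2 * r%:C) *: c 1%N + e *: c 0%N + ((e^*)%C * r%:C ^+ 2) *: c 2) +
      ((2 * (1 - r)%:C) *: c 1%N + ((e^*)%C * (1 - r ^+ 2)%:C) *: c 2).
    rewrite [RHS]addrACA -[X in _ = _ + X]scalerDl [X in _ = X + _]addrAC.
    rewrite -[X in _ = X + _ + _]scalerDl; congr (_ *: _ + _ + _ *: _).
      by rewrite rmorphB rmorph1; ring.
    by rewrite rmorphB rmorph1 rmorphXn; ring.
  apply: le_trans (magD _ _) _; apply: lerD => //.
  apply: le_trans (magD _ _) _; rewrite !magZ !magM mag_conj e1 mul1r !magR mag_nat.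
  have q0 : 0 <= 1 - r ^+ 2 by rewrite subr_ge0 exprn_ile1// ltW.
  rewrite !ger0_norm// ?subr_ge0 ?(ltW r1)//.
  have := bernoulli_sub 2 (ltW r0) (ltW r1).
  have := mag_ge0 (c 2); have := mag_ge0 (c 1%N).
  set x := mag (c 1%N); set y := mag (c 2) => x0 y0 hb.
  have := ler_wpM2r y0 hb; lra.
- move=> e k e1.
  apply: (@le_limit1 2^-1 _ _ (k.+1%:R * mag (c k.+1)) h1) => r r2 r1.
  have r0 : 0 < r by apply: lt_trans r2.
  have rc0 : r%:C != 0 :> R[i] by rewrite -mag_gt0 magR ger0_norm ?(ltW r0).
  have H : mag (2 *: c 0%N + ((e^*)%C * r%:C ^+ k.+1) *: c k.+1) <= 2 * K.
    pose G z : V := 2 *: (z ^- 0 *: g z) + ((e^*)%C * r%:C ^+ k.+1) *: (z ^- k.+1 *: g z) +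
      (e / r%:C ^+ k.+1) *: ((z ^+ k.+1 : R[i]^o) *: g z).
    apply: (@circ_weight G (e / r%:C ^+ k.+1) k r) => //.
    + by rewrite magM magV e1 mul1r magX magR (gtr0_norm r0) mulVf// expf_neq0// gt_eqF.
    + move=> z zr.
      have z0 : z != 0 by rewrite -mag_gt0 zr.
      have -> : G z = (2 + e / r%:C ^+ k.+1 * z ^+ k.+1 + ((e / r%:C ^+ k.+1 * z ^+ k.+1)^*)%C) *: g z.
        rewrite /G !scalerA -!scalerDl; congr (_ *: _).
        rewrite expr0 invr1 !conjcM conjcV !conjcX conjc_real.
        have -> : (z^*)%C = r%:C ^+ 2 / z.
          by apply: (mulIf z0); rewrite divfK// conj_circle zr rmorphXn.
        rewrite exprMn exprVn -exprM mulnC exprM expr2.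
        by field; rewrite !expf_neq0.
      rewrite magZ mulrC.
      by apply: ler_wpM2r; [exact: mag_ge0|apply: gK; rewrite zr].
    + have hz : mcvg (fun n => circ n (fun z => (z ^+ k.+1 : R[i]^o) *: g z) r) 0.
        have := @circ_holo _ _ (fun z => (z ^+ k.+1 : R[i]^o) *: g z) r K r0.
        rewrite expr0n /= scale0r; apply.
          move=> z zr; rewrite magZ [mag (_ ^+ _)]magX -[K]mul1r.
          apply: ler_pM; rewrite ?exprn_ge0 ?mag_ge0//; last exact: (gKr _ r1).
          by rewrite exprn_ile1 ?mag_ge0// (le_trans zr)// ltW.
        by move=> z zr; apply: cdiffZ; [exact: cdiffX|exact: (gdr _ r1)].
      have := mcvgD (mcvgD (mcvgZ 2 (cr r r2 r1 0%N)) (mcvgZ ((e^*)%C * r%:C ^+ k.+1) (cr r r2 r1 k.+1))) (mcvgZ (e / r%:C ^+ k.+1) hz).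
      by rewrite scaler0 addr0; apply: mcvg_eq => n; rewrite -!circZ -!circD.
  have -> : 2 *: c 0%N + (e^*)%C *: c k.+1 =
      (2 *: c 0%N + ((e^*)%C * r%:C ^+ k.+1) *: c k.+1) +
      (((e^*)%C * (1 - r ^+ k.+1)%:C) *: c k.+1).
    rewrite -addrA -scalerDl; congr (_ + _ *: _).
    by rewrite rmorphB rmorph1 rmorphXn; ring.
  apply: le_trans (magD _ _) _; apply: lerD => //.
  rewrite magZ magM mag_conj e1 mul1r magR.
  have q0 : 0 <= 1 - r ^+ k.+1 by rewrite subr_ge0 exprn_ile1// ltW.
  rewrite !ger0_norm//.
  have := bernoulli_sub k.+1 (ltW r0) (ltW r1).
  have := mag_ge0 (c k.+1).
  set y := mag (c k.+1) => y0 hb.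
  have := ler_wpM2r y0 hb; lra.
Qed.

Lemma half_lt1 : (2^-1 : R) < 1.
Proof. by rewrite invf_lt1// ltr1n. Qed.

Lemma half_bound (a t : R) : 0 <= a -> t <= 2^-1 -> a / (1 - t) <= 2 * a.
Proof.
move=> a0 t2; have := half_lt1; rewrite ler_pdivrMr; last by lra.
have : a * 1 <= a * (2 * (1 - t)) by apply: ler_wpM2l => //; lra.
lra.
Qed.

Lemma tail_near g K c m w : 0 <= K -> taylor_tail g K c -> mag w <= 2^-1 ->
  mag (g w - \sum_(k < m) w ^+ k *: c k) <= 2 * K * mag w ^+ m.
Proof.
move=> K0 tl w2; apply: le_trans (tl m w (le_lt_trans w2 half_lt1)) _.
by rewrite -[leRHS]mulrA; apply: half_bound => //; rewrite mulr_ge0// exprn_ge0// mag_ge0.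
Qed.

Lemma tail_value g K c : taylor_tail g K c -> c 0%N = g 0.
Proof.
move=> tl; have := tl 1%N 0; rewrite mag0 ltr01 => /(_ isT).
rewrite big_ord1 expr0 scale1r expr1 mulr0 mul0r => h.
by apply/esym/eqP; rewrite -subr_eq0 -mag_eq0 eq_le h mag_ge0.
Qed.

(** The expansion of order two and the given derivative agree to first order. *)
Lemma tail_slope g K c l : 0 <= K -> taylor_tail g K c ->
  (forall e : R, 0 < e -> exists2 d : R, 0 < d &
    forall k, mag k < d -> mag (g k - g 0 - k *: l) <= e * mag k) -> c 1%N = l.
Proof.
move=> K0 tl hl; apply/eqP; rewrite -subr_eq0 -mag_eq0 eq_le mag_ge0 andbT.
apply/ler_addgt0Pl => e e0; rewrite addr0.
have e2 : 0 < e / 2 by rewrite divr_gt0.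
have [d d0 hd] := hl _ e2.
have K1 : 0 < K + 1 by rewrite ltr_wpDl.
pose t := Num.min (Num.min 2^-1 (d / 2)) (e / (4 * (K + 1))).
have t0 : 0 < t by rewrite !lt_min !divr_gt0 ?mulr_gt0// invr_gt0 ltr0n.
have t1 : t <= 2^-1 by rewrite !ge_min lexx.
have t2 : t <= d / 2 by rewrite !ge_min lexx !orbT.
have t3 : t * (4 * (K + 1)) <= e by rewrite -ler_pdivlMr ?mulr_gt0// !ge_min lexx !orbT.
clearbody t.
have mt : mag (t%:C : R[i]) = t by rewrite magR gtr0_norm.
have h1 : mag (g t%:C - g 0 - t%:C *: l) <= e / 2 * t.
  by have := hd t%:C; rewrite mt; apply; lra.
have h2 : mag (g t%:C - g 0 - t%:C *: c 1%N) <= 2 * K * t ^+ 2.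
  have := @tail_near g K c 2 t%:C K0 tl; rewrite mt => /(_ t1).
  by rewrite big_ord_recl big_ord1 /= expr0 scale1r expr1 (tail_value tl) opprD addrA.
have : mag (t%:C *: (c 1%N - l)) <= e / 2 * t + 2 * K * t ^+ 2.
  have -> : t%:C *: (c 1%N - l) =
      (g t%:C - g 0 - t%:C *: l) - (g t%:C - g 0 - t%:C *: c 1%N).
    by rewrite scalerBr; set X := g _ - g _; rewrite opprB [RHS]addrC addrA subrK.
  by apply: le_trans (magD _ _) _; rewrite magN lerD.
rewrite magZ mt (_ : _ + _ = t * (e / 2 + 2 * K * t)); last by ring.
rewrite ler_pM2l// => /le_trans; apply; have : t * K <= t * (K + 1) by rewrite ler_pM2l// lerDl.
lra.
Qed.

End Disc.

(** * Holomorphic maps between normed spaces *)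

Section TaylorUnique.
Variables (R : realType) (V : normedModType R[i]).

(** Let [w] tend to zero to see that the constant term vanishes, divide by
    [w], and repeat. *)
Lemma poly_flat m (b : nat -> V) (C rho : R) : 0 < rho ->
  (forall w : R[i], 0 < mag w < rho -> mag (\sum_(k < m) w ^+ k *: b k) <= C * mag w ^+ m) ->
  forall k, (k < m)%N -> b k = 0.
Proof.
elim: m b C => [//|m IH] b C rho0 h.
have b0 : b 0%N = 0.
  apply/mag0_eq/eqP; rewrite eq_le mag_ge0 andbT; apply/ler_addgt0Pl => e e0; rewrite addr0.
  pose S := \sum_(k < m) mag (b k.+1).
  have S0 : 0 <= S by apply: sumr_ge0 => k _; apply: mag_ge0.
  have A0 : 0 < `|C| + S + 1 by rewrite ltr_wpDl// addr_ge0.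
  pose t := Num.min (Num.min (rho / 2) 1) (e / (`|C| + S + 1)).
  have t0 : 0 < t by rewrite !lt_min ltr01 !divr_gt0.
  have t1 : t <= rho / 2 by rewrite !ge_min lexx.
  have t2 : t <= 1 by rewrite !ge_min lexx !orbT.
  have t3 : t * (`|C| + S + 1) <= e by rewrite -ler_pdivlMr// !ge_min lexx !orbT.
  clearbody t.
  have mt : mag (t%:C : R[i]) = t by rewrite magR gtr0_norm.
  have := h t%:C; rewrite mt t0 /= => /(_ _) hh.
  have {hh} : mag (\sum_(k < m.+1) t%:C ^+ k *: b k) <= C * t ^+ m.+1 by apply: hh; lra.
  rewrite big_ord_recl /= expr0 scale1r.
  have tS : mag (\sum_(k < m) t%:C ^+ bump 0 k *: b (bump 0 k)) <= t * S.
    apply: le_trans (mag_sum _ _ _) _; rewrite mulr_sumr; apply: ler_sum => k _.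
    rewrite magZ magX mt /bump /=; apply: ler_wpM2r; first exact: mag_ge0.
    by rewrite exprS ler_piMr ?(ltW t0)// exprn_ile1// ltW.
  have Ct : C * t ^+ m.+1 <= `|C| * t.
    apply: (@le_trans _ _ (`|C| * t ^+ m.+1)).
      by apply: ler_wpM2r; [rewrite exprn_ge0// ltW|exact: ler_norm].
    apply: ler_wpM2l => //.
    by rewrite exprS ler_piMr ?(ltW t0)// exprn_ile1// ltW.
  set X := \sum_(k < m) _ in tS *.
  have := mag_subl (b 0%N) (- X); rewrite opprK magN; lra.
have hb : forall k, (k < m)%N -> b k.+1 = 0.
  apply: (IH (fun k => b k.+1) C rho0) => w w0.
  have := h w w0; rewrite big_ord_recl /= b0 scaler0 add0r.
  have -> : \sum_(i < m) w ^+ bump 0 i *: b (bump 0 i) = w *: \sum_(i < m) w ^+ i *: b i.+1.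
    by rewrite scaler_sumr; apply: eq_bigr => i _; rewrite scalerA -exprS.
  rewrite magZ exprS mulrCA ler_pM2l//.
  by case/andP: w0.
by case=> [//|k]; rewrite ltnS => /hb.
Qed.

Lemma taylor_unique (g : R[i] -> V) (c d : nat -> V) m (C C' rho : R) : 0 < rho ->
  (forall w, mag w < rho -> mag (g w - \sum_(k < m) w ^+ k *: c k) <= C * mag w ^+ m) ->
  (forall w, mag w < rho -> mag (g w - \sum_(k < m) w ^+ k *: d k) <= C' * mag w ^+ m) ->
  forall k, (k < m)%N -> c k = d k.
Proof.
move=> rho0 hc hd k km; apply/eqP; rewrite -subr_eq0; apply/eqP.
apply: (@poly_flat m (fun k => c k - d k) (C + C') rho) => // w /andP[_ wr].
have -> : \sum_(k < m) w ^+ k *: (c k - d k) =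
    (g w - \sum_(k < m) w ^+ k *: d k) - (g w - \sum_(k < m) w ^+ k *: c k).
  rewrite opprB [RHS]addrC addrA subrK -sumrB; apply: eq_bigr => i _; exact: scalerBr.
apply: le_trans (magD _ _) _; rewrite magN mulrDl addrC.
by apply: lerD; [exact: hc|exact: hd].
Qed.

End TaylorUnique.

Section Frechet.
Variables (R : realType).
Implicit Types (V W : normedModType R[i]).

Lemma nbhs0_mag V (P : V -> Prop) : (\forall h \near (0 : V), P h) <->
  exists2 d : R, 0 < d & forall h, mag h < d -> P h.
Proof.
split=> [/nbhs_norm0P[d /= d0 hd]|[d d0 hd]].
  have dr : d = (complex.Re d)%:C by rewrite RRe_real// gtr0_real.
  exists (complex.Re d); first by rewrite -ltcR -dr.
  by move=> h hh; apply: hd; rewrite /= dr magE ltcR.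
apply/nbhs_norm0P; exists d%:C; first by rewrite /= ltcR.
by move=> h /=; rewrite magE ltcR; apply: hd.
Qed.

Lemma diff_eps V W (f : V -> W) x : differentiable f x ->
  forall e : R, 0 < e -> exists2 d : R, 0 < d &
    forall h, mag h < d -> mag (f (x + h) - f x - 'd f x h) <= e * mag h.
Proof.
move=> /diff_locallyP[_ /eqaddoP fd] e e0.
have /fd : 0 < e%:C by rewrite ltcR.
move=> /nbhs0_mag[d d0 hd]; exists d => // h /hd.
by rewrite !fctE /= (addrC h) !magE -rmorphM lecR opprD addrA.
Qed.

Lemma diff_bounded V W (f : V -> W) x : differentiable f x ->
  exists2 C : R, 0 <= C & forall h, mag ('d f x h) <= C * mag h.
Proof.
move=> /diff_continuous /(_ 0); rewrite /continuous_at linear0 => /cvgr0Pnorm_le h.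
have /h : 0 < (1%:C : R[i]) by rewrite ltcR.
move=> /nbhs0_mag[d d0 hd].
exists (2 / d); first by rewrite divr_ge0// ltW.
move=> u; have [->|u0] := eqVneq u 0; first by rewrite linear0 !mag0 mulr0.
have mu : 0 < mag u by rewrite mag_gt0.
pose a : R[i] := (d / (2 * mag u))%:C.
have a0 : 0 < d / (2 * mag u) by rewrite divr_gt0// mulr_gt0.
have ma : mag a = d / (2 * mag u) by rewrite magR gtr0_norm.
have := hd (a *: u); rewrite magZ ma linearZ /= magE lecR magZ ma.
have -> : d / (2 * mag u) * mag u = d / 2 by field; rewrite gt_eqF.
move=> hh; have {hh} : d / (2 * mag u) * mag ('d f x u) <= 1 by apply: hh; lra.
rewrite mulrC -ler_pdivlMr// => /le_trans; apply.
by rewrite le_eqVlt; apply/orP; left; apply/eqP; field; rewrite !gt_eqF.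
Qed.

Lemma continuous_linear_mag V W (L : {linear V -> W}) (C : R) :
  (forall h, mag (L h) <= C * mag h) -> continuous L.
Proof.
move=> LC x; apply/cvgrPdist_le => e e0.
have er : e = (complex.Re e)%:C by rewrite RRe_real// gtr0_real.
have re0 : 0 < complex.Re e by rewrite -ltcR -er.
have C1 : 0 < `|C| + 1 by rewrite ltr_wpDl.
apply/nbhs_ballP; exists (complex.Re e / (`|C| + 1))%:C; first by rewrite /= ltcR divr_gt0.
move=> y; rewrite -ball_normE /= magE ltcR => xy.
rewrite -linearB er magE lecR; apply: le_trans (LC _) _.
apply: (@le_trans _ _ ((`|C| + 1) * mag (x - y))).
  apply: ler_wpM2r; first exact: mag_ge0.
  by apply: le_trans (ler_norm C) _; rewrite lerDl.
by rewrite mulrC -ler_pdivlMr// ltW.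
Qed.

Lemma diff_of_eps V W (f : V -> W) x (L : {linear V -> W}) (C : R) :
  (forall h, mag (L h) <= C * mag h) ->
  (forall e : R, 0 < e -> exists2 d : R, 0 < d &
    forall h, mag h < d -> mag (f (x + h) - f x - L h) <= e * mag h) ->
  differentiable f x /\ 'd f x = L :> (V -> W).
Proof.
move=> LC hf; have Lc := continuous_linear_mag LC.
have E : f \o shift x = cst (f x) + L +o_ 0 id.
  apply/eqaddoP => e e0.
  have er : e = (complex.Re e)%:C by rewrite RRe_real// gtr0_real.
  have re0 : 0 < complex.Re e by rewrite -ltcR -er.
  apply/nbhs0_mag; have [d d0 hd] := hf _ re0; exists d => // h /hd.
  by rewrite !fctE /= (addrC h) er !magE -rmorphM lecR opprD addrA.
have dE := diff_unique Lc E.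
split=> //; apply/diff_locallyP; rewrite dE; split=> //.
Qed.

Lemma cdiff_line V W (f : V -> W) Z U (l : R[i]) : differentiable f (Z + l *: U) ->
  cdiff (fun k => f (Z + k *: U)) l.
Proof.
move=> fd; exists ('d f (Z + l *: U) U) => e e0.
have U1 : 0 < mag U + 1 by rewrite ltr_wpDl// mag_ge0.
have [d d0 hd] := diff_eps fd (divr_gt0 e0 U1).
exists (d / (mag U + 1)); first by rewrite divr_gt0.
move=> k kd; have := hd (k *: U).
rewrite scalerDl addrA linearZ /= magZ => hh; apply: le_trans (hh _) _.
  have kd2 : mag k * (mag U + 1) < d by rewrite -ltr_pdivlMr.
  by apply: le_lt_trans kd2; apply: ler_wpM2l; [exact: mag_ge0|rewrite lerDl].
rewrite mulrCA mulrC; apply: ler_wpM2r; first exact: mag_ge0.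
rewrite mulrAC ler_pdivrMr//; apply: ler_wpM2l; first exact: ltW.
by rewrite lerDl.
Qed.

Definition holo_bd V W (f : V -> W) Z (rho K : R) :=
  forall Y, mag (Y - Z) < rho -> differentiable f Y /\ mag (f Y) <= K.

End Frechet.

Section ChainRule.
Variable R : realType.

Lemma affine_diff (V W : normedModType R[i]) (L : {linear V -> W}) (b : W) (C : R) z :
  (forall h, mag (L h) <= C * mag h) ->
  differentiable (fun x => b + L x) z /\ 'd (fun x => b + L x) z = L :> (V -> W).
Proof.
move=> LC; apply: (diff_of_eps LC) => e e0; exists 1 => // h _.
have -> : b + L (z + h) - (b + L z) - L h = 0.
  by rewrite linearD opprD addrACA subrr add0r -addrA addrACA subrr add0r subrr.
by rewrite mag0 mulr_ge0 ?mag_ge0// ltW.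
Qed.

Lemma diff_chain (V W X : normedModType R[i]) (f : V -> W) (g : W -> X) z :
  differentiable f z -> differentiable g (f z) ->
  differentiable (fun x => g (f x)) z /\
  forall U, 'd (fun x => g (f x)) z U = 'd g (f z) ('d f z U).
Proof.
move=> fd gd; split; first exact: differentiable_comp.
by move=> U; have -> := diff_comp fd gd.
Qed.

End ChainRule.

Section LinearDiff.
Variables (R : realType) (V W : normedModType R[i]).

Lemma linear_diff (L : {linear V -> W}) (C : R) z :
  (forall h, mag (L h) <= C * mag h) -> differentiable L z /\ 'd L z = L :> (V -> W).
Proof.
move=> LC; have [d1 d2] := affine_diff 0 z LC.
have E : (L : V -> W) = (fun x => 0 + L x) by apply/funext => x; rewrite add0r.
by split; rewrite {1}E.
Qed.

Lemma isometry_diff (L : {linear V -> W}) z :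
  (forall h, mag (L h) = mag h) -> differentiable L z /\ 'd L z = L :> (V -> W).
Proof. by move=> Liso; apply: (@linear_diff _ 1) => h; rewrite Liso mul1r. Qed.

End LinearDiff.

Section LocalDiff.
Variables (R : realType) (V W : normedModType R[i]).

Lemma diff_local (f g : V -> W) x (e : R) : 0 < e ->
  (forall y, mag (y - x) < e -> f y = g y) -> differentiable f x ->
  differentiable g x /\ 'd g x = 'd f x :> (V -> W).
Proof.
move=> e0 fg fd; have [C _ hC] := diff_bounded fd.
apply: (diff_of_eps hC) => k k0; have [d d0 hd] := diff_eps fd k0.
exists (Num.min d e); first by rewrite lt_min d0.
move=> h; rewrite lt_min => /andP[h1 h2].
rewrite -!fg ?subrr ?mag0//; first exact: hd.
by rewrite addrC addKr.
Qed.

Lemma linear_isometry_inverse (L : {linear V -> W}) :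
  (forall z, mag (L z) = mag z) -> (forall w, exists z, L z = w) ->
  exists M : {linear W -> V}, cancel L M /\ cancel M L.
Proof.
move=> Liso onto.
have Linj : injective L.
  move=> a b ab; apply/eqP; rewrite -subr_eq0 -mag_eq0 -Liso linearB ab subrr mag0.
  exact: eqxx.
have [M0 MK] := choice onto.
have Ml : linear M0 by move=> k a b; apply: Linj; rewrite linearP !MK.
pose M : {linear W -> V} := HB.pack M0 (GRing.isLinear.Build R[i] W V _ M0 Ml).
by exists M; split=> z; [apply: Linj; exact: MK|exact: MK].
Qed.

End LocalDiff.

Section BallFunctions.
Variables (R : realType) (V : normedModType R[i]) (W : completeNormedModType R[i]).
Implicit Types (f : V -> W).

Lemma rescale (U : V) (rho : R) : 0 < rho -> U != 0 -> exists a : R[i],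
  [/\ a != 0, mag a = rho / mag U & mag (a *: U) <= rho].
Proof.
move=> rho0 u0; have mu : 0 < mag U by rewrite mag_gt0.
have ma : mag ((rho / mag U)%:C : R[i]) = rho / mag U by rewrite magR gtr0_norm// divr_gt0.
exists (rho / mag U)%:C; split=> //; first by rewrite -mag_gt0 ma divr_gt0.
by rewrite magZ ma divfK// gt_eqF.
Qed.

Lemma holo_bd_line f Z (rho K : R) U : 0 < rho -> holo_bd f Z rho K -> mag U <= rho ->
  (forall z, mag z < 1 -> mag (f (Z + z *: U)) <= K) /\
  (forall z, mag z < 1 -> cdiff (fun k => f (Z + k *: U)) z).
Proof.
move=> rho0 fK Ur.
have zr z : mag z < 1 -> mag (Z + z *: U - Z) < rho.
  rewrite (addrC Z) addrK magZ => z1.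
  have [u0|u0] := eqVneq (mag U) 0; first by rewrite u0 mulr0.
  have mu : 0 < mag U by rewrite lt_def u0 mag_ge0.
  by apply: lt_le_trans Ur; rewrite gtr_pMl.
by split=> z /zr /fK[]// h _; exact: cdiff_line.
Qed.

Lemma holo_lipschitz f Z (rho K : R) U : 0 < rho -> holo_bd f Z rho K -> mag U <= rho / 2 ->
  mag (f (Z + U) - f Z) <= 2 * K / rho * mag U.
Proof.
move=> rho0 fK Ur.
have [->|u0] := eqVneq U 0; first by rewrite addr0 subrr !mag0 mulr0.
have [a [a0 ma aU]] := rescale rho0 u0.
have [g1 g2] := holo_bd_line rho0 fK aU.
have [c [_ tl _ _]] := taylor_disc g1 g2.
have c0 := tail_value tl; rewrite scale0r addr0 in c0.
have mai : mag a^-1 = mag U / rho by rewrite magV ma invf_div.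
have ai : mag a^-1 <= 2^-1 by rewrite mai ler_pdivrMr// mulrC.
have := @tail_near _ _ _ _ _ 1 _ (mag_bound_ge0 g1) tl ai.
rewrite big_ord1 expr0 scale1r c0 scalerA mulVf// scale1r expr1 mai => /le_trans; apply.
by rewrite mulrA mulrAC.
Qed.

(** Cauchy's estimate for the disc of radius [rho] about [Z] in the direction
    of [U]. *)
Lemma holo_deriv_bound f Z (rho K : R) U : 0 < rho -> holo_bd f Z rho K ->
  mag ('d f Z U) <= K / rho * mag U.
Proof.
move=> rho0 fK.
have [->|u0] := eqVneq U 0; first by rewrite linear0 !mag0 mulr0.
have mu : 0 < mag U by rewrite mag_gt0.
have [a [a0 ma aU]] := rescale rho0 u0.
have [g1 g2] := holo_bd_line rho0 fK aU.
have [c [cK tl _ _]] := taylor_disc g1 g2.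
have fd : differentiable f Z by have [] := fK Z; rewrite ?subrr ?mag0.
have c1 : c 1%N = 'd f Z (a *: U).
  apply: (tail_slope (mag_bound_ge0 g1) tl) => e e0.
  have [d d0 hd] := diff_eps fd (divr_gt0 e0 rho0).
  exists (d / rho); first by rewrite divr_gt0.
  move=> k; rewrite ltr_pdivlMr// => kd.
  have kU : mag (k *: (a *: U)) <= mag k * rho by rewrite magZ; apply: ler_wpM2l; rewrite ?mag_ge0.
  have lin : 'd f Z (k *: (a *: U)) = k *: 'd f Z (a *: U) by exact: linearZ.
  have := hd _ (le_lt_trans kU kd); rewrite lin scale0r addr0 => /le_trans; apply.
  rewrite -mulrA; apply: ler_wpM2l; first exact: ltW.
  by rewrite mulrC ler_pdivrMr.
have := cK 1%N; rewrite c1 linearZ /= magZ ma mulrC -ler_pdivlMr ?divr_gt0//.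
by rewrite invf_div mulrA mulrAC.
Qed.

End BallFunctions.

(** * The identity theorem and Cartan's uniqueness theorem *)

Section Chain.
Variables (R : realType) (V : normedModType R[i]).

Lemma geom_le0 (x q B : R) : 0 <= q < 1 -> (forall m, x <= B * q ^+ m) -> x <= 0.
Proof.
move=> /andP[q0 q1] h; apply/ler_addgt0Pl => e e0; rewrite addr0.
have [B0|B0] := leP B 0.
  by apply: le_trans (h 0%N) _; rewrite expr0 mulr1; lra.
have [qe|qn] := eqVneq q 0.
  by apply: le_trans (h 1%N) _; rewrite qe expr1 mulr0 ltW.
have qp : 0 < q by rewrite lt_def qn.
have bern (y : R) n : 0 <= y -> 1 + n%:R * y <= (1 + y) ^+ n.
  move=> y0; elim: n => [|n IH]; first by rewrite mul0r addr0 expr0.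
  rewrite exprS -natr1.
  have : 0 <= n%:R * (y * y) by rewrite !mulr_ge0.
  have := ler_wpM2l (addr_ge0 ler01 y0) IH; rewrite mulrDl mul1r.
  set p := (1 + y) ^+ n; set r := (n%:R : R) => h1 h2; nra.
pose a := q^-1 - 1.
have a0 : 0 < a by rewrite subr_gt0 invf_gt1.
have [m mP] : exists m : nat, B / e / a < m%:R.
  exists (Num.bound (B / e / a)); apply: archi_boundP.
  by apply: divr_ge0 (ltW a0); apply: divr_ge0 (ltW B0) (ltW e0).
apply: le_trans (h m) _.
have := bern a m (ltW a0); rewrite (_ : 1 + a = q^-1) ?exprVn; last by rewrite /a; ring.
move=> hb.
have : B / e <= (q ^+ m)^-1.
  by apply: le_trans hb; apply: ltW; move: mP; rewrite ltr_pdivrMr// -/a; lra.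
by rewrite ler_pdivrMr// mulrC ler_pdivlMr ?exprn_gt0.
Qed.

Lemma telescope (U : zmodType) (a b E p q : U) :
  a + E - (p + q) = (E - p) + (b - q) + (a - b).
Proof.
rewrite -[RHS]addrA (_ : b - q + (a - b) = a - q).
  by rewrite [RHS]addrACA -opprD (addrC E).
by rewrite addrC addrA subrK.
Qed.

(** Connectedness of the unit ball, along segments: a property that is locally
    constant there holds everywhere or nowhere. *)
Lemma chain_ball (P : V -> Prop) (Z0 Z1 : V) : mag Z0 < 1 -> mag Z1 < 1 ->
  (forall Y, mag Y < 1 -> exists2 r : R, 0 < r & forall Y', mag (Y' - Y) < r -> (P Y <-> P Y')) ->
  P Z1 -> P Z0.
Proof.
move=> z0 z1 loc p1.
pose Y (s : R) : V := Z1 + s%:C *: (Z0 - Z1).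
have Y0 : Y 0 = Z1 by rewrite /Y scale0r addr0.
have Y1 : Y 1 = Z0 by rewrite /Y scale1r addrC subrK.
have op (Q : V -> Prop) : (forall Y, mag Y < 1 -> exists2 r : R, 0 < r & forall Y', mag (Y' - Y) < r -> (Q Y -> Q Y')) ->
    open [set s | mag (Y s) < 1 /\ Q (Y s)].
  move=> locQ; rewrite openE => s [/= s1 Qs]; have [r r0 hr] := locQ _ s1.
  have D0 : 0 < mag (Z0 - Z1) + 1 by rewrite ltr_wpDl// mag_ge0.
  have m0 : 0 < Num.min r (1 - mag (Y s)) by rewrite lt_min r0 subr_gt0.
  apply/nbhs_ballP; exists (Num.min r (1 - mag (Y s)) / (mag (Z0 - Z1) + 1)); first by rewrite /= divr_gt0.
  move=> t; rewrite -ball_normE /= ltr_pdivlMr// => st.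
  have : mag (Y t - Y s) < Num.min r (1 - mag (Y s)).
    apply: le_lt_trans st; rewrite /Y opprD addrACA subrr add0r -scalerBl -rmorphB magZ magR distrC.
    by apply: ler_wpM2l => //; rewrite lerDl.
  rewrite lt_min => /andP[h1 h2]; split; last exact: hr h1 Qs.
  by have := mag_subl (Y t) (Y s); lra.
pose S : set R := [set s | s \in `[0, 1] /\ P (Y s)].
have Yb s : s \in `[0, 1] -> mag (Y s) < 1.
  rewrite in_itv /= => /andP[s0 s1].
  have -> : Y s = (1 - s)%:C *: Z1 + s%:C *: Z0.
    rewrite /Y rmorphB rmorph1 scalerBl scale1r scalerBr -addrA; congr (_ + _).
    by rewrite addrC.
  apply: le_lt_trans (magD _ _) _; rewrite !magZ !magR !ger0_norm ?subr_ge0//.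
  pose M := Num.max (mag Z0) (mag Z1).
  have M1 : M < 1 by rewrite gt_max z0.
  have h1 : (1 - s) * mag Z1 <= (1 - s) * M by apply: ler_wpM2l; [rewrite subr_ge0|rewrite le_max lexx orbT].
  have h0 : s * mag Z0 <= s * M by apply: ler_wpM2l; [|rewrite le_max lexx].
  by move: h0 h1; rewrite mulrBl mul1r; lra.
suff : S = `[0%R, 1%R]%classic.
  move=> E; have : S 1 by rewrite E /= in_itv /= ler01 lexx.
  by case=> _; rewrite Y1.
apply: (@segment_connected R 0 1).
- by exists 0; split; rewrite ?Y0// in_itv /= lexx ler01.
- exists [set s | mag (Y s) < 1 /\ P (Y s)].
    by apply: op => Z /loc[r r0 hr]; exists r => // Z' /hr[].
  apply/seteqP; split=> s; first by case=> s01 Ps; split=> //; split=> //; exact: Yb.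
  by case=> s01 [_ Ps].
- exists (~` [set s | mag (Y s) < 1 /\ ~ P (Y s)]).
    by apply: open_closedC; apply: (op (fun Z => ~ P Z)) => Z /loc[r r0 hr]; exists r => // Z' /hr[h1 h2] nP /h2.
  apply/seteqP; split=> s; first by case=> s01 Ps; split=> //; case=> _; exact.
  case=> s01 nP; split=> //; apply: contrapT => nPs; apply: nP; split=> //; exact: Yb.
Qed.

End Chain.

Section Ball.
Variables (R : realType) (V : completeNormedModType R[i]).
Implicit Types (f g : V -> V).

(** The first [m] Taylor coefficients vanish, so the constant [C], valid near
    the origin only, can be traded for the bound on the disc. *)
Lemma holo_flat (W : completeNormedModType R[i]) (g : R[i] -> W) (K C rho : R) m :
  (forall z, mag z < 1 -> mag (g z) <= K) -> (forall z, mag z < 1 -> cdiff g z) ->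
  0 < rho -> (forall w, mag w < rho -> mag (g w) <= C * mag w ^+ m) ->
  forall w, mag w < 1 -> mag (g w) <= K * mag w ^+ m / (1 - mag w).
Proof.
move=> gK gd rho0 hC w w1; have K0 := mag_bound_ge0 gK.
have [c [cK tl _ _]] := taylor_disc gK gd.
pose rho' := Num.min rho 2^-1.
have r0 : 0 < rho' by rewrite lt_min rho0 invr_gt0 ltr0n.
have c0 k : (k < m)%N -> c k = 0.
  apply: (@taylor_unique _ _ g c (fun=> 0) m (2 * K) C rho') => // z; rewrite lt_min => /andP[z1 z2].
    by apply: tail_near => //; exact: ltW.
  by rewrite big1 ?subr0 => [|i _]; [exact: hC|rewrite scaler0].
have := tl m w w1; rewrite big1 ?subr0// => k _.
by rewrite c0 ?scaler0.
Qed.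

Lemma holo_flat_all (W : completeNormedModType R[i]) (g : R[i] -> W) (K rho : R) :
  (forall z, mag z < 1 -> mag (g z) <= K) -> (forall z, mag z < 1 -> cdiff g z) ->
  0 < rho -> (forall w, mag w < rho -> g w = 0) ->
  forall w, mag w < 1 -> g w = 0.
Proof.
move=> gK gd rho0 h w w1; have K0 := mag_bound_ge0 gK.
have w1' : 0 < 1 - mag w by rewrite subr_gt0.
have hm m : mag (g w) <= K * mag w ^+ m / (1 - mag w).
  apply: (@holo_flat _ g K 0 rho m) => // z zr.
  by rewrite h// mag0 mul0r.
apply/mag0_eq/eqP; rewrite eq_le mag_ge0 andbT.
apply: (@geom_le0 _ _ (mag w) (K / (1 - mag w))) => [|m]; first by rewrite mag_ge0.
by rewrite mulrAC.
Qed.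

Definition holo1 f := forall Z : V, mag Z < 1 -> differentiable f Z.

Lemma holo1_bd f (K : R) Z (rho : R) : holo1 f -> (forall Z, mag Z < 1 -> mag (f Z) <= K) ->
  mag Z <= 1 - rho -> holo_bd f Z rho K.
Proof.
move=> fd fK Zr Y YZ; have Y1 : mag Y < 1.
  by have := mag_subl Y Z; lra.
by split; [exact: fd|exact: fK].
Qed.

Lemma local_identity f g Y (rho K d : R) : 0 < rho -> 0 < d ->
  holo_bd f Y rho K -> holo_bd g Y rho K ->
  (forall Z, mag (Z - Y) < d -> f Z = g Z) -> forall X, mag (X - Y) < rho -> f X = g X.
Proof.
move=> rho0 d0 fK gK hd X XY.
have [->|xy] := eqVneq X Y; first by apply: hd; rewrite subrr mag0.
have xy' : X - Y != 0 by rewrite subr_eq0.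
have mxy : 0 < mag (X - Y) by rewrite mag_gt0.
have [a [a0 ma aU]] := rescale rho0 xy'.
have [f1 f2] := holo_bd_line rho0 fK aU.
have [g1 g2] := holo_bd_line rho0 gK aU.
pose D z := f (Y + z *: (a *: (X - Y))) - g (Y + z *: (a *: (X - Y))).
have : D a^-1 = 0.
  apply: (@holo_flat_all _ D (K + K) (d / rho)) => //.
  - move=> z z1; apply: le_trans (magD _ _) _; rewrite magN; apply: lerD; [exact: f1|exact: g1].
  - by move=> z z1; apply: cdiffB; [exact: f2|exact: g2].
  - by rewrite divr_gt0.
  - move=> w wd; rewrite /D hd ?subrr//.
    rewrite (addrC Y) addrK magZ; apply: le_lt_trans (ler_wpM2l (mag_ge0 _) aU) _.
    by rewrite -ltr_pdivlMr.
  - by rewrite magV ma invf_div ltr_pdivrMr// mul1r.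
rewrite /D scalerA mulVf// scale1r.
by rewrite (addrC Y) subrK => /eqP; rewrite subr_eq0 => /eqP.
Qed.

Lemma holo_bd_local f Y : holo1 f -> mag Y < 1 ->
  exists2 rho : R, 0 < rho & exists K, holo_bd f Y rho K.
Proof.
move=> fd Y1; have [d d0 hd] := (continuousP_mag _ _).1 (differentiable_continuous (fd _ Y1)) 1 ltr01.
exists (Num.min d (1 - mag Y)); first by rewrite lt_min d0 subr_gt0.
exists (mag (f Y) + 1) => Z; rewrite lt_min => /andP[/hd h1 h2].
split; first by apply: fd; have := mag_subl Z Y; lra.
have := mag_subl (f Z) (f Y); lra.
Qed.

Lemma holo_bd_sub f Y Y' (rho rho' K K' : R) : holo_bd f Y rho K ->
  mag (Y' - Y) + rho' <= rho -> K <= K' -> holo_bd f Y' rho' K'.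
Proof.
move=> h hr KK Z ZY; have [|h1 h2] := h Z; last by split=> //; exact: le_trans h2 KK.
by have := magDB Z Y' Y; lra.
Qed.

(** Agreement near a point is an open condition by definition. It is also
    closed: on balls of a fixed radius where both maps are bounded, agreement
    near the centre spreads to the whole ball along lines. *)
Theorem ball_identity f g Z1 (e : R) : holo1 f -> holo1 g ->
  mag Z1 < 1 -> 0 < e -> (forall Z, mag (Z - Z1) < e -> f Z = g Z) ->
  forall Z, mag Z < 1 -> f Z = g Z.
Proof.
move=> fd gd Z11 e0 fg Z0 Z01.
pose P Y := exists2 d : R, 0 < d & forall Z, mag (Z - Y) < d -> f Z = g Z.
suff [d d0 h] : P Z0 by apply: h; rewrite subrr mag0.
apply: (chain_ball Z01 Z11); last by exists e.
move=> Y Y1; have [r1 r10 [K1 h1]] := holo_bd_local fd Y1.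
have [r2 r20 [K2 h2]] := holo_bd_local gd Y1.
pose r := Num.min r1 r2; pose K := Num.max K1 K2.
have r0 : 0 < r by rewrite lt_min r10.
have rr : r <= r1 /\ r <= r2 by rewrite !ge_min !lexx orbT.
have KK : K1 <= K /\ K2 <= K by rewrite !le_max !lexx orbT.
clearbody r K; case: rr => rr1 rr2; case: KK => KK1 KK2.
exists (r / 4); first by rewrite divr_gt0.
move=> Y' YY; have YY2 := YY; rewrite magB in YY2; split=> -[d d0 hd].
  exists (r / 2); first by rewrite divr_gt0.
  move=> Z ZY; apply: (@local_identity f g Y r K d) => //.
  - by apply: holo_bd_sub h1 _ KK1; rewrite subrr mag0 add0r.
  - by apply: holo_bd_sub h2 _ KK2; rewrite subrr mag0 add0r.
  - have := magDB Z Y' Y; lra.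
exists (r / 4); first by rewrite divr_gt0.
move=> Z ZY; apply: (@local_identity f g Y' (r / 2) K d) => //; first by rewrite divr_gt0.
- by apply: holo_bd_sub h1 _ KK1; lra.
- by apply: holo_bd_sub h2 _ KK2; lra.
- have := magDB Z Y Y'; lra.
Qed.

Lemma iter_holo f n : holo1 f -> (forall Z, mag Z < 1 -> mag (f Z) < 1) ->
  holo1 (iter n f) /\ (forall Z, mag Z < 1 -> mag (iter n f Z) < 1).
Proof.
move=> fd f1; elim: n => [|n [IH1 IH2]]; first by split=> // Z _; exact: ex_diff.
split=> Z Z1 /=; last exact: f1 (IH2 _ Z1).
apply: (@differentiable_comp _ _ _ _ (iter n f) f); first exact: IH1.
by apply: fd; exact: IH2.
Qed.

(** If [r = f - id] has order [m >= 2] along a line with leading coefficient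
    [c], then the [j]-th iterate of [f] has [m]-th coefficient [j *: c], which
    Cauchy's estimate bounds for all [j]. So [r] vanishes to all orders. *)
Theorem cartan f : holo1 f -> (forall Z, mag Z < 1 -> mag (f Z) < 1) ->
  f 0 = 0 -> (forall U, 'd f 0 U = U) -> forall Z, mag Z < 1 -> f Z = Z.
Proof.
move=> fd f1 f0 df0.
pose r Z := f Z - Z.
have rd : holo1 r.
  by move=> Z Z1; apply: differentiableB; [exact: fd|exact: ex_diff].
have rK Z : mag Z < 1 -> mag (r Z) <= 2.
  by move=> Z1; apply: le_trans (magD _ _) _; rewrite magN; have := f1 _ Z1; lra.
have r0 : mag (0 : V) <= 1 - 1 by rewrite mag0 subrr.
have lin U : mag U <= 1 ->
    (forall z, mag z < 1 -> mag (r (z *: U)) <= 2) /\ (forall z, mag z < 1 -> cdiff (fun k => r (k *: U)) z).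
  move=> U1; have [h1 h2] := holo_bd_line ltr01 (holo1_bd rd rK r0) U1.
  split=> z z1; first by have := h1 z z1; rewrite add0r.
  by apply: cdiff_eq (h2 z z1) => k; rewrite add0r.
have eqW (x : R) : x = 1 -> x <= 1 by move=> ->.
have order m : forall U, mag U = 1 -> forall z : R[i], mag z < 1 ->
    mag (r (z *: U)) <= 2 * mag z ^+ m.+2 / (1 - mag z).
  elim: m => [|m IH] U U1.
    have [g1 g2] := lin U (eqW _ U1).
    have [c [cK tl _ _]] := taylor_disc g1 g2.
    have c0 : c 0%N = 0 by rewrite (tail_value tl) scale0r /r f0 subrr.
    have c1 : c 1%N = 0.
      apply: (tail_slope _ tl) => // e e0.
      have m01 : mag (0 : V) < 1 by rewrite mag0 ltr01.
      have [d d0 hd] := diff_eps (fd 0 m01) e0.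
      exists d => // k kd; have := hd (k *: U).
      by rewrite magZ U1 mulr1 add0r f0 subr0 df0 scale0r scaler0 /r f0 !subr0; apply.
    move=> z z1; have := tl 2 z z1.
    by rewrite big_ord_recl big_ord1 /= c0 c1 !scaler0 addr0 subr0.
  have [g1 g2] := lin U (eqW _ U1).
  have [c [cK tl _ _]] := taylor_disc g1 g2.
  have ck k : (k < m.+2)%N -> c k = 0.
    apply: (@taylor_unique _ _ (fun z => r (z *: U)) c (fun=> 0) m.+2 4 4 2^-1) => [|w w2|w w2].
    - by rewrite invr_gt0 ltr0n.
    - have -> : 4 = 2 * 2 :> R by ring.
      exact: (tail_near m.+2 (ler0n R 2) tl (ltW w2)).
    - rewrite big1 ?subr0 => [|i _]; last by rewrite scaler0.
      apply: le_trans (IH U U1 w (lt_trans w2 (half_lt1 R))) _.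
      have -> : 4 = 2 * 2 :> R by ring.
      rewrite -[leRHS]mulrA; apply: half_bound; last exact: ltW.
      by rewrite mulr_ge0// exprn_ge0// mag_ge0.
  suff cm : c m.+2 = 0.
    move=> z z1; have := tl m.+3 z z1; rewrite big1 ?subr0// => -[k km] _ /=.
    move: km; rewrite ltnS leq_eqVlt => /orP[/eqP->|km]; first by rewrite cm scaler0.
    by rewrite ck// scaler0.
  have rc z : mag z < 2^-1 -> mag (r (z *: U) - z ^+ m.+2 *: c m.+2) <= 4 * mag z ^+ m.+3.
    move=> z2; have := @tail_near _ _ _ _ _ m.+3 z (ler0n R 2) tl (ltW z2).
    rewrite big_ord_recr /= big1 ?add0r => [|k _]; last by rewrite ck ?scaler0.
    by move=> /le_trans; apply; rewrite le_eqVlt; apply/orP; left; apply/eqP; ring.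
  (* On the ball of radius [|z|] about [z U] the map [r] is [O(|z| ^ m.+2)],
     and hence Lipschitz with constant [O(|z| ^ m.+1)]. *)
  have rball z : 0 < mag z -> mag z < 4^-1 ->
      holo_bd r (z *: U) (mag z) (4 * (2 * mag z) ^+ m.+2).
    move=> z0 z4 Y YZ.
    have mY : mag Y <= 2 * mag z.
      have := mag_subl Y (z *: U); rewrite magZ U1; lra.
    have Y1 : mag Y < 2^-1.
      have e2 : 2 * (4^-1 : R) = 2^-1 by field.
      by rewrite -e2; lra.
    have h2 : (2^-1 : R) < 1 by rewrite invf_lt1// ltr1n.
    split; first by apply: rd; apply: lt_trans h2.
    have [->|Y0] := eqVneq Y 0.
      rewrite /r f0 subr0 mag0 mulr_ge0// exprn_ge0// mulr_ge0// ltW//.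
    have mY0 : 0 < mag Y by rewrite mag_gt0.
    pose U' : V := (mag Y)^-1%:C *: Y.
    have mU' : mag U' = 1 by rewrite magZ magR ger0_norm ?invr_ge0 ?(ltW mY0)// mulVf// gt_eqF.
    have YE : Y = (mag Y)%:C *: U' by rewrite scalerA -rmorphM divff ?gt_eqF// scale1r.
    have mYC : mag ((mag Y)%:C : R[i]) = mag Y by rewrite magR ger0_norm// mag_ge0.
    have := IH U' mU' (mag Y)%:C; rewrite mYC -YE => /(_ (lt_trans Y1 h2)) h.
    apply: le_trans h _.
    have pY : mag Y ^+ m.+2 <= (2 * mag z) ^+ m.+2.
      by apply: lerXn2r => //; rewrite nnegrE ?mag_ge0// mulr_ge0// mag_ge0.
    have : 0 <= mag Y ^+ m.+2 by rewrite exprn_ge0// mag_ge0.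
    move=> /(mulr_ge0 (ler0n R 2)) /half_bound /(_ (ltW Y1)); lra.
  have iterP j : exists2 rho : R, 0 < rho & exists C : R, 0 <= C /\ forall z : R[i], mag z < rho ->
      mag (iter j f (z *: U) - z *: U - (j%:R * z ^+ m.+2) *: c m.+2) <= C * mag z ^+ m.+3.
    elim: j => [|j [rho rho0 [C [C0 hC]]]].
      exists 1 => //; exists 0; split=> // z _.
      by rewrite /= mul0r scale0r subr0 subrr mag0 mul0r.
    pose C' := C + j%:R * mag (c m.+2) + 1.
    have C'0 : 0 < C' by rewrite ltr_wpDl// addr_ge0// mulr_ge0// mag_ge0.
    have p2 : 0 <= (2 : R) ^+ m.+2 by rewrite exprn_ge0.
    exists (Num.min (Num.min rho 4^-1) (2 * C')^-1).
      by rewrite !lt_min rho0 !invr_gt0 mulr_gt0//= ltr0n.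
    exists (C + 4 + 8 * 2 ^+ m.+2 * C'); split.
      have p8 : 0 <= 8 * (2 : R) ^+ m.+2 by rewrite mulr_ge0.
      by apply: addr_ge0; [exact: addr_ge0|exact: mulr_ge0 p8 (ltW C'0)].
    move=> z; rewrite !lt_min => /andP[/andP[z1 z2] z3].
    have [->|z0] := eqVneq z 0.
      rewrite scale0r [iter _ _ _](_ : _ = 0); last first.
        by elim: (j) => [//|p IHp]; rewrite iterS IHp.
      by rewrite !expr0n mulr0 scale0r mag0 !expr0n mulr0 !subr0 mag0.
    have mz : 0 < mag z by rewrite mag_gt0.
    have z2' : mag z < 2^-1.
      apply: lt_trans z2 _; rewrite ltf_pV2 ?posrE// ltr_nat//.
    have z1' : mag z <= 1 by apply: ltW; apply: lt_trans z2' _; rewrite invf_lt1// ltr1n.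
    have hj := hC z z1.
    set Y := iter j f (z *: U) in hj *.
    set E := Y - z *: U.
    have mE : mag E <= C' * mag z ^+ m.+2.
      have -> : E = (E - (j%:R * z ^+ m.+2) *: c m.+2) + (j%:R * z ^+ m.+2) *: c m.+2.
        by rewrite subrK.
      apply: le_trans (magD _ _) _.
      rewrite magZ magM mag_nat magX.
      have pz : 0 <= mag z ^+ m.+2 by rewrite exprn_ge0// mag_ge0.
      have pzz : mag z ^+ m.+3 <= mag z ^+ m.+2 by rewrite exprS ler_piMl.
      have := ler_wpM2l C0 pzz; rewrite /C'.
      move: hj; rewrite -/E; set x := mag (E - _); set p := mag z ^+ m.+2.
      set q := mag z ^+ m.+3; set cc := mag (c _); set n := (j%:R : R); move: pz; rewrite -/p; lra.
    have mE2 : mag E <= mag z / 2.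
      apply: le_trans mE _.
      have : mag z ^+ m.+2 <= mag z * mag z.
        by rewrite !exprS mulrA ler_piMr ?mulr_ge0 ?mag_ge0// exprn_ile1// mag_ge0.
      move=> /(ler_wpM2l (ltW C'0)) /le_trans; apply.
      rewrite mulrA mulrC; apply: ler_wpM2l; first exact: mag_ge0.
      move: z3; rewrite -[ltRHS]mul1r ltr_pdivlMr ?mulr_gt0// => z3; lra.
    have := holo_lipschitz mz (rball z mz z2) mE2.
    have -> : z *: U + E = Y by rewrite addrC subrK.
    move=> hL.
    have {}hL : mag (r Y - r (z *: U)) <= 8 * 2 ^+ m.+2 * C' * mag z ^+ m.+3.
      apply: le_trans hL _.
      apply: le_trans (ler_wpM2l _ mE) _.
        have q0 : 0 <= (2 * mag z) ^+ m.+2 by rewrite exprn_ge0// mulr_ge0// mag_ge0.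
        by apply: divr_ge0 (ltW mz); apply: mulr_ge0 => //; exact: mulr_ge0.
      rewrite exprMn.
      rewrite (_ : _ * (C' * _) = 8 * 2 ^+ m.+2 * C' * (mag z ^+ m.+1 * mag z ^+ m.+2)); last first.
        rewrite (_ : mag z ^+ m.+2 = mag z * mag z ^+ m.+1); last by rewrite exprS.
        move: (2 ^+ m.+2) (mag z ^+ m.+1) => u p.
        by field; rewrite gt_eqF.
      have p8 : 0 <= 8 * (2 : R) ^+ m.+2 by rewrite mulr_ge0.
      apply: ler_wpM2l; first exact: mulr_ge0 p8 (ltW C'0).
      rewrite -exprD; apply: ler_wiXn2l; rewrite ?mag_ge0//.
      by rewrite addSn ltnS leq_addl.
    have -> : iter j.+1 f (z *: U) - z *: U - (j.+1%:R * z ^+ m.+2) *: c m.+2 =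
        (E - (j%:R * z ^+ m.+2) *: c m.+2) + (r (z *: U) - z ^+ m.+2 *: c m.+2) +
        (r Y - r (z *: U)).
      rewrite iterS -/Y -natr1 mulrDl mul1r scalerDl /E.
      have -> : f Y = r Y + Y by rewrite /r subrK.
      by rewrite -(addrA _ Y) (telescope _ (r (z *: U))).
    apply: le_trans (magD _ _) _; rewrite mulrDl; apply: lerD => //.
    by apply: le_trans (magD _ _) _; rewrite mulrDl; apply: lerD => //; exact: rc.
  (* The iterates map the ball into itself, so that Cauchy's estimate bounds
     their coefficients by one. *)
  have cj j : j%:R * mag (c m.+2) <= 1.
    have [id1 id2] := iter_holo j fd f1.
    have id2' Z : mag Z < 1 -> mag (iter j f Z) <= 1 by move=> /id2 /ltW.
    have [h1 h2] := holo_bd_line ltr01 (holo1_bd id1 id2' r0) (eqW _ U1).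
    have [d [dK dtl _ _]] := taylor_disc h1 h2.
    have [rho rho0 [C [C0 hC]]] := iterP j.
    pose dd k : V := if k == 1%N then U else if k == m.+2 then j%:R *: c m.+2 else 0.
    suff -> : j%:R * mag (c m.+2) = mag (d m.+2) by exact: dK.
    have -> : d m.+2 = dd m.+2.
      apply: (@taylor_unique _ _ (fun z => iter j f (0 + z *: U)) d dd m.+3 2 C (Num.min rho 2^-1)) => //.
      - by rewrite lt_min rho0 invr_gt0 ltr0n.
      - move=> w; rewrite lt_min => /andP[_ w2].
        have := tail_near m.+3 ler01 dtl (ltW w2); rewrite mulr1; exact.
      - move=> w; rewrite lt_min => /andP[w2 _]; have := hC w w2.
        rewrite add0r big_ord_recr /= big_ord_recl big_ord_recl /= /dd /=.
        rewrite big1 => [|k _]; last first.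
          rewrite /bump /= !add1n /=; case: eqP => [[kk]|_]; last by rewrite scaler0.
          by have := ltn_ord k; rewrite kk ltnn.
        by rewrite scaler0 add0r addr0 expr1 eqxx opprD addrA scalerA mulrC.
    by rewrite /dd /= eqxx magZ mag_nat.
  apply/mag0_eq/eqP; rewrite eq_le mag_ge0 andbT leNgt; apply/negP => cp.
  have := cj (Num.bound (mag (c m.+2))^-1); rewrite leNgt => /negP; apply.
  rewrite -ltr_pdivrMr// div1r; apply: archi_boundP.
  by rewrite invr_ge0 ltW.
move=> Z Z1; have [->|Z0] := eqVneq Z 0; first exact: f0.
have mZ : 0 < mag Z by rewrite mag_gt0.
pose U : V := (mag Z)^-1%:C *: Z.
have mU : mag U = 1 by rewrite magZ magR ger0_norm ?invr_ge0 ?(ltW mZ)// mulVf// gt_eqF.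
have ZE : Z = (mag Z)%:C *: U by rewrite scalerA -rmorphM divff ?gt_eqF// scale1r.
have mZC : mag ((mag Z)%:C : R[i]) = mag Z by rewrite magR ger0_norm// mag_ge0.
have [g1 g2] := lin U (eqW _ mU).
suff : r Z = 0 by move=> /eqP; rewrite subr_eq0 => /eqP.
apply/mag0_eq/eqP; rewrite eq_le mag_ge0 andbT.
have Z1' : 0 < 1 - mag Z by rewrite subr_gt0.
apply: (@geom_le0 _ _ (mag Z) (2 / (1 - mag Z))) => [|m]; first by rewrite mag_ge0.
have := order m U mU (mag Z)%:C; rewrite mZC -ZE => /(_ Z1) h.
apply: le_trans h _; rewrite mulrAC; apply: ler_wpM2l; first by rewrite divr_ge0// ltW.
by rewrite !exprS mulrA ler_piMl ?exprn_ge0 ?mag_ge0// mulr_ile1 ?mag_ge0// ltW.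
Qed.

End Ball.

Section CartanPair.
Variables (R : realType) (V : completeNormedModType R[i]).

Lemma diff_conj (L M : {linear V -> V}) (f : V -> V) z :
  (forall h, mag (L h) = mag h) -> (forall h, mag (M h) = mag h) ->
  differentiable f (M z) -> differentiable (fun x => L (f (M x))) z /\
  forall U, 'd (fun x => L (f (M x))) z U = L ('d f (M z) (M U)).
Proof.
move=> Liso Miso fd.
have [dM EM] := isometry_diff z Miso.
have [dL EL] := isometry_diff (f (M z)) Liso.
have [d1 E1] := diff_chain dM fd; have [d2 E2] := diff_chain d1 dL.
split; first exact: d2.
move=> U; rewrite E2 EL; congr (L _); rewrite E1 EM.
reflexivity.
Qed.

Lemma cartan_pair (f g : V -> V) :
  holo1 f -> holo1 g -> (forall Z, mag Z < 1 -> mag (f Z) < 1) ->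
  (forall Z, mag Z < 1 -> mag (g Z) < 1) -> g (f 0) = 0 ->
  (forall U, 'd g (f 0) ('d f 0 U) = U) -> forall Z, mag Z < 1 -> g (f Z) = Z.
Proof.
move=> fh gh f1 g1 gf0 dgf; have m0 : mag (0 : V) < 1 by rewrite mag0.
have ch x (x1 : mag x < 1) := diff_chain (fh x x1) (gh (f x) (f1 x x1)).
apply: (@cartan _ _ (fun x => g (f x))) => //.
- by move=> x x1; have [] := ch x x1.
- by move=> x x1; apply: g1; exact: f1.
- by move=> U; rewrite (ch 0 m0).2 dgf.
Qed.

End CartanPair.

Section Derivative.
Variables (R : realType) (V : completeNormedModType R[i]).
Implicit Types (f g : V -> V) (Z U : V).

Lemma cancel_deriv f g Z U : holo1 f -> holo1 g ->
  (forall Y, mag Y < 1 -> mag (f Y) < 1) -> (forall Y, mag Y < 1 -> g (f Y) = Y) ->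
  mag Z < 1 -> 'd g (f Z) ('d f Z U) = U.
Proof.
move=> fh gh fb fK Z1; have [d1 E1] := diff_chain (fh Z Z1) (gh _ (fb _ Z1)).
rewrite -E1.
have [d2 E2] := @isometry_diff _ _ _ [the {linear V -> V} of idfun] Z (fun=> erefl).
have r0 : 0 < 1 - mag Z by rewrite subr_gt0.
have [|_ E3] := @diff_local _ _ _ (idfun : V -> V) (fun x => g (f x)) Z _ r0 _ d2.
  by move=> y yZ; rewrite fK//; have := mag_subl y Z; lra.
by rewrite E3 E2.
Qed.

(** The derivative [f'(0)] and its inverse [g'(0)] are contractions by
    Cauchy's estimate, hence isometries, and Cartan's theorem applies to
    [g'(0) \o f]. *)
Lemma auto_fix0_linear f g : holo1 f -> holo1 g ->
  (forall Y, mag Y < 1 -> mag (f Y) < 1) -> (forall Y, mag Y < 1 -> mag (g Y) < 1) ->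
  (forall Y, mag Y < 1 -> g (f Y) = Y) -> (forall Y, mag Y < 1 -> f (g Y) = Y) ->
  f 0 = 0 -> g 0 = 0 ->
  exists L : {linear V -> V}, [/\ forall Z, mag (L Z) = mag Z,
    forall W, exists Z, L Z = W & forall Z, mag Z < 1 -> f Z = L Z].
Proof.
move=> fh gh fb gb fK gK f0 g0.
have m0 : mag (0 : V) < 1 by rewrite mag0.
have m1 : mag (0 : V) <= 1 - 1 by rewrite mag0 subrr.
have bnd (k : V -> V) : holo1 k -> (forall Y, mag Y < 1 -> mag (k Y) < 1) -> forall U, mag ('d k 0 U) <= mag U.
  move=> kh kb U.
  have K1 Z : mag Z < 1 -> mag (k Z) <= 1 by move=> Z1; exact: ltW (kb _ Z1).
  by have := holo_deriv_bound U ltr01 (holo1_bd kh K1 m1); rewrite divr1 mul1r.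
have gfK U : 'd g 0 ('d f 0 U) = U by have := cancel_deriv U fh gh fb fK m0; rewrite f0.
have fgK U : 'd f 0 ('d g 0 U) = U by have := cancel_deriv U gh fh gb gK m0; rewrite g0.
have giso U : mag ('d g 0 U) = mag U.
  by apply/eqP; rewrite eq_le (bnd _ gh gb)/= -{1}(fgK U) (bnd _ fh fb).
have fiso U : mag ('d f 0 U) = mag U.
  by apply/eqP; rewrite eq_le (bnd _ fh fb)/= -{1}(gfK U) (bnd _ gh gb).
pose L : {linear V -> V} := 'd f 0; pose M : {linear V -> V} := 'd g 0.
have Md Z := isometry_diff Z giso : differentiable M Z /\ 'd M Z = M :> (V -> V).
have Mh : holo1 M by move=> Z _; have [] := Md Z.
have Mb Y : mag Y < 1 -> mag (M Y) < 1 by rewrite giso.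
have Mf0 : M (f 0) = 0 by rewrite f0 linear0.
have dM U : 'd M (f 0) ('d f 0 U) = U by rewrite (Md _).2; exact: gfK.
exists L; split=> [|W|Z Z1]; first exact: fiso.
  by exists (M W); exact: fgK.
have E : M (f Z) = Z := cartan_pair fh Mh fb Mb Mf0 dM Z1.
by rewrite -{2}E [RHS]fgK.
Qed.

End Derivative.

(** * Curves and second differences *)

Section Curves.
Variables (R : realType) (V W : normedModType R[i]).

Definition velocity (U : normedModType R[i]) (p : R[i] -> U) (b : U) :=
  forall e : R, 0 < e -> exists2 d : R, 0 < d &
    forall t, mag t < d -> mag (p t - p 0 - t *: b) <= e * mag t.

Lemma velocity_line (Z : V) : velocity (fun t => t *: Z) Z.
Proof.
move=> e e0; exists 1 => // t _.
by rewrite scale0r subr0 subrr mag0 mulr_ge0 ?mag_ge0// ltW.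
Qed.

Lemma velocity_bound (p : R[i] -> V) b : velocity p b ->
  exists2 d : R, 0 < d & forall t, mag t < d -> mag (p t - p 0) <= (mag b + 1) * mag t.
Proof.
move=> hp; have [d d0 hd] := hp 1 ltr01; exists d => // t /hd h.
have -> : p t - p 0 = (p t - p 0 - t *: b) + t *: b by rewrite subrK.
apply: le_trans (magD _ _) _; rewrite magZ mulrDl mul1r addrC mulrC.
by rewrite lerD2l -[leRHS]mul1r.
Qed.

Lemma velocity_near (p : R[i] -> V) b (r : R) : velocity p b -> 0 < r ->
  exists2 d : R, 0 < d & forall t, mag t < d -> mag (p t - p 0) < r.
Proof.
move=> hp r0; have [d d0 hd] := velocity_bound hp.
have B0 : 0 < mag b + 1 by rewrite ltr_wpDl// mag_ge0.
exists (Num.min d (r / (mag b + 1))); first by rewrite lt_min d0 divr_gt0.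
move=> t; rewrite lt_min ltr_pdivlMr// => /andP[/hd h1 h2].
by apply: le_lt_trans h1 _; rewrite mulrC.
Qed.

Lemma velocity_quotient (p : R[i] -> V) b (e : R) : velocity p b -> p 0 = 0 -> 0 < e ->
  exists2 d : R, 0 < d & forall t, t != 0 -> mag t < d -> mag (t^-1 *: p t - b) < e.
Proof.
move=> hp p0 e0; have e2 : 0 < e / 2 by rewrite divr_gt0.
have [d d0 hd] := hp _ e2; exists d => // t t0 /hd; rewrite p0 subr0 => h.
have mt : 0 < mag t by rewrite mag_gt0.
have -> : t^-1 *: p t - b = t^-1 *: (p t - t *: b).
  by rewrite scalerBr scalerA mulVf// scale1r.
rewrite magZ magV mulrC ltr_pdivrMr//; apply: le_lt_trans h _.
by rewrite ltr_pM2r// ltr_pdivrMr// mulr_natr mulr2n ltrDl.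
Qed.

Lemma diff_linear (g : V -> W) x X Y s :
  'd g x (X + s *: Y) = 'd g x X + s *: 'd g x Y.
Proof. by rewrite linearD linearZ. Qed.

Lemma velocity_comp (p : R[i] -> V) b (g : V -> W) x : velocity p b -> p 0 = x ->
  differentiable g x -> velocity (fun t => g (p t)) ('d g x b).
Proof.
move=> hp <- gd e e0; have b1 : 0 < mag b + 1 by rewrite ltr_wpDl// mag_ge0.
have [C C0 hC] := diff_bounded gd; have C1 : 0 < C + 1 by rewrite ltr_wpDl.
have e1 : 0 < e / (2 * (mag b + 1)) by rewrite divr_gt0// mulr_gt0.
have e2 : 0 < e / (2 * (C + 1)) by rewrite divr_gt0// mulr_gt0.
have [d1 d10 h1] := diff_eps gd e1; have [d2 d20 h2] := hp _ e2.
have [d3 d30 h3] := velocity_bound hp.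
exists (Num.min (Num.min d2 d3) (d1 / (mag b + 1))); first by rewrite !lt_min d20 d30 divr_gt0.
move=> t; rewrite !lt_min => /andP[/andP[t2 t3] t1].
have t0 := mag_ge0 t.
have pb := h3 t t3.
have pd : mag (p t - p 0) < d1.
  by apply: le_lt_trans pb _; rewrite mulrC -ltr_pdivlMr.
have := h1 _ pd; rewrite [p 0 + _]addrC subrK.
have E : 'd g (p 0) (p t - p 0 - t *: b) = 'd g (p 0) (p t - p 0) - t *: 'd g (p 0) b.
  by rewrite linearB [X in _ - X]linearZ.
have := hC (p t - p 0 - t *: b); rewrite E => k1 k2.
have -> : g (p t) - g (p 0) - t *: 'd g (p 0) b =
   (g (p t) - g (p 0) - 'd g (p 0) (p t - p 0)) + ('d g (p 0) (p t - p 0) - t *: 'd g (p 0) b).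
  by rewrite addrA subrK.
apply: le_trans (magD _ _) _.
have k3 : e / (2 * (mag b + 1)) * mag (p t - p 0) <= e / 2 * mag t.
  apply: le_trans (ler_wpM2l (ltW e1) pb) _; rewrite mulrA le_eqVlt; apply/orP; left; apply/eqP.
  by congr (_ * _); field; rewrite gt_eqF.
have k4 : C * mag (p t - p 0 - t *: b) <= e / 2 * mag t.
  apply: le_trans (ler_wpM2l C0 (h2 t t2)) _; rewrite mulrA; apply: ler_wpM2r => //.
  have -> : C * (e / (2 * (C + 1))) = e / 2 * (C / (C + 1)) by field; rewrite gt_eqF.
  apply: ler_piMr; first by rewrite divr_ge0// ltW.
  by rewrite ler_pdivrMr// mul1r lerDl.
have -> : e * mag t = e / 2 * mag t + e / 2 * mag t by field.
by apply: lerD; [exact: le_trans k2 k3|exact: le_trans k1 k4].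
Qed.

Lemma velocity_scale (p : R[i] -> V) b s : velocity p b ->
  velocity (fun t => (1 + t * s) *: p t) (b + s *: p 0).
Proof.
move=> hp e e0; have e2 : 0 < e / 2 by rewrite divr_gt0.
have b1 : 0 < mag b + 1 by rewrite ltr_wpDl// mag_ge0.
have s1 : 0 < mag s + 1 by rewrite ltr_wpDl// mag_ge0.
have [d1 d10 h1] := hp _ e2; have [d2 d20 h2] := velocity_bound hp.
have D0 : 0 < 2 * ((mag s + 1) * (mag b + 1)) by rewrite !mulr_gt0.
exists (Num.min (Num.min d1 d2) (e / (2 * ((mag s + 1) * (mag b + 1))))).
  by rewrite !lt_min d10 d20 divr_gt0.
move=> t; rewrite !lt_min => /andP[/andP[/h1 t1 /h2 t2]]; rewrite ltr_pdivlMr// => t3.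
rewrite mul0r addr0 scale1r.
have -> : (1 + t * s) *: p t - p 0 - t *: (b + s *: p 0) =
    (p t - p 0 - t *: b) + (t * s) *: (p t - p 0).
  rewrite scalerDl scale1r scalerDr scalerA scalerBr opprD.
  by rewrite -!addrA; congr (_ + _); rewrite addrCA; congr (_ + _); rewrite addrCA.
apply: le_trans (magD _ _) _; rewrite magZ magM.
have t0 := mag_ge0 t; have s0 := mag_ge0 s.
have -> : e * mag t = e / 2 * mag t + e / 2 * mag t by field.
apply: lerD => //.
apply: le_trans (ler_wpM2l (mulr_ge0 t0 s0) t2) _.
rewrite mulrA; apply: ler_wpM2r => //.
apply: (@le_trans _ _ (mag t * ((mag s + 1) * (mag b + 1)))); last by move: t3; lra.
rewrite -mulrA; apply: ler_wpM2l => //; apply: ler_wpM2r; first exact: ltW.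
by rewrite lerDl.
Qed.

End Curves.

Section Transport.
Variables (R : realType) (V : normedModType R[i]).

Lemma scaled_velocity (f : V -> V) s Z : differentiable f 0 ->
  velocity (fun t => (1 + t * s) *: f (t *: Z)) ('d f 0 Z + s *: f 0).
Proof.
move=> fd; have := velocity_scale s (velocity_comp (velocity_line Z) (scale0r Z) fd).
by rewrite scale0r.
Qed.

Lemma transported_velocity (f g : V -> V) s Z : differentiable f 0 -> differentiable g (f 0) ->
  velocity (fun t => g ((1 + t * s) *: f (t *: Z)))
    ('d g (f 0) ('d f 0 Z) + s *: 'd g (f 0) (f 0)).
Proof.
move=> fd gd; rewrite -diff_linear; apply: (velocity_comp (scaled_velocity s Z fd)) => //.
by rewrite mul0r addr0 scale1r scale0r.
Qed.

End Transport.

Section LinearCoefficient.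
Variables (R : realType) (V : completeNormedModType R[i]).

(** Cauchy's estimate on the disc where [K] bounds [F]; the expansion on the
    unit disc serves to identify the linear coefficient. *)
Lemma linear_coef_bound (F : R[i] -> V) c0 c1 (C K r : R) : 0 < r < 1 -> 0 <= C ->
  (forall w, mag w < 1 -> cdiff F w) ->
  (forall w, mag w < 1 -> mag (F w - (c0 + w *: c1)) <= C * mag w ^+ 2 / (1 - mag w)) ->
  (forall w, mag w < r -> mag (F w) <= K) -> r * mag c1 <= K.
Proof.
move=> /andP[r0 r1] C0 Fd FE FK.
pose G (z : R[i]) := F (r%:C * z).
have mr (z : R[i]) : mag (r%:C * z) = r * mag z by rewrite magM magR gtr0_norm.
have GK z : mag z < 1 -> mag (G z) <= K by move=> z1; apply: FK; rewrite mr gtr_pMr.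
have Gd z : mag z < 1 -> cdiff G z.
  move=> z1; apply: (@cdiff_comp _ _ F (fun z => r%:C * z)).
    exact: (cdiffZ (cdiff_cst _ _) (cdiff_id _)).
  by apply: Fd; rewrite mr; have := mag_ge0 z; nra.
have K0 := mag_bound_ge0 GK.
have [d [dK tl _ _]] := taylor_disc GK Gd.
pose c k : V := if k is 0%N then c0 else r%:C *: c1.
have E : c 1%N = d 1%N.
  apply: (@taylor_unique _ _ G c d 2 (2 * C) (2 * K) 2^-1) => //; first by rewrite invr_gt0.
  - move=> z zh; rewrite big_ord_recl big_ord1 /= expr0 scale1r expr1 scalerA (mulrC z).
    have z0 := mag_ge0 z; have rz : r * mag z <= mag z by rewrite ler_piMl// ltW.
    have rz2 : mag (r%:C * z) <= 2^-1 by rewrite mr; lra.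
    apply: le_trans (FE _ (le_lt_trans rz2 (half_lt1 R))) _.
    apply: le_trans (half_bound _ rz2) _; first by rewrite mulr_ge0// exprn_ge0// mag_ge0.
    rewrite mulrA; apply: ler_wpM2l; first by rewrite mulr_ge0.
    by rewrite mr lerXn2r ?nnegrE// mulr_ge0// ltW.
  - by move=> z zh; apply: tail_near => //; exact: ltW.
have := dK 1%N; rewrite -E /c magZ magR gtr0_norm//.
Qed.

End LinearCoefficient.

Lemma second_difference_aux (U : zmodType) (p q o s t : U) :
  (p - (o + s)) + (q - (o + t)) + (s + t) = p + q - (o + o).
Proof.
have E : - (o + s) - (o + t) = - (o + o) - (s + t) by rewrite -!opprD addrACA.
by rewrite (addrACA p) E -[LHS]addrA -[_ + (s + t)]addrA addNr addr0.
Qed.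

Section SecondDifference.
Variables (R : realType) (V : completeNormedModType R[i]).

(** Write [xi = 1 + z]. The first-order terms add up to [z] plus its
    conjugate, which is [- |z| ^ 2] on the unit circle. *)
Lemma second_difference (g : V -> V) w (rho : R) (xi : R[i]) : 0 < rho ->
  holo_bd g w rho 1 -> mag w <= 1 -> mag xi = 1 -> mag (xi - 1) <= rho / 2 ->
  mag (g (xi *: w) + g ((xi^*)%C *: w) - 2 *: g w) <=
    (rho^-1 + 4 / rho ^+ 2) * mag (xi - 1) ^+ 2.
Proof.
move=> rho0 gK w1 xi1 xir.
have h2 : (2^-1 : R) < 1 by rewrite invf_lt1// ltr1n.
have rw : mag (rho%:C *: w) <= rho.
  by rewrite magZ magR gtr0_norm// ler_piMr// ltW.
have [g1 g2] := holo_bd_line rho0 gK rw.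
have [c [c1 tl _ _]] := taylor_disc g1 g2.
have c0 := tail_value tl; rewrite scale0r addr0 in c0.
pose z := xi - 1.
have zE : xi = 1 + z by rewrite /z addrC subrK.
have rC : rho%:C != 0 by rewrite -mag_gt0 magR normr_gt0 gt_eqF.
have est (y : R[i]) : mag y = mag z -> mag (g ((1 + y) *: w) - (g w + (y / rho%:C) *: c 1%N)) <= 2 * (mag z / rho) ^+ 2.
  move=> yz; have my : mag (y / rho%:C) = mag z / rho by rewrite magM magV magR gtr0_norm// yz.
  have y2 : mag (y / rho%:C) <= 2^-1.
    by rewrite my ler_pdivrMr//; move: xir; rewrite -/z; lra.
  have := @tail_near _ _ _ _ _ 2 _ ler01 tl y2.
  by rewrite big_ord_recl big_ord1 /= expr0 scale1r expr1 c0 scalerA divfK// scalerDl scale1r mulr1 my.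
have zc : z + (z^*)%C = - (mag z ^+ 2)%:C.
  have := conj_circle xi; rewrite xi1 expr1n zE conjcD conjc_one -(conj_circle z) => h.
  apply/eqP; rewrite -subr_eq0 opprK; apply/eqP.
  transitivity ((1 + (z^*)%C) * (1 + z) - 1); first by ring.
  by rewrite h subrr.
have e1 := est z erefl; have e2 := est (z^*)%C (mag_conj z).
have -> : g (xi *: w) + g ((xi^*)%C *: w) - 2 *: g w =
    (g ((1 + z) *: w) - (g w + (z / rho%:C) *: c 1%N)) +
    (g ((1 + (z^*)%C) *: w) - (g w + ((z^*)%C / rho%:C) *: c 1%N)) +
    ((z + (z^*)%C) / rho%:C) *: c 1%N.
  rewrite [(z + _) / _]mulrDl [X in _ = _ + X]scalerDl second_difference_aux -zE.
  by rewrite zE conjcD conjc_one scaler_nat mulr2n.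
apply: le_trans (magD _ _) _.
have e3 : mag (((z + (z^*)%C) / rho%:C) *: c 1%N) <= mag z ^+ 2 / rho.
  rewrite zc magZ magM magN magR magV magR !ger0_norm ?(ltW rho0) ?exprn_ge0 ?mag_ge0//.
  by rewrite ler_piMr// divr_ge0 ?exprn_ge0 ?mag_ge0// ltW.
have := magD (g ((1 + z) *: w) - (g w + (z / rho%:C) *: c 1%N)) (g ((1 + (z^*)%C) *: w) - (g w + ((z^*)%C / rho%:C) *: c 1%N)).
have -> : (rho^-1 + 4 / rho ^+ 2) * mag (xi - 1) ^+ 2 = 2 * (mag z / rho) ^+ 2 + 2 * (mag z / rho) ^+ 2 + mag z ^+ 2 / rho.
  by rewrite /z; field; rewrite gt_eqF.
move=> h; exact: (lerD (le_trans h (lerD e1 e2)) e3).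
Qed.

End SecondDifference.

(** * Bounded operators and Neumann's series *)

Section Completeness.
Variable R : realType.

Lemma seq_complete_cvg (V : normedModType R[i]) :
  (forall u : nat -> V, mcauchy u -> exists l, mcvg u l) ->
  forall F : set_system V, ProperFilter F -> cauchy F -> cvg F.
Proof.
move=> hV F FF /cauchyP Fc.
have e0 n : 0 < (n.+1%:R^-1 : R) by rewrite invr_gt0 ltr0n.
have ex n : exists Z : V, F [set W | mag (W - Z) < n.+1%:R^-1].
  have en : 0 < (n.+1%:R^-1 : R)%:C by rewrite ltcR.
  have [Z FZ] := Fc _ en; exists Z; apply: filterS FZ => W.
  by rewrite -ball_normE /= magE ltcR magB.
have [u uP] := choice ex.
have small (e : R) : 0 < e -> exists N, forall n, (N <= n)%N -> n.+1%:R^-1 <= e.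
  move=> e1; exists (Num.bound e^-1) => n hn.
  rewrite invf_ple ?posrE ?ltr0n//; apply: ltW; apply: lt_le_trans (archi_boundP _) _.
    by rewrite invr_ge0 ltW.
  by rewrite ler_nat leqW.
have uc : mcauchy u.
  move=> e e1; have e2 : 0 < e / 2 by rewrite divr_gt0.
  have [N hN] := small _ e2; exists N => m n /hN hm /hN hn.
  have [W [/= W1 W2]] := filter_ex (filterI (uP m) (uP n)).
  apply: le_trans (magDB _ W _) _; rewrite (magB _ W).
  apply: le_trans (lerD (ltW W1) (ltW W2)) _.
  by apply: le_trans (lerD hm hn) _; rewrite -splitr.
have [l hl] := hV u uc.
apply/cvg_ex; exists l; apply/cvgrPdist_le => e e1.
have er : e = (complex.Re e)%:C by rewrite RRe_real// gtr0_real.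
have re0 : 0 < complex.Re e by rewrite -ltcR -er.
have e2 : 0 < complex.Re e / 2 by rewrite divr_gt0.
have [N hN] := small _ e2; have [M hM] := hl _ e2.
have {hM} h1 := hM (maxn N M) (leq_maxr _ _).
have h2 := hN (maxn N M) (leq_maxl _ _).
apply: filterS (uP (maxn N M)) => W /= W1.
rewrite er magE lecR magB.
apply: le_trans (magDB _ (u (maxn N M)) _) _.
apply: le_trans (lerD (ltW W1) h1) _.
by rewrite [leRHS]splitr lerD2r.
Qed.

End Completeness.

Section BopAlgebra.
Variables (R : realType) (H : normedModType R[i]).
Implicit Types (Z W X E : bop H).

Lemma bop_mag Z : mag Z = opnorm Z. Proof. by []. Qed.

Lemma mag_app Z (x : H) : mag (Z x) <= mag Z * mag x.
Proof. by have := opnorm_le Z x; rewrite !magE -rmorphM lecR. Qed.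

Lemma mag_bop_le Z (M : R) : 0 <= M -> (forall x, mag (Z x) <= M * mag x) -> mag Z <= M.
Proof.
move=> M0 h; rewrite bop_mag; apply: opnorm_lub => // x.
by rewrite !magE -rmorphM lecR; exact: h.
Qed.

Lemma mag_mul Z W : mag (Z * W) <= mag Z * mag W.
Proof.
apply: mag_bop_le => [|x]; first by rewrite mulr_ge0 ?mag_ge0.
rewrite bopME -mulrA; apply: le_trans (mag_app _ _) _.
by apply: ler_wpM2l; [exact: mag_ge0|exact: mag_app].
Qed.

Lemma mag_bop1 : mag (1 : bop H) <= 1.
Proof. by apply: mag_bop_le => // x; rewrite bop1E mul1r. Qed.

Lemma bopP Z W : (forall x, Z x = W x) -> Z = W.
Proof. by move=> h; apply/val_inj/funext. Qed.

Lemma bopDE Z W x : (Z + W) x = Z x + W x. Proof. by []. Qed.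
Lemma bopNE Z x : (- Z) x = - Z x. Proof. by []. Qed.
Lemma bopBE Z W x : (Z - W) x = Z x - W x. Proof. by []. Qed.
Lemma bopZE (a : R[i]) Z x : (a *: Z) x = a *: Z x. Proof. by []. Qed.

Lemma bop_scalel (a : R[i]) Z W : (a *: Z) * W = a *: (Z * W).
Proof. by apply: bopP => x. Qed.

Lemma bop_scaler (a : R[i]) Z W : Z * (a *: W) = a *: (Z * W).
Proof. by apply: bopP => x; rewrite bopME !bopZE linearZ. Qed.

Lemma bop_mcvgMl (u : nat -> bop H) Z W : mcvg u W -> mcvg (fun n => Z * u n) (Z * W).
Proof.
move=> uW e e0; have Z1 : 0 < mag Z + 1 by rewrite ltr_wpDl// mag_ge0.
have [N hN] := uW _ (divr_gt0 e0 Z1); exists N => n /hN h.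
rewrite -mulrBr; apply: le_trans (mag_mul _ _) _.
apply: le_trans (ler_wpM2l (mag_ge0 _) h) _.
by rewrite mulrA ler_pdivrMr// mulrC ler_pM2l// lerDl.
Qed.

Lemma bop_mcvgMr (u : nat -> bop H) Z W : mcvg u W -> mcvg (fun n => u n * Z) (W * Z).
Proof.
move=> uW e e0; have Z1 : 0 < mag Z + 1 by rewrite ltr_wpDl// mag_ge0.
have [N hN] := uW _ (divr_gt0 e0 Z1); exists N => n /hN h.
rewrite -mulrBl; apply: le_trans (mag_mul _ _) _.
apply: le_trans (ler_wpM2r (mag_ge0 _) h) _.
by rewrite mulrAC ler_pdivrMr// ler_pM2l// lerDl.
Qed.

Definition inverse_of Z W := Z * W = 1 /\ W * Z = 1.

Lemma inverse_unique Z W W' : inverse_of Z W -> inverse_of Z W' -> W = W'.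
Proof. by move=> [_ WZ] [ZW' _]; rewrite -[W]mulr1 -ZW' mulrA WZ mul1r. Qed.

Lemma inverse_sym Z W : inverse_of Z W -> inverse_of W Z.
Proof. by case. Qed.

End BopAlgebra.

Section Geometric.
Variable R : realType.

Lemma geom_cvg (q e : R) : 0 <= q < 1 -> 0 < e ->
  exists N, forall n, (N <= n)%N -> q ^+ n <= e.
Proof.
move=> q01 e0; apply: contrapT => h.
suff : e <= 0 by rewrite leNgt e0.
apply: (geom_le0 (B := 1) q01) => N; rewrite mul1r.
apply: contrapT => eN; apply: h; exists N => n Nn.
case/andP: q01 => q0 q1.
apply: le_trans (ler_wiXn2l q0 (ltW q1) Nn) _.
by rewrite leNgt; apply/negP => h; apply: eN; exact: ltW.
Qed.

End Geometric.

Section BopComplete.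
Variables (R : realType) (H : completeNormedModType R[i]).
Implicit Types (Z W X E : bop H).

Lemma bop_seq_complete (u : nat -> bop H) : mcauchy u -> exists l, mcvg u l.
Proof.
move=> uc.
have ucx x : mcauchy (fun n => u n x).
  move=> e e0; have x1 : 0 < mag x + 1 by rewrite ltr_wpDl// mag_ge0.
  have [N hN] := uc _ (divr_gt0 e0 x1); exists N => m n /hN h /h {}h.
  rewrite -bopBE; apply: le_trans (mag_app _ _) _.
  apply: le_trans (ler_wpM2r (mag_ge0 _) h) _.
  by rewrite mulrAC ler_pdivrMr// ler_pM2l// lerDl.
have [T TP] := choice (fun x => mcauchy_mcvg (ucx x)).
have [N0 hN0] := uc 1 ltr01.
have bd n : (N0 <= n)%N -> mag (u n) <= mag (u N0) + 1.
  move=> /hN0 h; have := h _ (leqnn _); have := mag_subl (u n) (u N0); lra.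
have Tb : is_bop T.
  apply/asboolP; split.
    move=> a x y; apply: (mcvg_unique (TP _)).
    by apply: mcvg_eq (mcvgD (mcvgZ a (TP x)) (TP y)) => n; rewrite linearP.
  exists (mag (u N0) + 1)%:C => x; rewrite !magE -rmorphM lecR.
  apply/ler_addgt0Pl => e e0; have [M hM] := TP x e e0.
  have := hM (maxn N0 M) (leq_maxr _ _).
  have := mag_app (u (maxn N0 M)) x.
  have := ler_wpM2r (mag_ge0 x) (bd _ (leq_maxl N0 M)).
  have := mag_subl (T x) (u (maxn N0 M) x); rewrite (magB (T x)); lra.
exists (Bop Tb) => e e0; have [N hN] := uc e e0; exists N => n nN.
apply: mag_bop_le => [|x]; first exact: ltW.
rewrite bopBE /=; apply/ler_addgt0Pl => d d0; have [M hM] := TP x d d0.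
have h1 := hM (maxn N M) (leq_maxr _ _).
have h2 := hN n (maxn N M) nN (leq_maxl _ _).
have h3 := mag_app (u n - u (maxn N M)) x.
have h4 := ler_wpM2r (mag_ge0 x) h2.
have := magDB (u n x) (u (maxn N M) x) (T x).
rewrite bopBE in h3; lra.
Qed.

(** The series is summed inside a subspace [P] that is only closed under the
    products [X Y X]; a power algebra is such a subspace. *)
Lemma neumann (P : bop H -> Prop) Z X E :
  P 0 -> (forall A B, P A -> P B -> P (A + B)) ->
  (forall A B, P A -> P B -> P (A * B * A)) -> (forall A, P A -> P (- A)) ->
  (forall u l, (forall n, P (u n)) -> mcvg u l -> P l) ->
  inverse_of Z X -> P X -> P E -> mag X * mag E < 1 ->
  exists Y, [/\ P Y, inverse_of (Z + E) Y & mag (Y - X) * (1 - mag X * mag E) <= mag X * mag X * mag E].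
Proof.
move=> P0 PD PS PN Pcl [ZX XZ] PX PE q1.
set q := mag X * mag E in q1 *.
have q0 : 0 <= q by rewrite mulr_ge0 ?mag_ge0.
pose Q := - (X * E).
have mQ : mag Q <= q by rewrite magN mag_mul.
have mQn n : mag (Q ^+ n) <= q ^+ n.
  elim: n => [|n IH]; first by rewrite !expr0 mag_bop1.
  rewrite !exprS; apply: le_trans (mag_mul _ _) _.
  by apply: ler_pM; rewrite ?mag_ge0.
(* Passing from [Q ^+ n * X] to [Q ^+ n.+2 * X] is a sandwich by [E] followed
   by one by [X]; this is why the induction proceeds in steps of two. *)
have PQ n : P (Q ^+ n * X).
  suff : P (Q ^+ n * X) /\ P (Q ^+ n.+1 * X) by case.
  elim: n => [|n [IH1 IH2]]; split=> //.
  - by rewrite expr0 mul1r.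
  - by rewrite expr1 /Q mulNr; apply: PN; exact: PS.
  - have E2 M : Q * (M * Q) * X = X * (E * (M * X) * E) * X.
      by rewrite /Q !mulrN !mulNr opprK !mulrA.
    by rewrite exprS exprSr E2; apply: (PS _ _ PX); exact: PS.
pose T n := \sum_(k < n) Q ^+ k * X.
have PT n : P (T n).
  rewrite /T; elim: n => [|n IH]; first by rewrite big_ord0.
  by rewrite big_ord_recr /=; apply: PD.
have TE n : T n = (\sum_(k < n) Q ^+ k) * X by rewrite /T mulr_suml.
have gl n : (\sum_(k < n) Q ^+ k) * (1 - Q) = 1 - Q ^+ n.
  elim: n => [|n IH]; first by rewrite big_ord0 mul0r expr0 subrr.
  by rewrite big_ord_recr /= mulrDl IH mulrBr mulr1 -exprSr addrA subrK.
have gr n : (1 - Q) * (\sum_(k < n) Q ^+ k) = 1 - Q ^+ n.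
  elim: n => [|n IH]; first by rewrite big_ord0 mulr0 expr0 subrr.
  by rewrite big_ord_recr /= mulrDr IH mulrBl mul1r -exprS addrA subrK.
have XE : X * (Z + E) = 1 - Q by rewrite mulrDr XZ /Q opprK.
have ZE : Z + E = Z * (1 - Q).
  by rewrite mulrBr mulr1 /Q mulrN opprK mulrA ZX mul1r.
have Q0 : mcvg (fun n => Q ^+ n) 0.
  move=> e e0; have [|N hN] := @geom_cvg _ q e _ e0; first by rewrite q0.
  by exists N => n /hN; rewrite subr0; apply: le_trans.
have Tc : mcauchy T.
  move=> e e0; pose A := 2 * (mag X + 1).
  have A0 : 0 < A by rewrite mulr_gt0// ltr_wpDl// mag_ge0.
  have r1 : 0 < 1 - q by rewrite subr_gt0.
  have [|N hN] := @geom_cvg _ q (e * (1 - q) / A) _ (divr_gt0 (mulr_gt0 e0 r1) A0); first by rewrite q0.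
  exists N => m n /hN hm /hN hn; rewrite !TE -mulrBl.
  set S := _ - _.
  have SE : S * (1 - Q) = Q ^+ n - Q ^+ m.
    by rewrite mulrBl !gl opprB addrCA addrAC subrr add0r addrC.
  have S1 : mag S * (1 - q) <= 2 * (e * (1 - q) / A).
    have : mag S <= mag (Q ^+ n - Q ^+ m) + mag S * q.
      have -> : S = (Q ^+ n - Q ^+ m) + S * Q by rewrite -SE mulrBr mulr1 subrK.
      apply: le_trans (magD _ _) _; rewrite lerD2l.
      apply: le_trans (mag_mul _ _) _; rewrite -SE mulrBr mulr1 subrK.
      by apply: ler_wpM2l => //; exact: mag_ge0.
    have := magD (Q ^+ n) (- Q ^+ m); rewrite magN.
    have := mQn n; have := mQn m; lra.
  apply: le_trans (mag_mul _ _) _.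
  rewrite -(ler_pM2r r1) mulrAC; apply: le_trans (ler_wpM2r (mag_ge0 X) S1) _.
  rewrite (_ : _ * mag X = e * (1 - q) * (2 * mag X / A)); last by field; rewrite gt_eqF.
  apply: ler_piMr; first by rewrite mulr_ge0 ?ltW.
  by rewrite ler_pdivrMr// mul1r /A ler_pM2l// lerDl.
have [Y YP] := bop_seq_complete Tc.
have [ZY YZ] : inverse_of (Z + E) Y.
  split.
    apply: (mcvg_unique (bop_mcvgMl (Z + E) YP)).
    have := mcvgB (mcvg_cst (1 : bop H)) (bop_mcvgMr X (bop_mcvgMl Z Q0)).
    rewrite mulr0 mul0r subr0; apply: mcvg_eq => n.
    by rewrite TE ZE -!mulrA (mulrA (1 - Q)) gr mulrBl mulrBr mul1r ZX.
  apply: (mcvg_unique (bop_mcvgMr (Z + E) YP)).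
  have := mcvgB (mcvg_cst (1 : bop H)) Q0.
  by rewrite subr0; apply: mcvg_eq => n; rewrite TE -mulrA XE gl.
exists Y; split; [exact: Pcl PT YP|by []|].
have YX : Y - X = - (Y * E * X).
  have := congr1 (fun A => A * X) YZ; rewrite mulrDr mulrDl -mulrA ZX mulr1 mul1r.
  by move=> /eqP; rewrite addrC eq_sym -subr_eq => /eqP <-; rewrite opprB addrC.
have h1 : mag (Y - X) <= mag Y * mag E * mag X.
  rewrite YX magN; apply: le_trans (mag_mul _ _) _.
  by apply: ler_wpM2r; [exact: mag_ge0|exact: mag_mul].
have h2 : mag Y <= mag X + mag (Y - X) by have := mag_subl Y X; lra.
have h3 := ler_wpM2r q0 h2.
rewrite -/q; move: h1 h3; rewrite /q.
set x := mag X; set y := mag Y; set e := mag E; set d := mag _; lra.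
Qed.

End BopComplete.

(** * Power algebras and the identity component *)

Section PowerAlg.
Variables (R : realType) (H : hilbertType R) (A : powerAlgebra H).
Implicit Types (X Y Z W E : bop H).
Local Notation inA := (pa_set A).

Lemma pa0 : inA 0.
Proof. by have [[]] := pa_setP A. Qed.
Lemma paD X Y : inA X -> inA Y -> inA (X + Y).
Proof.
have [[_ h] _ _ _] := pa_setP A => hx hy.
by have := h 1 X Y hx hy; rewrite scale1r.
Qed.
Lemma paZ (a : R[i]) X : inA X -> inA (a *: X).
Proof.
have [[h0 h] _ _ _] := pa_setP A => hx.
by have := h a X 0 hx h0; rewrite addr0.
Qed.
Lemma paN X : inA X -> inA (- X).
Proof. by rewrite -scaleN1r; exact: paZ. Qed.
Lemma paB X Y : inA X -> inA Y -> inA (X - Y).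
Proof. by move=> hx hy; apply: paD => //; apply: paN. Qed.
Lemma pa1 : inA 1.
Proof. by have [_ _ h _] := pa_setP A. Qed.
Lemma pa_sqr X : inA X -> inA (X * X).
Proof. by have [_ _ _ h] := pa_setP A => /h; rewrite expr2. Qed.

Lemma pa_anticomm X Y : inA X -> inA Y -> inA (X * Y + Y * X).
Proof.
move=> hx hy; have := paB (paB (pa_sqr (paD hx hy)) (pa_sqr hx)) (pa_sqr hy).
rewrite mulrDl !mulrDr; set a := X * X; set b := X * Y; set c := Y * X; set d := Y * Y.
by rewrite -(addrA a) [a + _]addrC addrK addrA addrK.
Qed.

Lemma half_cancel (X : bop H) : X + X = 2 *: X.
Proof. by rewrite scaler_nat mulr2n. Qed.

Lemma jordan_triple X Y :
  (X * (X * Y + Y * X) + (X * Y + Y * X) * X) - ((X * X) * Y + Y * (X * X)) =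
  2 *: (X * Y * X).
Proof.
rewrite -half_cancel mulrDr mulrDl !mulrA.
set a := X * X * Y; set b := X * Y * X; set c := Y * X * X.
by rewrite (addrC a b) addrACA addrK.
Qed.

(** Anticommutators come from squares by polarization, and then
    [jordan_triple] applies. *)
Lemma pa_sandwich X Y : inA X -> inA Y -> inA (X * Y * X).
Proof.
move=> hx hy; have h1 := pa_anticomm hx (pa_anticomm hx hy).
have h2 := pa_anticomm (pa_sqr hx) hy.
by have := paZ 2^-1 (paB h1 h2); rewrite jordan_triple scalerA mulVf ?pnatr_eq0// scale1r.
Qed.

Lemma pa_closed (u : nat -> bop H) W : (forall n, inA (u n)) -> mcvg u W -> inA W.
Proof.
move=> hu uW; have [_ cA _ _] := pa_setP A.
apply: cA => B /nbhs_ballP[e /= e0 hB].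
have er : e = (complex.Re e)%:C by rewrite RRe_real// gtr0_real.
have re0 : 0 < complex.Re e by rewrite -ltcR -er.
have e2 : 0 < complex.Re e / 2 by rewrite divr_gt0.
have [N hN] := uW _ e2.
exists (u N); split; first exact: hu.
apply: hB; rewrite -ball_normE /= er magE ltcR magB.
by apply: le_lt_trans (hN N (leqnn _)) _; rewrite ltr_pdivrMr// mulr_natr mulr2n ltrDl.
Qed.

Lemma pa_far X : ~ inA X -> exists2 e : R, 0 < e & forall Y, mag (Y - X) < e -> ~ inA Y.
Proof.
move=> nX; apply: contrapT => h; apply: nX.
have ex n : exists Y, inA Y /\ mag (Y - X) < n.+1%:R^-1.
  apply: contrapT => h'; apply: h; exists n.+1%:R^-1; first by rewrite invr_gt0.
  by move=> Y YX AY; apply: h'; exists Y.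
have [u uP] := choice ex.
apply: (@pa_closed u) => [n|e e0]; first by have [] := uP n.
exists (Num.bound e^-1) => n hn.
apply: le_trans (ltW (uP n).2) _.
rewrite invf_ple ?posrE ?ltr0n//; apply: ltW; apply: lt_le_trans (archi_boundP _) _.
  by rewrite invr_ge0 ltW.
by rewrite ler_nat leqW.
Qed.

Lemma pa_neumann Z X E : inverse_of Z X -> inA X -> inA E -> mag X * mag E < 1 ->
  exists Y, [/\ inA Y, inverse_of (Z + E) Y & mag (Y - X) * (1 - mag X * mag E) <= mag X * mag X * mag E].
Proof.
apply: neumann; [exact: pa0|exact: paD|exact: pa_sandwich|exact: paN|exact: pa_closed].
Qed.

Lemma bop_neumann Z X E : inverse_of Z X -> mag X * mag E < 1 ->
  exists Y, inverse_of (Z + E) Y /\ mag (Y - X) * (1 - mag X * mag E) <= mag X * mag X * mag E.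
Proof.
move=> ZX q1; have [Y [_ h1 h2]] := @neumann _ _ (fun=> True) Z X E I
  (fun _ _ _ _ => I) (fun _ _ _ _ => I) (fun _ _ => I) (fun _ _ _ _ => I) ZX I I q1.
by exists Y.
Qed.

Implicit Types (a b : A).

Lemma pa_in a : inA (pa_val a).
Proof. exact: set_mem (pa_valP a). Qed.

Definition pa_mk X (hX : inA X) : A := PaElt (mem_set hX).

Lemma pa_inj a b : pa_val a = pa_val b -> a = b. Proof. exact: val_inj. Qed.
Lemma pa_valD a b : pa_val (a + b) = pa_val a + pa_val b. Proof. by []. Qed.
Lemma pa_valN a : pa_val (- a) = - pa_val a. Proof. by []. Qed.
Lemma pa_valB a b : pa_val (a - b) = pa_val a - pa_val b. Proof. by []. Qed.
Lemma pa_valZ (k : R[i]) a : pa_val (k *: a) = k *: pa_val a. Proof. by []. Qed.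
Lemma pa_val0 : pa_val (0 : A) = 0. Proof. by []. Qed.
Lemma pa_mag a : mag a = mag (pa_val a). Proof. by []. Qed.

Lemma pa_seq_complete (u : nat -> A) : mcauchy u -> exists l, mcvg u l.
Proof.
move=> uc; have [l hl] := @bop_seq_complete _ _ (fun n => pa_val (u n)) uc.
have Al : inA l by apply: (pa_closed _ hl) => n; exact: pa_in.
by exists (pa_mk Al).
Qed.

End PowerAlg.

HB.instance Definition _ (R : realType) (H : hilbertType R) (A : powerAlgebra H) :=
  Uniform_isComplete.Build (pa_elt A) (seq_complete_cvg (@pa_seq_complete R H A)).

Section GIFacts.
Variables (R : realType) (H : hilbertType R) (A : powerAlgebra H).
Implicit Types (a b : A).
Local Notation inA := (pa_set A).

Definition Inv : set A := [set Z : A | op_invertible (pa_val Z)].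

Lemma GI_inv a : GI A a -> exists W, inverse_of (pa_val a) W.
Proof. by move=> /connected_component_sub[W [h1 h2]]; exists W. Qed.

Lemma invertible_of a W : inverse_of (pa_val a) W -> Inv a.
Proof. by move=> [h1 h2]; exists W. Qed.

Lemma Inv1 : Inv (pa_one A).
Proof. by exists 1; rewrite /= !mul1r. Qed.

Lemma GI1 : GI A (pa_one A).
Proof. by apply: connected_component_refl; exact: Inv1. Qed.

Lemma GI_connected (C : set A) a b : GI A a -> C a -> C b -> C `<=` Inv -> connected C -> GI A b.
Proof.
move=> Ga Ca Cb CI Cc; apply: connected_component_trans Ga _.
by exists C.
Qed.

Lemma open_mag (P : set A) : (forall a, P a -> exists2 e : R, 0 < e & forall b, mag (b - a) < e -> P b) -> open P.
Proof.
move=> h; rewrite openE => a /h[e e0 he]; apply/nbhs_ballP; exists e%:C; first by rewrite /= ltcR.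
by move=> b; rewrite -ball_normE /= magE ltcR magB; exact: he.
Qed.

(** Invertibility inside the algebra; for the elements of [GI A] it is no
    restriction, by [GI_has_inverse]. *)
Definition has_inverse a := exists2 W, inA W & inverse_of (pa_val a) W.

Lemma small_pert (x : R) : 0 <= x -> exists2 e : R, 0 < e & x * e < 1.
Proof.
move=> x0; exists (x + 1)^-1; first by rewrite invr_gt0 ltr_wpDl.
by rewrite ltr_pdivrMr ?ltr_wpDl// mul1r ltrDl.
Qed.

Lemma has_inverse_open : open has_inverse.
Proof.
apply: open_mag => a [W AW aW].
have [e e0 he] := small_pert (mag_ge0 W); exists e => // b ba.
have AE : inA (pa_val (b - a)) by exact: pa_in.
have q1 : mag W * mag (pa_val (b - a)) < 1.
  by apply: le_lt_trans he; apply: ler_wpM2l; [exact: mag_ge0|exact: ltW].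
have [Y [AY bY _]] := pa_neumann aW AW AE q1; exists Y => //.
by move: bY; rewrite pa_valB addrC subrK.
Qed.

Lemma lacks_inverse_open : open [set a : A | exists2 W, ~ inA W & inverse_of (pa_val a) W].
Proof.
apply: open_mag => a [W AW aW].
have [d d0 hd] := pa_far AW.
have m0 := mag_ge0 W.
pose e := Num.min (2 * (mag W + 1))^-1 (d / (4 * (mag W * mag W + 1))).
have W1 : 0 < mag W + 1 by rewrite ltr_wpDl.
have W2 : 0 < mag W * mag W + 1 by rewrite ltr_wpDl// mulr_ge0.
exists e; first by rewrite lt_min invr_gt0 divr_gt0// !mulr_gt0.
move=> b; rewrite lt_min => /andP[b1 b2].
have q1 : mag W * mag (pa_val (b - a)) <= 2^-1.
  rewrite -pa_mag; apply: le_trans (ler_wpM2l m0 (ltW b1)) _.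
  rewrite invfM mulrCA ler_piMr ?invr_ge0//.
  by rewrite ler_pdivrMr// mul1r lerDl.
have h2 : (2^-1 : R) < 1 by rewrite invf_lt1// ltr1n.
have [Y [bY Ye]] := bop_neumann aW (le_lt_trans q1 h2).
exists Y; last by move: bY; rewrite pa_valB addrC subrK.
apply: hd.
have : mag W * mag W * mag (pa_val (b - a)) <= d / 4.
  apply: le_trans (ler_wpM2l (mulr_ge0 m0 m0) (ltW b2)) _.
  rewrite (_ : _ * (d / _) = d / 4 * (mag W * mag W / (mag W * mag W + 1))); last first.
    by field; rewrite gt_eqF.
  apply: ler_piMr; first by rewrite divr_ge0// ltW.
  by rewrite ler_pdivrMr// mul1r lerDl.
have := mag_ge0 (Y - W); move: q1 Ye; rewrite -!pa_mag.
set q := mag W * mag (b - a); set y := mag (Y - W); set z := _ * _ * _ => q1 Ye y0 zd.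
have : y * 2^-1 <= y * (1 - q) by apply: ler_wpM2l => //; lra.
lra.
Qed.

(** Among the invertible elements, those whose inverse lies in the algebra
    form an open set by Neumann's series, and so do the others because the
    algebra is closed; [GI A] is connected and contains the identity. *)
Lemma GI_has_inverse a : GI A a -> has_inverse a.
Proof.
suff <- : GI A `&` has_inverse = GI A by case.
apply: component_connected.
- exists (pa_one A); split; first exact: GI1.
  by exists 1; [exact: pa1|split; rewrite /= mul1r].
- by exists has_inverse => //; exact: has_inverse_open.
- exists (~` [set a : A | exists2 W, ~ inA W & inverse_of (pa_val a) W]).
    by apply: open_closedC; exact: lacks_inverse_open.
  apply/seteqP; split => b [Gb hb]; split=> //.
    by case: hb => W AW bW [W' AW' bW']; apply: AW'; rewrite -(inverse_unique bW bW').
  have [W bW] := GI_inv Gb; exists W => //.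
  by apply: contrapT => AW; apply: hb; exists W.
Qed.

End GIFacts.

(** * Adjoints and quadratic forms *)

Section Adj.
Variables (R : realType) (H : hilbertType R).
Implicit Types (X Z W P : bop H) (x y : H).
Local Notation "''[' x , y ]" := (inner x y).

Lemma ipxx x : '[x, x] = (mag x ^+ 2)%:C.
Proof. by rewrite innerxx magE rmorphXn. Qed.

Lemma ipC x y : '[y, x] = (('[x, y])^*)%C.
Proof. by rewrite innerC. Qed.

Lemma ipDl x y z : '[x + y, z] = '[x, z] + '[y, z].
Proof. exact: linearDl. Qed.
Lemma ipDr x y z : '[x, y + z] = '[x, y] + '[x, z].
Proof. exact: linearDr. Qed.
Lemma ipBl x y z : '[x - y, z] = '[x, z] - '[y, z].
Proof. exact: linearBl. Qed.
Lemma ipBr x y z : '[x, y - z] = '[x, y] - '[x, z].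
Proof. exact: linearBr. Qed.
Lemma ipZl a x y : '[a *: x, y] = a * '[x, y].
Proof. exact: linearZl_LR. Qed.
Lemma ipZr a x y : '[x, a *: y] = (a^*)%C * '[x, y].
Proof. exact: linearZr_LR. Qed.

Lemma ip_CS x y : mag '[x, y] <= mag x * mag y.
Proof. by have := inner_CauchySchwarz x y; rewrite !magE -rmorphM lecR. Qed.

Lemma ip_inj x y : (forall z, '[z, x] = '[z, y]) -> x = y.
Proof.
move=> h; apply/eqP; rewrite -subr_eq0 -mag_eq0.
have : mag (x - y) ^+ 2 = 0 by apply: (@complexI R); rewrite -ipxx ipBr h subrr.
by move/eqP; rewrite expf_eq0.
Qed.

Lemma adjP Z x y : '[Z x, y] = '[x, adjoint Z y].
Proof. exact: adjointP. Qed.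

Lemma adjP' Z x y : '[adjoint Z x, y] = '[x, Z y].
Proof. by rewrite ipC -adjP -ipC. Qed.

Lemma adj_unique Z W : (forall x y, '[Z x, y] = '[x, W y]) -> adjoint Z = W.
Proof. by move=> h; apply: bopP => y; apply: ip_inj => x; rewrite -adjP h. Qed.

Lemma adjK Z : adjoint (adjoint Z) = Z.
Proof. by apply: adj_unique => x y; rewrite adjP'. Qed.

Lemma adjM Z W : adjoint (Z * W) = adjoint W * adjoint Z.
Proof. by apply: adj_unique => x y; rewrite !bopME !adjP. Qed.

Lemma adj1 : adjoint (1 : bop H) = 1.
Proof. by apply: adj_unique. Qed.

Lemma adjD Z W : adjoint (Z + W) = adjoint Z + adjoint W.
Proof. by apply: adj_unique => x y; rewrite !bopDE ipDl ipDr !adjP. Qed.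

Lemma adjZ a Z : adjoint (a *: Z) = (a^*)%C *: adjoint Z.
Proof. by apply: adj_unique => x y; rewrite !bopZE ipZl ipZr conjcK adjP. Qed.

Lemma adjB Z W : adjoint (Z - W) = adjoint Z - adjoint W.
Proof. by apply: adj_unique => x y; rewrite !bopBE ipBl ipBr !adjP. Qed.

Lemma mag_adj Z : mag (adjoint Z) <= mag Z.
Proof.
apply: mag_bop_le => [|y]; first exact: mag_ge0.
have [h|h] := eqVneq (mag (adjoint Z y)) 0.
  by rewrite h mulr_ge0 ?mag_ge0.
have h0 : 0 < mag (adjoint Z y) by rewrite lt_def h mag_ge0.
rewrite -(ler_pM2r h0) -expr2.
have -> : mag (adjoint Z y) ^+ 2 = mag '[Z (adjoint Z y), y].
  by rewrite adjP ipxx magR ger0_norm// exprn_ge0// mag_ge0.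
apply: le_trans (ip_CS _ _) _; rewrite mulrAC; apply: ler_wpM2r; first exact: mag_ge0.
exact: mag_app.
Qed.

Lemma mag_sqrE Z x : '[adjoint Z (Z x), x] = (mag (Z x) ^+ 2)%:C.
Proof. by rewrite adjP' ipxx. Qed.

Lemma form_defect Z x : '[(adjoint Z * Z - 1) x, x] = (mag (Z x) ^+ 2 - mag x ^+ 2)%:C.
Proof. by rewrite bopBE bop1E ipBl bopME mag_sqrE ipxx rmorphB. Qed.

(** For [P = Z^* Z - 1] the positivity of the form of [P] at [x - s P x]
    bounds [|P x| ^ 2] by a multiple of [<P x, x>], and [|P x|] is bounded
    below by invertibility. *)
Lemma positive_invertible_below Z W : op_positive (adjoint Z * Z - 1) ->
  inverse_of (adjoint Z * Z - 1) W ->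
  exists2 c : R, 0 < c & forall x, (1 + c) * mag x ^+ 2 <= mag (Z x) ^+ 2.
Proof.
set P := adjoint Z * Z - 1 => Ppos [PW WP].
have Psa : adjoint P = P by rewrite /P adjB adj1 adjM adjK.
pose p x := mag (Z x) ^+ 2 - mag x ^+ 2.
have pE x : '[P x, x] = (p x)%:C by exact: form_defect.
have p0 x : 0 <= p x by have := Ppos x; rewrite pE ler0c.
pose M := mag P + 1.
have M0 : 0 < M by rewrite ltr_wpDl// mag_ge0.
have pM x : p x <= M * mag x ^+ 2.
  have : mag '[P x, x] <= M * mag x ^+ 2.
    apply: le_trans (ip_CS _ _) _; rewrite expr2 mulrA; apply: ler_wpM2r; first exact: mag_ge0.
    apply: le_trans (mag_app _ _) _; apply: ler_wpM2r; first exact: mag_ge0.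
    by rewrite lerDl.
  by rewrite pE magR ger0_norm.
(* The form of [P] is non-negative at [x - M^-1 P x]. *)
have pP x : M^-1 * mag (P x) ^+ 2 <= p x.
  set s := M^-1; have s0 : 0 < s by rewrite invr_gt0.
  set y := P x.
  have : 0 <= p (x - s%:C *: y) by [].
  have -> : p (x - s%:C *: y) = p x - 2 * s * mag y ^+ 2 + s ^+ 2 * p y.
    have PB : P (x - s%:C *: y) = P x - s%:C *: P y by rewrite linearB linearZ.
    apply: (@complexI R); rewrite -pE PB ipBl !ipBr !ipZl !ipZr pE pE.
    have e1 : '[P y, x] = (mag y ^+ 2)%:C by rewrite -{1}Psa adjP' -/y ipxx.
    rewrite conjc_real e1 -/y ipxx.
    by rewrite -!rmorphM -!rmorphB; congr (_%:C); ring.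
  have := pM y; have : s * M = 1 by rewrite mulVf// gt_eqF.
  move=> sM h; have := ler_wpM2l (exprn_ge0 2 (ltW s0)) h.
  have -> : s ^+ 2 * (M * mag y ^+ 2) = s * mag y ^+ 2 by rewrite expr2 mulrA -(mulrA s) sM mulr1.
  lra.
have W0 := mag_ge0 W.
have W1 : 0 < mag W + 1 by rewrite ltr_wpDl.
exists (M^-1 / (mag W + 1) ^+ 2); first by rewrite divr_gt0 ?exprn_gt0// invr_gt0.
move=> x; have xP : mag x <= (mag W + 1) * mag (P x).
  have {1}-> : x = W (P x) by rewrite -bopME WP.
  apply: le_trans (mag_app _ _) _; apply: ler_wpM2r; first exact: mag_ge0.
  by rewrite lerDl.
have x2 : mag x ^+ 2 <= (mag W + 1) ^+ 2 * mag (P x) ^+ 2.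
  by rewrite -exprMn lerXn2r ?nnegrE ?mulr_ge0 ?mag_ge0// ltW.
have := pP x; rewrite /p => h.
have : M^-1 / (mag W + 1) ^+ 2 * mag x ^+ 2 <= M^-1 * mag (P x) ^+ 2.
  rewrite -mulrA; apply: ler_wpM2l; first by rewrite invr_ge0 ltW.
  by rewrite mulrC ler_pdivrMr ?exprn_gt0// mulrC.
lra.
Qed.

(** One direction is [positive_invertible_below]. For the other, [Z^* Z - 1 =
    Z^* (1 - X^* X) Z], whose middle factor is invertible by Neumann's series. *)
Lemma op_lt1P Z X : inverse_of Z X -> op_lt 1 (adjoint Z * Z) <-> mag X < 1.
Proof.
move=> [ZX XZ]; split.
  move=> [Ppos [W [h1 h2]]].
  have [c c0 hc] := positive_invertible_below Ppos (conj h2 h1).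
  have s0 : 0 < Num.sqrt (1 + c) by rewrite sqrtr_gt0 addr_gt0.
  have s1 : 1 < Num.sqrt (1 + c).
    by rewrite -[X in X < _]sqrtr1 ltr_sqrt ?addr_gt0// ltrDl.
  apply: (@le_lt_trans _ _ (Num.sqrt (1 + c))^-1); last by rewrite invf_lt1.
  apply: mag_bop_le => [|y]; first by rewrite invr_ge0 ltW.
  have := hc (X y); have -> : Z (X y) = y by rewrite -bopME ZX.
  move=> h; rewrite mulrC ler_pdivlMr// mulrC.
  rewrite -(@ler_pXn2r _ 2) ?nnegrE ?mulr_ge0 ?mag_ge0 ?(ltW s0)//.
  by rewrite exprMn sqr_sqrtr// addr_ge0// ltW.
move=> X1; split.
  move=> x; rewrite form_defect ler0c subr_ge0 lerXn2r ?nnegrE ?mag_ge0//.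
  have {1}-> : x = X (Z x) by rewrite -bopME XZ.
  apply: le_trans (mag_app _ _) _; by rewrite ler_piMl ?mag_ge0 ?(ltW X1).
have i1 : inverse_of (1 : bop H) 1 by split; rewrite mulr1.
have E1 : mag (1 : bop H) * mag (- (adjoint X * X)) < 1.
  rewrite magN; apply: le_lt_trans (ler_pM (mag_ge0 _) (mag_ge0 _) (mag_bop1 H) (mag_mul _ _)) _.
  rewrite mul1r; apply: le_lt_trans (ler_wpM2r (mag_ge0 _) (mag_adj X)) _.
  by rewrite -expr2 expr_lt1 ?mag_ge0.
have [Y [[Y1 Y2] _]] := bop_neumann i1 E1.
have aZX : adjoint X * adjoint Z = 1 by rewrite -adjM ZX adj1.
have aXZ : adjoint Z * adjoint X = 1 by rewrite -adjM XZ adj1.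
have PE : adjoint Z * Z - 1 = adjoint Z * (1 - adjoint X * X) * Z.
  by rewrite mulrBr mulr1 mulrBl !mulrA aXZ mul1r XZ.
exists (X * Y * adjoint X); rewrite PE; split.
  rewrite -!mulrA (mulrA (adjoint X) (adjoint Z)) aZX mul1r (mulrA Y) Y2 mul1r.
  exact: XZ.
rewrite -!mulrA (mulrA Z X) ZX mul1r (mulrA (1 - _) Y) Y1 mul1r.
exact: aXZ.
Qed.

End Adj.

Section OperatorFacts.
Variables (R : realType) (H : hilbertType R).
Implicit Types (T Z W : bop H) (x y : H).
Local Notation "''[' x , y ]" := (inner x y).

Lemma quad_form_eq0 T : (forall x, '[T x, x] = 0) -> T = 0.
Proof.
move=> h; apply: bopP => x; apply: ip_inj => y.
have add u v : '[T u, v] + '[T v, u] = 0.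
  have TD : T (u + v) = T u + T v by rewrite linearD.
  by have := h (u + v); rewrite TD ipDl !ipDr !h add0r addr0.
have h1 := add x y; have := add x ('i *: y).
have TZ : T ('i *: y) = 'i *: T y by rewrite linearZ.
rewrite ipZr TZ ipZl => h2.
have ci : (('i : R[i])^*)%C = - 'i by apply: complexP2 => /=; rewrite ?oppr0.
rewrite ci in h2.
have i0 : ('i : R[i]) != 0 by rewrite -mag_gt0 magi.
have h3 : '[T y, x] - '[T x, y] = 0.
  by apply: (mulfI i0); rewrite mulr0 -h2; ring.
have : '[T x, y] *+ 2 = 0 by rewrite -[RHS](subrr 0) -{1}h1 -h3; ring.
move/eqP; rewrite mulrn_eq0 /= => /eqP h4.
by rewrite ipC h4 conjc0 linear0r.
Qed.

Lemma quad_form_inj T W : (forall x, '[T x, x] = '[W x, x]) -> T = W.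
Proof.
move=> h; apply/eqP; rewrite -subr_eq0; apply/eqP/quad_form_eq0 => x.
by rewrite bopBE ipBl h subrr.
Qed.

(** With the phase of [m] chosen so that [m <T x, x>] is positive, the form of
    [1 + m T] at [x] would exceed [|x| ^ 2] unless [<T x, x> = 0]. *)
Lemma one_extreme T : (forall m : R[i], mag m <= 2^-1 -> mag (1 + m *: T) <= 1) -> T = 0.
Proof.
move=> h; apply: quad_form_eq0 => x; apply/eqP/negP => /negP n0.
set c := '[T x, x] in n0.
have mc : 0 < mag c by rewrite mag_gt0.
pose m : R[i] := (mag c / 2)%:C / c.
have mm : mag m <= 2^-1.
  rewrite magM magV magR ger0_norm; last by rewrite divr_ge0 ?mag_ge0.
  by rewrite mulrAC divff ?gt_eqF// mul1r.
have := ip_CS ((1 + m *: T) x) x.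
rewrite bopDE bopZE bop1E ipDl ipZl ipxx -/c divfK//.
rewrite -rmorphD magR ger0_norm; last by rewrite addr_ge0 ?divr_ge0 ?exprn_ge0 ?mag_ge0.
have := ler_wpM2r (mag_ge0 x) (le_trans (mag_app (1 + m *: T) x) (ler_wpM2r (mag_ge0 x) (h m mm))).
by rewrite bopDE bopZE bop1E mul1r -expr2; lra.
Qed.

(** With [N = 1 - U^* U], the operator is [U (1 + m N)], and [|U y| ^ 2 = |y|
    ^ 2 - <N y, y>] at [y = x + m N x] is a polynomial in [m] whose
    coefficients are forms of powers of [N]; as [0 <= N <= 1], it stays below
    [|x| ^ 2]. *)
Lemma contraction_bump (U : bop H) (m : R[i]) : mag U <= 1 -> mag m <= 2^-1 ->
  mag (U + m *: (U - U * adjoint U * U)) <= 1.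
Proof.
move=> U1 m2; set N := 1 - adjoint U * U.
have -> : U + m *: (U - U * adjoint U * U) = U * (1 + m *: N).
  by rewrite mulrDr mulr1 bop_scaler /N mulrBr mulr1 mulrA.
apply: mag_bop_le => // x; rewrite mul1r bopME.
have Nsa : adjoint N = N by rewrite /N adjB adj1 adjM adjK.
have Ule z : mag (U z) <= mag z.
  by apply: le_trans (mag_app _ _) _; rewrite ler_piMl ?mag_ge0.
have aUle z : mag (adjoint U z) <= mag z.
  apply: le_trans (mag_app _ _) _; rewrite ler_piMl ?mag_ge0//.
  exact: le_trans (mag_adj U) U1.
have Nform z : '[N z, z] = (mag z ^+ 2 - mag (U z) ^+ 2)%:C.
  by rewrite /N bopBE bop1E ipBl bopME mag_sqrE ipxx rmorphB.
pose n z := mag z ^+ 2 - mag (U z) ^+ 2.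
have sq (a b : R) : 0 <= a -> a <= b -> a ^+ 2 <= b ^+ 2.
  by move=> a0 ab; rewrite lerXn2r ?nnegrE// (le_trans a0).
have n0 z : 0 <= n z by rewrite subr_ge0 sq ?mag_ge0.
have Nn z : mag (N z) ^+ 2 <= n z.
  have E : (mag (N z) ^+ 2)%:C = (mag z ^+ 2 - 2 * mag (U z) ^+ 2 + mag (adjoint U (U z)) ^+ 2)%:C.
    rewrite -ipxx /N bopBE bop1E bopME ipBl !ipBr !ipxx mag_sqrE.
    have -> : '[z, adjoint U (U z)] = (mag (U z) ^+ 2)%:C by rewrite -adjP ipxx.
    by rewrite -!rmorphB; congr (_%:C); ring.
  have {}E := complexI E; rewrite E /n.
  have := sq _ _ (mag_ge0 _) (aUle (U z)); lra.
set y := (1 + m *: N) x.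
have yE : y = x + m *: N x by [].
have Uy : (mag (U y) ^+ 2)%:C = (mag y ^+ 2)%:C - '[N y, y].
  by rewrite Nform -rmorphB; congr (_%:C); ring.
pose r := complex.Re m.
have m2E : (m * (m^*)%C) = (mag m ^+ 2)%:C by rewrite mulrC conj_circle.
have mE : m + (m^*)%C = (2 * r)%:C by rewrite /r; case: (m) => a b; apply: complexP2 => /=; ring.
have my : mag y ^+ 2 = mag x ^+ 2 + 2 * r * n x + mag m ^+ 2 * mag (N x) ^+ 2.
  apply: (@complexI R); rewrite -ipxx yE ipDl !ipDr !ipZl !ipZr !ipxx Nform -/(n x).
  have -> : '[x, N x] = (n x)%:C by rewrite -(adjP' N) Nsa Nform.
  transitivity ((mag x ^+ 2)%:C + (m + (m^*)%C) * (n x)%:C + m * (m^*)%C * (mag (N x) ^+ 2)%:C).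
    by ring.
  by rewrite mE m2E -!rmorphM -!rmorphD.
have Ny : '[N y, y] = (n x + 2 * r * mag (N x) ^+ 2 + mag m ^+ 2 * n (N x))%:C.
  have NyE : N y = N x + m *: N (N x) by rewrite yE linearD linearZ.
  rewrite NyE yE ipDl !ipDr !ipZl !ipZr !Nform -/(n x) -/(n (N x)).
  have e1 : '[N x, N x] = (mag (N x) ^+ 2)%:C by rewrite ipxx.
  have e2 : '[N (N x), x] = (mag (N x) ^+ 2)%:C by rewrite -{1}Nsa adjP' ipxx.
  rewrite e1 e2.
  transitivity ((n x)%:C + (m + (m^*)%C) * (mag (N x) ^+ 2)%:C + m * (m^*)%C * (n (N x))%:C).
    by ring.
  by rewrite mE m2E -!rmorphM -!rmorphD.
have Uy2 : mag (U y) ^+ 2 <= mag x ^+ 2.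
  have : mag (U y) ^+ 2 = mag y ^+ 2 - (n x + 2 * r * mag (N x) ^+ 2 + mag m ^+ 2 * n (N x)).
    by apply: (@complexI R); rewrite Uy Ny -rmorphB.
  rewrite my => ->.
  have r1 : `|r| <= 2^-1 by apply: le_trans (mag_Re m) m2.
  have m4 : mag m ^+ 2 <= 4^-1.
    apply: le_trans (sq _ _ (mag_ge0 _) m2) _.
    by rewrite le_eqVlt; apply/orP; left; apply/eqP; field.
  have := Nn x; have := n0 x; have := n0 (N x); have := Nn (N x).
  have := exprn_ge0 2 (mag_ge0 (N (N x))); have := exprn_ge0 2 (mag_ge0 (N x)).
  have := exprn_ge0 2 (mag_ge0 m).
  move: r1; rewrite ler_norml => /andP[r1 r2].
  set a := n x; set b := mag (N x) ^+ 2; set c := n (N x); set q := mag m ^+ 2 in m4 *.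
  move=> q0 b0 d0 dc c0 a0 ba.
  have : 0 <= (a - b) * (1 - 2 * r) by rewrite mulr_ge0//; lra.
  have : 0 <= q * c by rewrite mulr_ge0.
  have : 0 <= b * (4^-1 - q) by rewrite mulr_ge0//; lra.
  nra.
by rewrite -(@ler_pXn2r _ 2) ?nnegrE ?mag_ge0.
Qed.

End OperatorFacts.

Section SelfAdjoint.
Variables (R : realType) (H : hilbertType R).
Local Notation "''[' x , y ]" := (inner x y).
Implicit Types (S T : bop H) (x y : H).

Lemma mag_le_form (T : bop H) (M : R) : 0 <= M ->
  (forall x y, mag '[T x, y] <= M * (mag x * mag y)) -> mag T <= M.
Proof.
move=> M0 h; apply: mag_bop_le => // x.
have [h0|h0] := eqVneq (mag (T x)) 0; first by rewrite h0 mulr_ge0// mag_ge0.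
have p0 : 0 < mag (T x) by rewrite lt_def h0 mag_ge0.
rewrite -(ler_pM2r p0) -mulrA; apply: le_trans (h x (T x)).
by rewrite ipxx magR ger0_norm ?exprn_ge0 ?mag_ge0// expr2.
Qed.

(** The norm of a self-adjoint operator, or its opposite, lies in the
    spectrum: otherwise [1 - T ^ 2 / m ^ 2] with [m = |T|] would be bounded
    below, and [T] would have norm less than [m]. *)
Lemma selfadjoint_eq0 T : adjoint T = T ->
  (forall s : R, exists W, inverse_of (1 + s%:C *: T) W) -> T = 0.
Proof.
move=> Tsa hinv; apply/mag0_eq/eqP/negP => /negP m0.
have mp : 0 < mag T by rewrite lt_def m0 mag_ge0.
set m := mag T in mp.
have [W1 [_ W1P]] := hinv m^-1; have [W2 [_ W2P]] := hinv (- m^-1).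
pose M := mag W1 * mag W2.
have M0 : 0 <= M by rewrite mulr_ge0 ?mag_ge0.
(* Since [1 + T / m] and [1 - T / m] are invertible, [1 - T ^ 2 / m ^ 2] is
   bounded below. *)
have below x : mag x <= M * mag (x - (m^-1 ^+ 2)%:C *: T (T x)).
  have E : W1 (W2 (x - (m^-1 ^+ 2)%:C *: T (T x))) = x.
    have -> : x - (m^-1 ^+ 2)%:C *: T (T x) = (1 + (- m^-1)%:C *: T) ((1 + (m^-1)%:C *: T) x).
      rewrite bopDE bop1E bopZE bopDE bop1E bopZE.
      have -> : T (x + (m^-1)%:C *: T x) = T x + (m^-1)%:C *: T (T x) by rewrite linearD linearZ.
      rewrite scalerDr scalerA -rmorphM mulNr -expr2 !rmorphN !scaleNr.
      by rewrite addrA addrK.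
    have e2 z : W2 ((1 + (- m^-1)%:C *: T) z) = z by rewrite -bopME W2P.
    have e1 z : W1 ((1 + (m^-1)%:C *: T) z) = z by rewrite -bopME W1P.
    by rewrite e2 e1.
  rewrite -{1}E; apply: le_trans (mag_app _ _) _; rewrite -mulrA; apply: ler_wpM2l; first exact: mag_ge0.
  exact: mag_app.
have M1 : 0 < M ^+ 2 + 1 by rewrite ltr_wpDl// exprn_ge0.
have key x : mag (T x) ^+ 2 <= m ^+ 2 * (1 - (M ^+ 2 + 1)^-1) * mag x ^+ 2.
  have h1 := below x.
  have E : mag (x - (m^-1 ^+ 2)%:C *: T (T x)) ^+ 2 =
      mag x ^+ 2 - 2 * m^-1 ^+ 2 * mag (T x) ^+ 2 + (m^-1 ^+ 2) ^+ 2 * mag (T (T x)) ^+ 2.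
    apply: (@complexI R); rewrite -ipxx ipBl !ipBr !ipZl !ipZr !conjc_real.
    have e1 : '[T (T x), x] = (mag (T x) ^+ 2)%:C by rewrite -{1}Tsa adjP' ipxx.
    have e2 : '[x, T (T x)] = (mag (T x) ^+ 2)%:C by rewrite -{1}Tsa -adjP ipxx.
    rewrite e1 e2 !ipxx -!rmorphM -!rmorphB; congr (_%:C); ring.
  have h2 : mag (T (T x)) ^+ 2 <= m ^+ 2 * mag (T x) ^+ 2.
    by rewrite -exprMn lerXn2r ?nnegrE ?mulr_ge0 ?mag_ge0//; exact: mag_app.
  have h3 : (m^-1 ^+ 2) ^+ 2 * mag (T (T x)) ^+ 2 <= m^-1 ^+ 2 * mag (T x) ^+ 2.
    apply: le_trans (ler_wpM2l (exprn_ge0 _ (exprn_ge0 _ _)) h2) _; first by rewrite invr_ge0 ltW.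
    rewrite mulrA le_eqVlt; apply/orP; left; apply/eqP; congr (_ * _).
    by field; rewrite gt_eqF.
  have h4 : mag x ^+ 2 <= M ^+ 2 * (mag x ^+ 2 - m^-1 ^+ 2 * mag (T x) ^+ 2).
    apply: (@le_trans _ _ (M ^+ 2 * mag (x - (m^-1 ^+ 2)%:C *: T (T x)) ^+ 2)).
      by rewrite -exprMn lerXn2r ?nnegrE ?mulr_ge0 ?mag_ge0.
    by apply: ler_wpM2l; [exact: exprn_ge0|rewrite E; lra].
  have YX : mag (T x) ^+ 2 <= m ^+ 2 * mag x ^+ 2.
    by rewrite -exprMn lerXn2r ?nnegrE ?mulr_ge0 ?mag_ge0//; exact: mag_app.
  have X0 : 0 <= mag x ^+ 2 by rewrite exprn_ge0// mag_ge0.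
  move: (mag x ^+ 2) (mag (T x) ^+ 2) h4 YX X0 => X Y h4 YX X0.
  have h5 : m^-1 ^+ 2 * Y <= (1 - (M ^+ 2 + 1)^-1) * X.
    have -> : (1 - (M ^+ 2 + 1)^-1) * X = M ^+ 2 * X / (M ^+ 2 + 1).
      by field; rewrite gt_eqF.
    rewrite ler_pdivlMr//.
    have : 0 <= X - m^-1 ^+ 2 * Y.
      have mi : 0 <= m^-1 ^+ 2 by rewrite exprn_ge0// invr_ge0 ltW.
      move: YX => /(ler_wpM2l mi); rewrite [X in _ <= X -> _]mulrA -exprMn mulVf ?gt_eqF// expr1n mul1r.
      by rewrite subr_ge0.
    move: h4; nra.
  have -> : Y = m ^+ 2 * (m^-1 ^+ 2 * Y) by rewrite mulrA -exprMn divff ?gt_eqF// expr1n mul1r.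
  by rewrite -mulrA; apply: ler_wpM2l => //; exact: exprn_ge0 (ltW mp).
pose q := 1 - (M ^+ 2 + 1)^-1.
have q1 : q < 1 by rewrite ltrBlDr ltrDl invr_gt0.
have q0 : 0 <= q by rewrite subr_ge0 invf_le1// lerDr exprn_ge0.
have : m <= m * Num.sqrt q.
  apply: mag_bop_le => [|x]; first by rewrite mulr_ge0 ?sqrtr_ge0 ?ltW.
  rewrite -(@ler_pXn2r _ 2) ?nnegrE ?mulr_ge0 ?sqrtr_ge0 ?mag_ge0 ?(ltW mp)//.
  by rewrite !exprMn sqr_sqrtr//; exact: key.
rewrite -[leLHS]mulr1 ler_pM2l// => h.
have s1 : Num.sqrt q < 1 by rewrite -[X in _ < X]sqrtr1 ltr_sqrt.
by move: (lt_le_trans s1 h); rewrite ltxx.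
Qed.

(** Polarization, followed by normalization of both vectors. *)
Lemma mag_le_quad S (M : R) : 0 <= M ->
  (forall x, mag '[S x, x] <= M * mag x ^+ 2) -> mag S <= 2 * M.
Proof.
move=> M0 h; apply: mag_le_form => [|x y]; first by rewrite mulr_ge0.
have sym u v : mag ('[S u, v] + '[S v, u]) <= M * (mag u ^+ 2 + mag v ^+ 2).
  have SD : S (u + v) = S u + S v by rewrite linearD.
  have SB : S (u - v) = S u - S v by rewrite linearB.
  have E : 2 * ('[S u, v] + '[S v, u]) = '[S (u + v), u + v] - '[S (u - v), u - v].
    by rewrite SD SB ipBl !ipBr ipDl !ipDr; ring.
  have par : mag (u + v) ^+ 2 + mag (u - v) ^+ 2 = 2 * (mag u ^+ 2 + mag v ^+ 2).
    apply: (@complexI R); rewrite rmorphM !rmorphD /= -!ipxx ipBl !ipBr ipDl !ipDr.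
    by rewrite rmorph1; ring.
  have := magD '[S (u + v), u + v] (- '[S (u - v), u - v]).
  rewrite -E magM mag_nat magN; have := h (u + v); have := h (u - v).
  have := congr1 (fun r => M * r) par; rewrite mulrDr; lra.
have pol u v : mag '[S u, v] <= M * (mag u ^+ 2 + mag v ^+ 2).
  have h1 := sym u v; have := sym u ('i *: v).
  have SZ : S ('i *: v) = 'i *: S v by rewrite linearZ.
  have ci : (('i : R[i])^*)%C = - 'i by apply: complexP2 => /=; rewrite ?oppr0.
  rewrite SZ ipZr ipZl ci magZ magi mul1r => h2.
  have h3 : mag ('[S u, v] - '[S v, u]) <= M * (mag u ^+ 2 + mag v ^+ 2).
    by move: h2; rewrite mulNr addrC -mulrBr magM magi mul1r magB.
  have E : 2 * '[S u, v] = ('[S u, v] + '[S v, u]) + ('[S u, v] - '[S v, u]) by ring.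
  have := magD ('[S u, v] + '[S v, u]) ('[S u, v] - '[S v, u]).
  rewrite -E magM mag_nat; lra.
have [->|x0] := eqVneq x 0; first by rewrite linear0 linear0l !mag0 mul0r mulr0.
have [->|y0] := eqVneq y 0; first by rewrite linear0r !mag0 !mulr0.
have mx : 0 < mag x by rewrite mag_gt0. have my : 0 < mag y by rewrite mag_gt0.
have SE : S ((mag x)^-1%:C *: x) = (mag x)^-1%:C *: S x by rewrite linearZ.
have := pol ((mag x)^-1%:C *: x) ((mag y)^-1%:C *: y).
rewrite SE ipZl ipZr conjc_real !magM !magZ !magR !ger0_norm ?invr_ge0 ?mag_ge0//.
rewrite !mulVf ?gt_eqF// expr1n mulrCA ler_pdivrMl// ler_pdivrMl// => /le_trans; apply.
by rewrite le_eqVlt; apply/orP; left; apply/eqP; ring.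
Qed.

End SelfAdjoint.

(** * Inversion in a power algebra *)

Section Inversion.
Variables (R : realType) (H : hilbertType R) (A : powerAlgebra H).
Implicit Types (a b e x : A).
Local Notation inA := (pa_set A).

Lemma has_inverseP a : has_inverse a -> exists b : A, inverse_of (pa_val a) (pa_val b).
Proof. by move=> [W AW aW]; exists (pa_mk AW). Qed.

(** The inverse inside the algebra, with value [0] where there is none. *)
Definition pinv a : A :=
  if pselect (has_inverse a) is left h then sval (cid (has_inverseP h)) else 0.

Lemma pinvP a : has_inverse a -> inverse_of (pa_val a) (pa_val (pinv a)).
Proof. by rewrite /pinv => ha; case: pselect => // h; exact: svalP (cid (has_inverseP h)). Qed.

Lemma pinv_unique a b : inverse_of (pa_val a) (pa_val b) -> pinv a = b.
Proof.
move=> ab; apply: pa_inj; apply: (inverse_unique (pinvP _) ab).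
by exists (pa_val b) => //; exact: pa_in.
Qed.

Lemma has_inverse_pinv a : has_inverse a -> has_inverse (pinv a).
Proof.
move=> ha; exists (pa_val a); first exact: pa_in.
exact/inverse_sym/pinvP.
Qed.

Lemma pinvK a : has_inverse a -> pinv (pinv a) = a.
Proof. by move=> /pinvP/inverse_sym/pinv_unique. Qed.

Definition sandwich x e : A := pa_mk (pa_sandwich (pa_in x) (pa_in e)).

Lemma sandwich_is_linear x : linear (sandwich x).
Proof.
move=> k a b; apply: pa_inj; rewrite pa_valD pa_valZ /= mulrDr mulrDl.
by rewrite bop_scaler bop_scalel.
Qed.
HB.instance Definition _ x := GRing.isLinear.Build R[i] A A _ (sandwich x) (sandwich_is_linear x).

Lemma sandwichE x e : pa_val (sandwich x e) = pa_val x * pa_val e * pa_val x.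
Proof. by []. Qed.

Lemma mag_sandwich x e : mag (sandwich x e) <= mag x * mag x * mag e.
Proof.
rewrite pa_mag sandwichE; apply: le_trans (mag_mul _ _) _.
rewrite mulrAC; apply: ler_wpM2r; first exact: mag_ge0.
exact: mag_mul.
Qed.

Lemma inverse_resid (Z X E Y : bop H) : inverse_of Z X -> inverse_of (Z + E) Y ->
  Y - X = - (Y * E * X).
Proof.
move=> [ZX XZ] [ZY YZ].
have := congr1 (fun B => B * X) YZ; rewrite mulrDr mulrDl -mulrA ZX mulr1 mul1r.
by move=> /eqP; rewrite addrC eq_sym -subr_eq => /eqP <-; rewrite opprB addrC.
Qed.

(** The derivative of inversion at [a]. *)
Definition dinv a e : A := - sandwich (pinv a) e.
Lemma dinv_is_linear a : linear (dinv a).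
Proof. by move=> k b c; rewrite /dinv linearP opprD scalerN. Qed.
HB.instance Definition _ a := GRing.isLinear.Build R[i] A A _ (dinv a) (dinv_is_linear a).

Lemma pinv_diff a : has_inverse a -> differentiable pinv a /\ 'd pinv a = dinv a :> (A -> A).
Proof.
move=> ha; have aX := pinvP ha; set x := pinv a in aX.
apply: (@diff_of_eps _ _ _ _ _ _ (mag x * mag x)) => [e|e e0].
  by rewrite /= magN mag_sandwich.
have x0 := mag_ge0 x.
pose B := 2 * (mag x * mag x * mag x) + 1.
have B0 : 0 < B by rewrite ltr_wpDl// mulr_ge0// !mulr_ge0.
have x1 : 0 < 2 * (mag x + 1) by rewrite mulr_gt0// ltr_wpDl.
exists (Num.min (2 * (mag x + 1))^-1 (e / B)); first by rewrite lt_min invr_gt0 x1 divr_gt0.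
move=> h; rewrite lt_min => /andP[h1 h2].
have q1 : mag (pa_val x) * mag (pa_val h) <= 2^-1.
  rewrite -!pa_mag; apply: le_trans (ler_wpM2l x0 (ltW h1)) _.
  rewrite invfM mulrCA ler_piMr ?invr_ge0//.
  by rewrite ler_pdivrMr ?ltr_wpDl// mul1r lerDl.
have t1 : (2^-1 : R) < 1 by rewrite invf_lt1// ltr1n.
have [Y [AY hY Ye]] := pa_neumann aX (pa_in x) (pa_in h) (le_lt_trans q1 t1).
have -> : pinv (a + h) = pa_mk AY by apply: pinv_unique.
have YX := inverse_resid aX hY.
have -> : mag (pa_mk AY - pinv a - dinv a h) = mag ((Y - pa_val x) * pa_val h * pa_val x).
  rewrite pa_mag -[RHS]magN; congr mag.
  rewrite !pa_valB pa_valN opprK sandwichE -/x /=.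
  by rewrite !mulrBl opprB addrC -YX.
have Y2 : mag (Y - pa_val x) <= 2 * (mag x * mag x * mag h).
  move: Ye q1; rewrite -!pa_mag; have := mag_ge0 (Y - pa_val x).
  set y := mag (Y - _); set q := mag x * mag h => y0 Ye q1.
  have : y * 2^-1 <= y * (1 - q) by apply: ler_wpM2l => //; lra.
  lra.
apply: le_trans (mag_mul _ _) _.
apply: (@le_trans _ _ (2 * (mag x * mag x * mag h) * mag h * mag x)).
  apply: ler_wpM2r; first exact: mag_ge0.
  apply: le_trans (mag_mul _ _) _.
  by apply: ler_wpM2r; [exact: mag_ge0|].
rewrite (_ : 2 * _ * _ * _ = (2 * (mag x * mag x * mag x) * mag h) * mag h); last by ring.
apply: ler_wpM2r; first exact: mag_ge0.
apply: (@le_trans _ _ (B * mag h)); last by rewrite mulrC -ler_pdivlMr// ltW.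
by apply: ler_wpM2r; [exact: mag_ge0|rewrite lerDl].
Qed.

Lemma path_GI (f : R -> A) : (forall (s e : R), 0 < e -> exists2 d : R, 0 < d &
    forall t, `|t - s| < d -> mag (f t - f s) <= e) ->
  (forall t, 0 <= t <= 1 -> Inv (f t)) -> GI A (f 0) -> GI A (f 1).
Proof.
move=> fc fI g0.
apply: (@GI_connected _ _ _ (f @` `[0, 1]) (f 0)) => //.
- by exists 0 => //; rewrite /= in_itv /= lexx ler01.
- by exists 1 => //; rewrite /= in_itv /= lexx ler01.
- by move=> _ [t ht <-]; apply: fI; move: ht; rewrite /= in_itv.
- apply: connected_continuous_connected; first exact: segment_connected.
  apply: continuous_subspaceT => s; apply/cvgrPdist_le => e e0.
  have er : e = (complex.Re e)%:C by rewrite RRe_real// gtr0_real.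
  have re0 : 0 < complex.Re e by rewrite -ltcR -er.
  have [d d0 hd] := fc s _ re0.
  apply/nbhs_ballP; exists d => // t; rewrite /ball /= distrC => /hd.
  by rewrite er magE lecR magB.
Qed.

Lemma GI_segment a b : GI A a ->
  (forall t : R, 0 <= t <= 1 -> Inv (a + t%:C *: b)) -> GI A (a + b).
Proof.
move=> ga hinv; pose f (t : R) : A := a + t%:C *: b.
have f1 : f 1 = a + b by rewrite /f scale1r.
rewrite -f1; apply: path_GI => //; last by rewrite /f scale0r addr0.
move=> s d d0; have m1 : 0 < mag b + 1 by rewrite ltr_wpDl// mag_ge0.
exists (d / (mag b + 1)); first by rewrite divr_gt0.
move=> t ts; rewrite /f opprD addrACA subrr add0r -scalerBl -rmorphB magZ magR.
move: ts; rewrite ltr_pdivlMr// => ts; apply: le_trans (ltW ts).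
by apply: ler_wpM2l => //; rewrite lerDl.
Qed.

Lemma GI_open a : GI A a -> exists2 e : R, 0 < e & forall b, mag (b - a) < e -> GI A b.
Proof.
move=> ga; have [W AW aW] := GI_has_inverse ga.
have [e e0 he] := small_pert (mag_ge0 W); exists e => // b ba.
rewrite -[b](subrK a) addrC; apply: GI_segment => // t /andP[t0 t1].
have q1 : mag W * mag (pa_val (t%:C *: (b - a))) < 1.
  apply: le_lt_trans he; apply: ler_wpM2l; first exact: mag_ge0.
  by rewrite -pa_mag magZ magR ger0_norm//; apply: ltW; apply: le_lt_trans ba; rewrite ler_piMl ?mag_ge0.
have [Y [bY _]] := bop_neumann aW q1.
by apply: (@invertible_of _ _ _ _ Y); rewrite pa_valD.
Qed.

Lemma cexp_log (l : R[i]) : l != 0 -> exists c, cexp c = l.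
Proof.
move=> l0; have [h|h] := pselect (~ (0 <= l)).
  by have [c hc _] := cexp_surj h; exists c.
have ml : 0 < mag l by rewrite mag_gt0.
have lE : l = (mag l)%:C by move/contrapT: h => h; rewrite -magE ger0_norm.
exists (ln (mag l))%:C; rewrite [RHS]lE; apply: complexP2; rewrite /= ?cos0 ?sin0 ?mulr1 ?mulr0//.
by rewrite lnK.
Qed.

(** The path [exp (t c) *: a], with [exp c = l], leads from [a] to [l *: a]
    through invertible elements. *)
Lemma GI_scale (l : R[i]) a : l != 0 -> GI A a -> GI A (l *: a).
Proof.
move=> /cexp_log[c <-] ga; have [W aW] := GI_inv ga.
pose f (t : R) : A := cexp (t%:C * c) *: a.
have f1 : f 1 = cexp c *: a by rewrite /f mul1r.
rewrite -f1; apply: path_GI.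
- move=> s e e0; have m1 : 0 < mag a + 1 by rewrite ltr_wpDl// mag_ge0.
  have c1 : 0 < mag c + 1 by rewrite ltr_wpDl// mag_ge0.
  have [d d0 hd] := cdiff_ccont (cdiff_cexp (s%:C * c)) (divr_gt0 e0 m1).
  exists (d / (mag c + 1)); first by rewrite divr_gt0.
  move=> t ts; rewrite /f -scalerBl magZ.
  have := hd (t%:C * c); rewrite -mulrBl -rmorphB magM magR => h.
  have {}h : mag (cexp (t%:C * c) - cexp (s%:C * c)) <= e / (mag a + 1).
    apply: h; move: ts; rewrite ltr_pdivlMr//; apply: le_lt_trans.
    by apply: ler_wpM2l => //; rewrite lerDl.
  apply: le_trans (ler_wpM2r (mag_ge0 _) h) _.
  by rewrite mulrAC ler_pdivrMr// ler_pM2l// lerDl.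
- move=> t _; case: aW => h1 h2.
  apply: (@invertible_of _ _ _ _ ((cexp (t%:C * c))^-1 *: W)).
  have n0 := cexp_neq0 (t%:C * c).
  by split; rewrite /f pa_valZ bop_scalel bop_scaler scalerA ?h1 ?h2 ?divff ?mulVf// scale1r.
- by rewrite /f mul0r cexp0 scale1r.
Qed.

(** A component absorbs every connected set of invertible elements that it
    meets. *)
Lemma GI_image (f : A -> A) a b : (forall c, GI A c -> {for c, continuous f}) ->
  (forall c, GI A c -> Inv (f c)) -> GI A b -> GI A (f b) -> GI A a -> GI A (f a).
Proof.
move=> fc fI gb gfb ga.
apply: (@GI_connected _ _ _ (f @` GI A) (f b) (f a) gfb); [by exists b|by exists a| |].
- by move=> _ [c gc <-]; exact: fI.
- apply: connected_continuous_connected; first exact: component_connected.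
  by apply: continuous_in_subspaceT => c /set_mem; exact: fc.
Qed.

Lemma pinv1 : pinv (pa_one A) = pa_one A.
Proof. by apply: pinv_unique; split; rewrite /= mul1r. Qed.

Lemma GI_pinv a : GI A a -> GI A (pinv a).
Proof.
move=> ga; apply: (@GI_image pinv a (pa_one A) _ _ _ _ ga).
- by move=> c /GI_has_inverse /pinv_diff[+ _]; exact: differentiable_continuous.
- move=> c gc; apply: (@invertible_of _ _ _ _ (pa_val c)).
  exact/inverse_sym/pinvP/GI_has_inverse.
- exact: GI1.
- by rewrite pinv1; exact: GI1.
Qed.

Lemma domainDP a : domainD A a <-> GI A a /\ mag (pinv a) < 1.
Proof.
split=> -[ga h]; split=> //.
  by apply/(op_lt1P (pinvP (GI_has_inverse ga))).
by apply/(op_lt1P (pinvP (GI_has_inverse ga))).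
Qed.

Definition ballB : set A := [set a | GI A a /\ mag a < 1].

Lemma pinv_ballB a : domainD A a -> ballB (pinv a).
Proof. by move=> /domainDP[ga a1]; split=> //; exact: GI_pinv. Qed.

Lemma pinv_domainD a : ballB a -> domainD A (pinv a).
Proof.
move=> [ga a1]; apply/domainDP; split; first exact: GI_pinv.
by rewrite pinvK//; exact: GI_has_inverse.
Qed.

Lemma open_unit_ballE a : open_unit_ball A a <-> mag a < 1.
Proof. by rewrite /open_unit_ball /= magE -[1]/(1%:C) ltcR. Qed.

Lemma ballBE : GI A `&` open_unit_ball A = ballB.
Proof. by apply/seteqP; split=> a [ga] /open_unit_ballE. Qed.

End Inversion.

(** * Moebius transformations of the unit ball *)

Section Moebius.
Variables (R : realType) (H : hilbertType R) (A : powerAlgebra H).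
Implicit Types (a b u z w V : A) (t : R).

Definition unitary u := has_inverse u /\ forall x, mag (pa_val u x) = mag x.

Lemma unitary_pinv u : unitary u -> unitary (pinv u).
Proof.
move=> [hu iso]; split; first exact: has_inverse_pinv.
by move=> x; rewrite -iso -bopME (pinvP hu).1.
Qed.

Lemma unitary_mag u : unitary u -> mag u <= 1.
Proof. by move=> [_ iso]; rewrite pa_mag; apply: mag_bop_le => // x; rewrite iso mul1r. Qed.

Lemma unitary_one : unitary (pa_one A).
Proof. by split => //; exists 1; [exact: pa1|split; rewrite mulr1]. Qed.

Lemma unitaryZ (c : R[i]) u : mag c = 1 -> unitary u -> unitary (c *: u) /\ pinv (c *: u) = c^-1 *: pinv u.
Proof.
move=> c1 [hu iso]; have c0 : c != 0 by rewrite -mag_gt0 c1.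
have cu : inverse_of (pa_val (c *: u)) (pa_val (c^-1 *: pinv u)).
  have [h1 h2] := pinvP hu.
  by split; rewrite !pa_valZ bop_scalel bop_scaler scalerA ?h1 ?h2 ?divff ?mulVf// scale1r.
split; last exact: pinv_unique.
split; first by exists (pa_val (c^-1 *: pinv u)) => //; exact: pa_in.
by move=> x; rewrite pa_valZ bopZE magZ c1 mul1r.
Qed.

(** On operators this is [(z + t u) (u + t z)^-1 u], the translate of the unit
    ball that moves [0] to [t u]; the form chosen here shows that it stays in
    the algebra. *)
Definition mob u t z : A :=
  (t^-1)%:C *: (u - (1 - t ^+ 2)%:C *: sandwich u (pinv (u + t%:C *: z))).

Variables (u : A) (uu : unitary u).
Let hu : has_inverse u := uu.1.
Let iso : forall x, mag (pa_val u x) = mag x := uu.2.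

Section FixedParameter.
Variables (t : R) (t0 : t != 0) (t2 : `|t| <= 2^-1).

Lemma mob_has_inverse z : mag z <= 1 -> has_inverse (u + t%:C *: z).
Proof.
move=> z1; have q1 : mag (pa_val (pinv u)) * mag (pa_val (t%:C *: z)) < 1.
  apply: (@le_lt_trans _ _ 2^-1); last by rewrite invf_lt1// ltr1n.
  rewrite -!pa_mag magZ magR -[2^-1]mul1r; apply: ler_pM; rewrite ?mag_ge0 ?mulr_ge0 ?mag_ge0//.
    exact/unitary_mag/unitary_pinv.
  by rewrite -[2^-1]mulr1; apply: ler_pM; rewrite ?mag_ge0.
have [Y [AY zY _]] := pa_neumann (pinvP hu) (pa_in _) (pa_in (t%:C *: z)) q1.
by exists Y.
Qed.

(** The operator [(u + t z)^-1 u]. Factoring it out expresses [mob] and its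
    defect by the vectors [u (S x)] and [z (S x)]. *)
Definition mobS z : bop H := pa_val (pinv (u + t%:C *: z)) * pa_val u.

Lemma mobS_eq z : mag z <= 1 ->
  pa_val u * mobS z + t%:C *: (pa_val z * mobS z) = pa_val u.
Proof.
move=> /mob_has_inverse/pinvP[+ _]; rewrite pa_valD pa_valZ /mobS => h.
by rewrite -bop_scalel -mulrDl mulrA h mul1r.
Qed.

Lemma mobE z : mag z <= 1 ->
  pa_val (mob u t z) = pa_val z * mobS z + t%:C *: (pa_val u * mobS z).
Proof.
move=> z1; have := mobS_eq z1; rewrite /mob pa_valZ pa_valB pa_valZ sandwichE -mulrA -/(mobS z).
set a := pa_val u * _; set b := pa_val z * _ => <-.
have t0C : t%:C != 0 by rewrite -mag_gt0 magR normr_gt0.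
apply: (scalerI t0C); rewrite scalerA -rmorphM divff// scale1r scalerDr scalerA -rmorphM.
rewrite rmorphB scalerBl scale1r opprB -expr2 addrC addrA.
by rewrite subrK addrC.
Qed.

Lemma mobS_below z x : mag z <= 1 -> mag x <= 2 * mag (mobS z x) /\ mag (mobS z x) <= 2 * mag x.
Proof.
move=> z1; have : pa_val u (mobS z x) + t%:C *: pa_val z (mobS z x) = pa_val u x.
  by rewrite -[in RHS](mobS_eq z1).
move: (mobS z x) => y E.
have zy : mag (t%:C *: pa_val z y) <= 2^-1 * mag y.
  rewrite magZ magR; apply: ler_pM; rewrite ?mag_ge0//.
  by apply: le_trans (mag_app _ _) _; rewrite -pa_mag ler_piMl ?mag_ge0.
have uy := iso y.
have y0 := mag_ge0 y.
split; first by rewrite -iso -E; apply: le_trans (magD _ _) _; rewrite uy; lra.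
have := mag_subl (pa_val u y) (- (t%:C *: pa_val z y)); rewrite opprK E magN !iso; lra.
Qed.

(** With [a = u (S x)] and [b = z (S x)], this is the identity [|a + t b| ^ 2
    - |b + t a| ^ 2 = (1 - t ^ 2) (|a| ^ 2 - |b| ^ 2)]. *)
Lemma mob_defect z x : mag z <= 1 ->
  mag x ^+ 2 - mag (pa_val (mob u t z) x) ^+ 2 =
  (1 - t ^+ 2) * (mag (mobS z x) ^+ 2 - mag (pa_val z (mobS z x)) ^+ 2).
Proof.
move=> z1; rewrite -(iso (mobS z x)) mobE//.
have -> : mag x = mag (pa_val u (mobS z x) + t%:C *: pa_val z (mobS z x)).
  by rewrite -iso -[in LHS](mobS_eq z1).
rewrite bopDE bopZE !bopME; set a := pa_val u _; set b := pa_val z _.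
apply: (@complexI R); rewrite -[RHS]/((_ * _)%:C) rmorphM /= !rmorphB /= -!ipxx.
rewrite !ipDl !ipDr !ipZl !ipZr conjc_real rmorphXn /=.
by rewrite rmorph1; ring.
Qed.

Let t21 : t ^+ 2 <= 4^-1.
Proof.
have : `|t| ^+ 2 <= (2^-1) ^+ 2 by rewrite lerXn2r ?nnegrE ?invr_ge0.
by rewrite real_normK ?num_real// => /le_trans; apply; rewrite exprVn lef_pV2 ?posrE//; lra.
Qed.

Lemma mob_le1 z : mag z <= 1 -> mag (mob u t z) <= 1.
Proof.
move=> z1; rewrite pa_mag; apply: mag_bop_le => // x; rewrite mul1r.
rewrite -(@ler_pXn2r _ 2) ?nnegrE ?mag_ge0// -subr_ge0 mob_defect//.
apply: mulr_ge0; first by have := t21; lra.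
rewrite subr_ge0 ler_pXn2r ?nnegrE ?mag_ge0//.
by apply: le_trans (mag_app _ _) _; rewrite -pa_mag ler_piMl ?mag_ge0.
Qed.

Lemma mob_lt1 z : mag z < 1 -> mag (mob u t z) < 1.
Proof.
move=> z1; have z0 := mag_ge0 z.
pose d := (1 - mag z ^+ 2) / 8.
have zz : mag z ^+ 2 < 1 by rewrite expr_lt1.
have z2 : 0 <= mag z ^+ 2 by rewrite exprn_ge0.
have d0 : 0 < d by rewrite divr_gt0// subr_gt0.
have d1 : 0 <= 1 - d by rewrite /d; lra.
apply: (@le_lt_trans _ _ (Num.sqrt (1 - d))); last first.
  by rewrite -[X in _ < X]sqrtr1 ltr_sqrt// ltrBlDr ltrDl.
rewrite pa_mag; apply: mag_bop_le => [|x]; first exact: sqrtr_ge0.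
rewrite -(@ler_pXn2r _ 2) ?nnegrE ?mulr_ge0 ?sqrtr_ge0 ?mag_ge0//.
rewrite exprMn sqr_sqrtr//.
have := mob_defect x (ltW z1); have [x1 _] := mobS_below x (ltW z1).
set y := mobS z x in x1 *; set m := mag (pa_val _ _).
have zy : mag (pa_val z y) ^+ 2 <= mag z ^+ 2 * mag y ^+ 2.
  by rewrite -exprMn ler_pXn2r ?nnegrE ?mulr_ge0 ?mag_ge0//; exact: mag_app.
have x2 : mag x ^+ 2 <= 4 * mag y ^+ 2.
  rewrite (_ : 4 = 2 ^+ 2); last by rewrite expr2; lra.
  by rewrite -exprMn ler_pXn2r ?nnegrE ?mulr_ge0 ?mag_ge0.
have y2 : 0 <= mag y ^+ 2 by rewrite exprn_ge0// mag_ge0.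
move=> E; have t1 := t21.
have h1 : (1 - mag z ^+ 2) * mag y ^+ 2 <= mag y ^+ 2 - mag (pa_val z y) ^+ 2.
  by rewrite mulrBl mul1r lerD2l lerN2.
have h2 : 0 <= (1 - mag z ^+ 2) * mag y ^+ 2 by rewrite mulr_ge0// subr_ge0 ltW.
have h3 : 2^-1 * ((1 - mag z ^+ 2) * mag y ^+ 2) <= mag x ^+ 2 - m ^+ 2.
  rewrite E; apply: ler_pM => //; lra.
have h4 : (1 - mag z ^+ 2) * mag x ^+ 2 <= 4 * ((1 - mag z ^+ 2) * mag y ^+ 2).
  by rewrite [leRHS]mulrCA; apply: ler_wpM2l => //; rewrite subr_ge0 ltW.
rewrite mulrBl mul1r /d; lra.
Qed.

Lemma mob0 : mob u t 0 = t%:C *: u.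
Proof.
apply: pa_inj; rewrite mobE ?mag0// mul0r add0r pa_valZ /mobS scaler0 addr0.
by rewrite (pinvP hu).2 mulr1.
Qed.

Lemma mobS_expand z : mag z <= 1 ->
  mobS z = 1 - t%:C *: (pa_val (pinv u) * pa_val z * mobS z).
Proof.
move=> z1; have := congr1 (fun B => pa_val (pinv u) * B) (mobS_eq z1).
move: (mobS z) => S; rewrite /= mulrDr (pinvP hu).2 bop_scaler !mulrA (pinvP hu).2 mul1r => <-.
by rewrite addrK.
Qed.

Lemma mob_expand z : mag z <= 1 ->
  mag (mob u t z - (z + t%:C *: (u - sandwich z (pinv u)))) <= 5 * t ^+ 2.
Proof.
move=> z1; rewrite pa_mag pa_valB mobE// pa_valD pa_valZ pa_valB sandwichE.
have S2 : mag (mobS z) <= 2.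
  by apply: mag_bop_le => // x; have [] := mobS_below x z1.
have SE := mobS_expand z1.
set S := mobS z in S2 SE *; set Z := pa_val z; set U := pa_val u; set U' := pa_val (pinv u) in SE *.
have UU' : U * U' = 1 by have [] := pinvP hu.
have ZS : Z * S = Z - t%:C *: (Z * U' * Z * S).
  by rewrite {1}SE mulrBr mulr1 bop_scaler !mulrA.
have US : U * S = U - t%:C *: (Z * S).
  by rewrite {1}SE mulrBr mulr1 bop_scaler !mulrA UU' mul1r.
have -> : Z * S + t%:C *: (U * S) - (Z + t%:C *: (U - Z * U' * Z)) =
   - (t ^+ 2)%:C *: (Z * S) + (t ^+ 2)%:C *: (Z * U' * Z * (U' * Z * S)).
  rewrite US; set T := Z * S in ZS *; rewrite {1}ZS.
  have -> : Z * U' * Z * S = Z * U' * Z - t%:C *: (Z * U' * Z * (U' * Z * S)).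
    by rewrite {1}SE mulrBr mulr1 bop_scaler !mulrA.
  rewrite !scalerBr !scalerA expr2 rmorphM /=.
  set p := t%:C *: U; set q := t%:C *: _; set r := _ *: _.
  set s := _ *: T.
  rewrite scaleNr -/s; move: p q r s => p q r s.
  apply: (addIr (Z + (p - q))); rewrite subrK opprB -addrA [RHS]addrCA; congr (_ + _).
  by rewrite [RHS]addrACA [RHS]addrC (addrC (- s)).
have Z1 : mag Z <= 1 by [].
have U'1 : mag U' <= 1 by apply/unitary_mag/unitary_pinv.
have ZS2 : mag (Z * S) <= 2.
  by apply: le_trans (mag_mul _ _) _; rewrite -[2]mul1r; apply: ler_pM; rewrite ?mag_ge0.
have US2 : mag (U' * Z * S) <= 2.
  by rewrite -mulrA; apply: le_trans (mag_mul _ _) _; rewrite -[2]mul1r; apply: ler_pM; rewrite ?mag_ge0.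
have W2 : mag (Z * U' * Z * (U' * Z * S)) <= 2.
  apply: le_trans (mag_mul _ _) _; rewrite -[2]mul1r; apply: ler_pM; rewrite ?mag_ge0//.
  apply: le_trans (mag_mul _ _) _; rewrite -[1]mul1r; apply: ler_pM; rewrite ?mag_ge0//.
  apply: le_trans (mag_mul _ _) _; rewrite -[1]mul1r; apply: ler_pM; rewrite ?mag_ge0//.
apply: le_trans (magD _ _) _; rewrite scaleNr magN !magZ magR ger0_norm ?sqr_ge0//.
have h0 := sqr_ge0 t.
have := ler_wpM2l h0 ZS2; have := ler_wpM2l h0 W2; lra.
Qed.

End FixedParameter.
End Moebius.

Section MoebiusCalculus.
Variables (R : realType) (H : hilbertType R) (A : powerAlgebra H).
Implicit Types (u z V : A) (t : R).

Lemma mob_diff u t z V : t != 0 -> has_inverse (u + t%:C *: z) ->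
  differentiable (mob u t) z /\
  'd (mob u t) z V = (1 - t ^+ 2)%:C *: sandwich u (sandwich (pinv (u + t%:C *: z)) V).
Proof.
move=> t0 hz; have [pd pE] := pinv_diff hz.
pose k : R[i] := - ((t^-1)%:C * (1 - t ^+ 2)%:C).
pose S : {linear A -> A} := [the {linear A -> A} of k \*: sandwich u].
have SE e : S e = k *: sandwich u e by [].
pose T : {linear A -> A} := [the {linear A -> A} of t%:C \*: idfun].
have TE e : T e = t%:C *: e by [].
have TC e : mag (T e) <= mag t%:C * mag e by rewrite TE magZ.
have [Td TdE] := affine_diff u z TC.
have SC e : mag (S e) <= mag k * (mag u * mag u) * mag e.
  by rewrite SE magZ -mulrA; apply: ler_wpM2l; [exact: mag_ge0|exact: mag_sandwich].
have [Sd SdE] := affine_diff ((t^-1)%:C *: u) (pinv (u + t%:C *: z)) SC.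
have mE : mob u t = (fun x => (t^-1)%:C *: u + S (pinv (u + T x))).
  by apply/funext => x; rewrite /mob scalerBr scalerA -scaleNr.
have [d1 E1] := diff_chain Td pd; have [d2 E2] := diff_chain d1 Sd.
split; first by rewrite mE.
transitivity (S (dinv (u + t%:C *: z) (T V))).
  by rewrite mE (E2 V) SdE (E1 V) TdE pE.
rewrite SE TE /dinv.
rewrite linearN linearZ /= linearZ /= scalerN scaleNr opprK scalerA mulrAC -rmorphM mulVf//.
by rewrite mul1r.
Qed.

End MoebiusCalculus.

Section MoebiusInverse.
Variables (R : realType) (H : hilbertType R) (A : powerAlgebra H).
Implicit Types (u z V : A) (t : R).

Lemma sq_neq1 t : `|t| <= 2^-1 -> 1 - t ^+ 2 != 0.
Proof.
move=> t2; have : `|t| ^+ 2 <= (2^-1) ^+ 2 by rewrite lerXn2r ?nnegrE ?invr_ge0.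
rewrite real_normK ?num_real// => h; apply/eqP => e.
have : (2^-1 : R) ^+ 2 < 1 by rewrite expr_lt1 ?invr_ge0// invf_lt1// ltr1n.
by move: h e; lra.
Qed.

(** By definition [u - t mob u t z] is [(1 - t ^ 2) u (u + t z)^-1 u]. *)
Lemma mob_pinv u t z : unitary u -> t != 0 -> `|t| <= 2^-1 -> mag z <= 1 ->
  inverse_of (pa_val (u + (- t)%:C *: mob u t z))
    (pa_val ((1 - t ^+ 2)^-1%:C *: sandwich (pinv u) (u + t%:C *: z))).
Proof.
move=> uu t0 t2 z1; have [h1 h2] := pinvP uu.1.
have [y1 y2] := pinvP (mob_has_inverse uu t2 z1).
have -> : u + (- t)%:C *: mob u t z = (1 - t ^+ 2)%:C *: sandwich u (pinv (u + t%:C *: z)).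
  rewrite /mob scalerA -rmorphM mulNr divff// rmorphN rmorph1 scaleN1r opprB addrC.
  by rewrite subrK.
have t1 := sq_neq1 t2.
set p := u + _ in y1 y2 *; set P := pa_val p in y1 y2 *.
set y := pinv p in y1 y2 *; set Y := pa_val y in y1 y2 *.
set U := pa_val u in h1 h2 *; set U' := pa_val (pinv u) in h1 h2 *.
have E1 : (U * Y * U) * (U' * P * U') = 1.
  by rewrite -!mulrA (mulrA U U') h1 mul1r (mulrA Y) y2 mul1r.
have E2 : (U' * P * U') * (U * Y * U) = 1.
  by rewrite -!mulrA (mulrA U' U) h2 mul1r (mulrA P) y1 mul1r.
split; rewrite !pa_valZ !sandwichE bop_scalel bop_scaler scalerA -rmorphM.
  by rewrite E1 divff// rmorph1 scale1r.
by rewrite E2 mulVf// rmorph1 scale1r.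
Qed.

Lemma sandwichK u z : has_inverse u -> sandwich u (sandwich (pinv u) z) = z.
Proof.
move=> /pinvP[h1 h2]; apply: pa_inj; rewrite !sandwichE -!mulrA h2 mulr1.
by rewrite mulrA h1 mul1r.
Qed.

Lemma sandwichK' u z : has_inverse u -> sandwich (pinv u) (sandwich u z) = z.
Proof.
move=> /pinvP[h1 h2]; apply: pa_inj; rewrite !sandwichE -!mulrA h1 mulr1.
by rewrite mulrA h2 mul1r.
Qed.

Lemma mobK u t z : unitary u -> t != 0 -> `|t| <= 2^-1 -> mag z <= 1 ->
  mob u (- t) (mob u t z) = z.
Proof.
move=> uu t0 t2 z1; rewrite {1}/mob (pinv_unique (mob_pinv uu t0 t2 z1)).
have hu : has_inverse u := uu.1.
rewrite [sandwich u _]linearZ /= (sandwichK _ hu) sqrrN scalerA -rmorphM divff ?sq_neq1//.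
rewrite rmorph1 scale1r opprD addrA subrr add0r -scaleNr scalerA -rmorphN -rmorphM.
by rewrite invrN mulrNN mulVf// rmorph1 scale1r.
Qed.

Lemma mob_diff0 u t V : unitary u -> t != 0 -> `|t| <= 2^-1 ->
  'd (mob u t) 0 V = (1 - t ^+ 2)%:C *: V.
Proof.
move=> uu t0 t2; have h0 : mag (0 : A) <= 1 by rewrite mag0.
have [_ ->] := mob_diff V t0 (mob_has_inverse uu t2 h0).
by rewrite scaler0 addr0 (sandwichK _ (uu.1 : has_inverse u)).
Qed.

Lemma mob_diff_back u t V : unitary u -> t != 0 -> `|t| <= 2^-1 ->
  'd (mob u (- t)) (t%:C *: u) V = (1 - t ^+ 2)^-1%:C *: V.
Proof.
move=> uu t0 t2; have h0 : mag (0 : A) <= 1 by rewrite mag0.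
have := mob_pinv uu t0 t2 h0; rewrite mob0// scaler0 addr0 => hi.
have hu := uu.1; have t0' : - t != 0 by rewrite oppr_eq0.
have [_ ->] := @mob_diff _ _ _ u (- t) (t%:C *: u) V t0'
  (ex_intro2 _ _ _ (pa_in _) hi).
rewrite (pinv_unique hi) sqrrN; set c := 1 - t ^+ 2.
have c0 : c != 0 := sq_neq1 t2.
have -> : sandwich (pinv u) u = pinv u.
  by apply: pa_inj; rewrite sandwichE (pinvP hu).2 mul1r.
have -> : sandwich (c^-1%:C *: pinv u) V = (c^-1 * c^-1)%:C *: sandwich (pinv u) V.
  by apply: pa_inj; rewrite pa_valZ !sandwichE pa_valZ !bop_scalel bop_scaler scalerA -rmorphM.
rewrite [sandwich u _]linearZ /= (sandwichK _ hu) scalerA -rmorphM; congr (_%:C *: _).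
by rewrite mulrA divff// mul1r.
Qed.

End MoebiusInverse.

(** * Linear isometries are Jordan homomorphisms up to a unitary *)

Section Isometry.
Variables (R : realType) (H : hilbertType R) (A : powerAlgebra H).
Local Notation "''[' x , y ]" := (inner x y).
Implicit Types (z w V : A).

(** Both signs of [t] are allowed, so the first-order term of the form has to
    vanish. *)
Lemma first_order_re (T : bop H) (C : R) x :
  (forall t : R, t != 0 -> `|t| <= 2^-1 -> mag (1 + t%:C *: T) <= 1 + C * t ^+ 2) ->
  complex.Re '[T x, x] = 0.
Proof.
move=> h; set rho := complex.Re _; pose D := `|C| * mag x ^+ 2.
have D0 : 0 <= D by rewrite mulr_ge0// exprn_ge0// mag_ge0.
have key t : t != 0 -> `|t| <= 2^-1 -> t * rho <= D * t ^+ 2.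
  move=> t0 t2; have hb := h t t0 t2.
  have : mag '[(1 + t%:C *: T) x, x] <= (1 + C * t ^+ 2) * mag x ^+ 2.
    apply: le_trans (ip_CS _ _) _; rewrite expr2 mulrA; apply: ler_wpM2r; first exact: mag_ge0.
    apply: le_trans (mag_app _ _) _; apply: ler_wpM2r; first exact: mag_ge0.
    exact: hb.
  rewrite bopDE bop1E bopZE ipDl ipZl ipxx => hm.
  have := le_trans (ler_norm _) (le_trans (mag_Re _) hm).
  have -> : complex.Re ((mag x ^+ 2)%:C + t%:C * '[T x, x]) = mag x ^+ 2 + t * rho.
    by rewrite /rho; case: '[T x, x] => a b /=; ring.
  have : C * t ^+ 2 * mag x ^+ 2 <= D * t ^+ 2.
    rewrite /D mulrAC; apply: ler_wpM2r; first exact: sqr_ge0.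
    by apply: ler_wpM2r; [rewrite exprn_ge0// mag_ge0|exact: ler_norm].
  lra.
apply/eqP; rewrite -normr_eq0 eq_le normr_ge0 andbT.
apply/ler_addgt0Pl => e e0; rewrite addr0.
have D1 : 0 < D + 1 by rewrite ltr_wpDl.
pose t := Num.min 2^-1 (e / (D + 1)).
have t0 : 0 < t by rewrite lt_min invr_gt0 ltr0n divr_gt0.
have t2 : t <= 2^-1 by rewrite ge_min lexx.
have t3 : t * (D + 1) <= e by rewrite -ler_pdivlMr// ge_min lexx orbT.
clearbody t.
have k1 := key t (lt0r_neq0 t0); rewrite gtr0_norm// in k1.
have k2 := key (- t); rewrite oppr_eq0 normrN gtr0_norm// in k2.
have {}k1 := k1 t2; have {}k2 := k2 (lt0r_neq0 t0) t2.
rewrite ler_norml; apply/andP; split; rewrite -(ler_pM2l t0); nra.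
Qed.

Variables (L M : {linear A -> A}) (LK : cancel L M) (MK : cancel M L).
Hypothesis (Liso : forall z, mag (L z) = mag z).
Local Notation u := (L (pa_one A)).
Hypothesis (hu : has_inverse u).

Let Miso z : mag (M z) = mag z. Proof. by rewrite -Liso MK. Qed.
Let one_le1 : mag (pa_one A) <= 1. Proof. exact/unitary_mag/unitary_one. Qed.

(** [L] maps the contractions [mob w t (M 1)] to contractions whose expansion
    in [t] starts with [1 + t L (w - sandwich (M 1) (pinv w))]. *)
Lemma isometry_first_order w x : unitary w ->
  complex.Re '[pa_val (L (w - sandwich (M (pa_one A)) (pinv w))) x, x] = 0.
Proof.
move=> uw; apply: (@first_order_re _ 5) => t t0 t2.
have V1 : mag (M (pa_one A)) <= 1 by rewrite Miso.
have := mob_expand uw t0 t2 V1; set B := _ - sandwich _ _.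
have := mob_le1 uw t0 t2 V1; set m := mob _ _ _ => m1.
clearbody m B; rewrite -Liso linearB linearD /= MK linearZ /= => m2.
have : mag (pa_one A + t%:C *: L B) <= 1 + 5 * t ^+ 2.
  have -> : pa_one A + t%:C *: L B = L m - (L m - (pa_one A + t%:C *: L B)).
    by rewrite subKr.
  by apply: le_trans (magD _ _) _; rewrite magN Liso lerD.
by [].
Qed.

(** [isometry_first_order] with [w = 1] and with [w = i] gives the real and
    the imaginary parts of the quadratic forms. *)
Lemma isometry_adjoint :
  adjoint (pa_val u) = pa_val (L (sandwich (M (pa_one A)) (pa_one A))).
Proof.
apply: quad_form_inj => x.
set V := M _; set B := L (sandwich _ _).
have h1 := isometry_first_order x (unitary_one A).
have [ui iE] := unitaryZ (magi R) (unitary_one A).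
have h2 := isometry_first_order x ui.
rewrite iE pinv1 in h1 h2.
rewrite linearB -/V -/B pa_valB bopBE ipBl in h1.
have LE : L ('i *: pa_one A - sandwich V ('i^-1 *: pa_one A)) = 'i *: u - 'i^-1 *: B.
  by rewrite linearB linearZ [sandwich V _]linearZ /= linearZ.
rewrite LE in h2.
have : complex.Re ('i * '[pa_val u x, x] - 'i^-1 * '[pa_val B x, x]) = 0.
  by rewrite -h2 pa_valB !pa_valZ bopBE !bopZE ipBl !ipZl.
have -> : ('i : R[i])^-1 = - 'i.
  by apply: complexP2; rewrite /= ?expr0n ?expr1n /= ?add0r ?divr1 ?mul0r ?oppr0 ?mulr1.
have -> : '[adjoint (pa_val u) x, x] = (('[pa_val u x, x])^*)%C by rewrite adjP' [LHS]ipC.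
move: h1; set a := '[_, _]; set b := '[pa_val B x, x].
case: (a) => a1 a2; case: (b) => b1 b2 /= h1 h3.
apply: complexP2 => /=; lra.
Qed.

(** The inverse isometry maps the contractions [u + m (u - u u^* u)] to [1 + m
    T] for a fixed [T], which vanishes because the identity is an extreme
    point. Hence [u = u u^* u] with [u] invertible. *)
Lemma isometry_unitary : unitary u.
Proof.
split=> // x.
have [h1 h2] := pinvP hu.
pose B := L (sandwich (M (pa_one A)) (pa_one A)).
have BE : pa_val B = adjoint (pa_val u) by rewrite -isometry_adjoint.
pose X := u - sandwich u B.
have X0 : pa_val (M X) = 0.
  apply: one_extreme => m m2.
  have ME : M (u + m *: X) = pa_one A + m *: M X by rewrite linearD linearZ LK.
  have -> : 1 + m *: pa_val (M X) = pa_val (M (u + m *: X)) by rewrite ME.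
  rewrite -pa_mag Miso pa_mag pa_valD pa_valZ pa_valB sandwichE BE.
  by apply: contraction_bump => //; rewrite -pa_mag Liso.
have : X = 0 by rewrite -(MK X) (_ : M X = 0) ?linear0//; exact: pa_inj.
move=> /(congr1 (fun a => pa_val a)); rewrite pa_valB sandwichE BE.
move=> /eqP; rewrite pa_val0 subr_eq0 => /eqP E.
have : adjoint (pa_val u) * pa_val u = 1.
  have := congr1 (fun T => pa_val (pinv u) * T) E.
  by rewrite /= -mulrA mulrA h2 mul1r.
move=> E1; apply/eqP; rewrite -(@eqrXn2 _ 2)// ?mag_ge0//; apply/eqP.
by apply: (@complexI R); rewrite -mag_sqrE -bopME E1 bop1E ipxx.
Qed.

End Isometry.

Section IsometryJordan.
Variables (R : realType) (H : hilbertType R) (A : powerAlgebra H).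
Implicit Types (z w V a b : A).
Variables (L M : {linear A -> A}) (LK : cancel L M) (MK : cancel M L).
Hypothesis (Liso : forall z, mag (L z) = mag z).
Local Notation I := (pa_one A).
Local Notation u := (L I).
Hypothesis (hu : has_inverse u).

Let Miso z : mag (M z) = mag z. Proof. by rewrite -Liso MK. Qed.
Let uu : unitary u := isometry_unitary LK MK Liso hu.
Let u1 : unitary I := unitary_one A.

(** Both sides are biholomorphic maps of the unit ball with the same value and
    the same derivative at the origin, hence equal. *)
Lemma isometry_mob t z : t != 0 -> `|t| <= 2^-1 -> mag z < 1 ->
  L (mob I t z) = mob u t (L z).
Proof.
move=> t0 t2 z1.
have t0' : - t != 0 by rewrite oppr_eq0.
have t2' : `|- t| <= 2^-1 by rewrite normrN.
have b1 x : mag x < 1 -> mag (M x) <= 1 by rewrite Miso => /ltW.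
have mI x (x1 : mag x < 1) := (mob_diff 0 t0 (mob_has_inverse u1 t2 (b1 _ x1))).1.
have m0 : mag (0 : A) < 1 by rewrite mag0.
have M0 : M 0 = 0 by rewrite linear0.
pose f x := L (mob I t (M x)).
have E0 : f 0 = t%:C *: u by rewrite /f M0 (mob0 u1 t0 t2) linearZ.
have fd x (x1 : mag x < 1) := diff_conj Liso Miso (mI x x1).
have Fid : forall Z, mag Z < 1 -> mob u (- t) (f Z) = Z.
  apply: cartan_pair.
  - by move=> x x1; have [] := fd x x1.
  - by move=> x x1; have [] := mob_diff 0 t0' (mob_has_inverse uu t2' (ltW x1)).
  - by move=> x x1; rewrite /f Liso; apply: mob_lt1 => //; rewrite Miso.
  - by move=> x x1; apply: mob_lt1.
  - by rewrite E0 -(mob0 uu t0 t2) (mobK uu t0 t2 (ltW m0)).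
  - move=> U; rewrite E0 (mob_diff_back _ uu t0 t2).
    have -> : 'd f 0 U = (1 - t ^+ 2)%:C *: U.
      apply: etrans ((fd 0 m0).2 U) _; rewrite M0 (mob_diff0 _ u1 t0 t2).
      by rewrite [LHS]linearZ /= MK.
    by rewrite scalerA -rmorphM mulVf ?sq_neq1// rmorph1 scale1r.
have w1 : mag (L (mob I t z)) <= 1 by rewrite Liso; apply: mob_le1 => //; exact: ltW.
have Lz1 : mag (L z) < 1 by rewrite Liso.
have E : mob u (- t) (L (mob I t z)) = L z by rewrite -[RHS](Fid _ Lz1) /f LK.
by rewrite -[LHS](mobK uu t0' t2' w1) opprK E.
Qed.

Let sq_small z : mag z < 1 -> L (sandwich z I) = sandwich (L z) (pinv u).
Proof.
move=> z1; apply/eqP; rewrite -subr_eq0 -mag_eq0 eq_le mag_ge0 andbT.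
set D := _ - _; apply/ler_addgt0Pl => e e0; rewrite addr0.
pose t := Num.min 2^-1 (e / 10).
have t0 : 0 < t by rewrite lt_min invr_gt0 ltr0n divr_gt0.
have t2 : t <= 2^-1 by rewrite ge_min lexx.
have t3 : t * 10 <= e by rewrite -ler_pdivlMr// ge_min lexx orbT.
clearbody t.
have t2' : `|t| <= 2^-1 by rewrite gtr0_norm.
have h1 := mob_expand u1 (lt0r_neq0 t0) t2' (ltW z1).
have Lz1 : mag (L z) <= 1 by rewrite Liso ltW.
have := mob_expand uu (lt0r_neq0 t0) t2' Lz1.
rewrite -isometry_mob ?lt0r_neq0//.
move: h1; move: (mob I t z) => m; rewrite pinv1 -Liso linearB linearD linearZ /= linearB.
set a := L z + _; set b := L z + _ => h1 h2.
have : mag (t%:C *: D) <= 10 * t ^+ 2.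
  have -> : t%:C *: D = (L m - a) - (L m - b).
    rewrite opprB addrC addrA subrK /a /b [RHS]addrAC opprD addrA subrr add0r.
    by rewrite addrC -scalerBr opprB addrC addrA subrK.
  apply: le_trans (magD _ _) _; rewrite magN; lra.
rewrite magZ magR gtr0_norm// expr2 mulrCA ler_pM2l//; lra.
Qed.

(** Compare the terms of first order in [t] in [isometry_mob]; homogeneity
    extends the identity beyond the ball. *)
Lemma isometry_square z : L (sandwich z I) = sandwich (L z) (pinv u).
Proof.
pose c : R := (mag z + 1)^-1.
have m1 : 0 < mag z + 1 by rewrite ltr_wpDl// mag_ge0.
have c0 : 0 < c by rewrite invr_gt0.
have : mag (c%:C *: z) < 1.
  by rewrite magZ magR gtr0_norm// mulrC ltr_pdivrMr// mul1r ltrDl.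
have sc w e : sandwich (c%:C *: w) e = (c * c)%:C *: sandwich w e.
  by apply: pa_inj; rewrite pa_valZ !sandwichE pa_valZ !bop_scalel bop_scaler scalerA -rmorphM.
move=> /sq_small; rewrite [L (c%:C *: z)]linearZ /= !sc linearZ /= => /scalerI; apply.
by rewrite -mag_gt0 magR normr_gt0 mulf_neq0// gt_eqF.
Qed.

(** Dividing by the unitary [u] turns [L] into a unital Jordan homomorphism. *)
Definition jhom z : bop H := pa_val (pinv u) * pa_val (L z).

Lemma jhomD z w : jhom (z + w) = jhom z + jhom w.
Proof. by rewrite /jhom linearD pa_valD mulrDr. Qed.

Lemma jhomZ (c : R[i]) z : jhom (c *: z) = c *: jhom z.
Proof. by rewrite /jhom linearZ pa_valZ bop_scaler. Qed.

Lemma jhomB z w : jhom (z - w) = jhom z - jhom w.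
Proof. by rewrite jhomD -scaleN1r jhomZ scaleN1r. Qed.

Lemma jhom1 : jhom I = 1.
Proof. by have [] := pinvP hu. Qed.

Lemma jhom_inj : injective jhom.
Proof.
move=> z w /(congr1 (fun T => pa_val u * T)); rewrite /jhom /= !mulrA.
by rewrite (pinvP hu).1 !mul1r => /pa_inj /(can_inj LK).
Qed.

Lemma jhom_sq z : jhom (sandwich z I) = jhom z * jhom z.
Proof. by rewrite /jhom isometry_square sandwichE !mulrA. Qed.

(** The anticommutator, expressed by squares so that it lies in the algebra. *)
Definition jord a b : A := sandwich (a + b) I - sandwich a I - sandwich b I.

Lemma anticommE (X Y : bop H) : (X + Y) * (X + Y) - X * X - Y * Y = X * Y + Y * X.
Proof.
rewrite mulrDl !mulrDr; set a := X * X; set b := X * Y; set c := Y * X; set d := Y * Y.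
by rewrite -(addrA a) [a + _]addrC addrK addrA addrK.
Qed.

Lemma jordE a b : pa_val (jord a b) = pa_val a * pa_val b + pa_val b * pa_val a.
Proof. by rewrite -anticommE !pa_valB !sandwichE /= !mulr1. Qed.

Lemma jhom_jord a b : jhom (jord a b) = jhom a * jhom b + jhom b * jhom a.
Proof. by rewrite -anticommE !jhomB !jhom_sq jhomD. Qed.

Lemma jhom_sandwich a b : jhom (sandwich a b) = jhom a * jhom b * jhom a.
Proof.
have two : (2 : R[i]) != 0 by rewrite pnatr_eq0.
apply: (scalerI two); rewrite -jordan_triple -jhomZ.
have -> : 2 *: sandwich a b = jord a (jord a b) - jord (sandwich a I) b.
  by apply: pa_inj; rewrite pa_valZ pa_valB !jordE !sandwichE /= mulr1 -jordan_triple.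
by rewrite jhomB !jhom_jord jhom_sq.
Qed.

(** A pair of mutual inverses is recognised by Jordan products only. *)
Lemma inverse_iff (Z W : bop H) :
  inverse_of Z W <-> Z * W * Z = Z /\ Z * (W * W) * Z = 1.
Proof.
split=> [[ZW WZ]|[h1 h2]].
  by split; rewrite ?ZW ?mul1r// -!mulrA WZ mulr1.
have r : Z * (W * (W * Z)) = 1 by rewrite -h2 !mulrA.
split.
  by have := congr1 (fun T => T * (W * (W * Z))) h1; rewrite /= -[in LHS]mulrA r mulr1.
have l : Z * W * W * Z = 1 by rewrite -h2 !mulrA.
by have := congr1 (fun T => Z * (W * W) * T) h1; rewrite /= !mulrA l mul1r.
Qed.

Lemma jhom_inverse z w :
  inverse_of (pa_val z) (pa_val w) <-> inverse_of (jhom z) (jhom w).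
Proof.
have e1 : pa_val z * pa_val w * pa_val z = pa_val z <-> jhom z * jhom w * jhom z = jhom z.
  rewrite -jhom_sandwich -sandwichE; split=> [/pa_inj->//|/jhom_inj->//].
have e2 : pa_val z * (pa_val w * pa_val w) * pa_val z = 1 <->
    jhom z * (jhom w * jhom w) * jhom z = 1.
  have -> : pa_val w * pa_val w = pa_val (sandwich w I) by rewrite sandwichE mulr1.
  rewrite -jhom_sq -jhom_sandwich -sandwichE; split=> h.
    by rewrite -jhom1; congr jhom; exact: pa_inj.
  by have /jhom_inj -> := etrans h (esym jhom1).
by rewrite !inverse_iff e1 e2.
Qed.

Lemma isometry_pinv z : has_inverse z -> inverse_of (pa_val (L z)) (pa_val (sandwich (pinv u) (L (pinv z)))).
Proof.
move=> /pinvP/jhom_inverse[]; rewrite /jhom; have [] := pinvP hu.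
rewrite sandwichE; set U := pa_val u; set U' := pa_val _; set X := pa_val (L z).
set Y := pa_val (L _) => h1 h2 e1 e2; split; last by rewrite -mulrA e2.
have := congr1 (fun T => U * T * U') e1; rewrite /= mulr1 h1 => <-.
by rewrite !mulrA h1 mul1r.
Qed.

Lemma isometry_has_inverse z : has_inverse (L z) <-> has_inverse z.
Proof.
split; last by move=> /isometry_pinv h; exists (pa_val (sandwich (pinv u) (L (pinv z)))) => //; exact: pa_in.
move=> /pinvP; set c := pinv (L z) => -[e1 e2].
exists (pa_val (M (sandwich u c))); first exact: pa_in.
apply/jhom_inverse; rewrite /jhom MK sandwichE !mulrA (pinvP hu).2 mul1r.
split; last by rewrite mulrA -(mulrA _ (pa_val u)) (pinvP hu).1 mulr1.
rewrite mulrA.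
rewrite -(mulrA (pa_val (pinv u))) e1 mulr1; exact: (pinvP hu).2.
Qed.

Lemma mag_sandwich_unitary w e : unitary w -> mag (sandwich w e) = mag e.
Proof.
have le v a : unitary v -> mag (sandwich v a) <= mag a.
  move=> /unitary_mag v1; apply: le_trans (mag_sandwich _ _) _.
  by rewrite ler_piMl ?mag_ge0// -[1]mulr1; apply: ler_pM; rewrite ?mag_ge0.
move=> uw; apply/eqP; rewrite eq_le le//=.
have hw : has_inverse w := uw.1.
by rewrite -{1}(sandwichK' e hw); apply: le; exact: unitary_pinv.
Qed.

Lemma isometry_mag_pinv z : has_inverse z -> mag (pinv (L z)) = mag (pinv z).
Proof.
move=> hz; rewrite (pinv_unique (isometry_pinv hz)) mag_sandwich_unitary ?Liso//.
exact: unitary_pinv.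
Qed.

Hypothesis (gu : GI A u).

Lemma isometry_GI z : GI A (L z) <-> GI A z.
Proof.
have inv a : has_inverse a -> Inv a by move=> [W _ aW]; exact: invertible_of aW.
have cont (K : {linear A -> A}) : (forall z, mag (K z) = mag z) -> continuous K.
  by move=> Kiso; apply: (@continuous_linear_mag _ _ _ _ 1) => h; rewrite Kiso mul1r.
split=> gz; last first.
  apply: (@GI_image _ _ _ L z I) => //; last exact: GI1.
    by move=> c _; exact: cont.
  by move=> c /GI_has_inverse hc; apply: inv; apply/isometry_has_inverse.
rewrite -(LK z); apply: (@GI_image _ _ _ M (L z) u) => //.
- by move=> c _; exact: cont.
- by move=> c /GI_has_inverse hc; apply: inv; apply/isometry_has_inverse; rewrite MK.
- by rewrite LK; exact: GI1.
Qed.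

Lemma isometry_domainD z : domainD A (L z) <-> domainD A z.
Proof.
have E : GI A z -> mag (pinv (L z)) = mag (pinv z).
  by move=> /GI_has_inverse; exact: isometry_mag_pinv.
split=> /domainDP[gz m1]; apply/domainDP.
  by move/isometry_GI: gz => gz; split=> //; rewrite -E.
by split; [exact/isometry_GI|rewrite E].
Qed.

End IsometryJordan.

Section Backward.
Variables (R : realType) (H : hilbertType R) (A : powerAlgebra H).
Implicit Types (a b z : A).

Lemma domainD_open a : domainD A a ->
  exists2 e : R, 0 < e & forall b, mag (b - a) < e -> domainD A b.
Proof.
move=> /domainDP[ga a1]; have [e e0 he] := GI_open ga.
have [pd _] := pinv_diff (GI_has_inverse ga).
have r0 : 0 < (1 - mag (pinv a)) / 2 by rewrite divr_gt0// subr_gt0.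
have [d d0 hd] := (continuousP_mag _ _).1 (differentiable_continuous pd) _ r0.
exists (Num.min e d); first by rewrite lt_min e0.
move=> b; rewrite lt_min => /andP[/he gb /hd bd]; apply/domainDP; split=> //.
have := mag_subl (pinv b) (pinv a); lra.
Qed.

Lemma isometry_biholomorphic (L M : {linear A -> A}) (h : A -> A) :
  cancel L M -> cancel M L -> (forall z, mag (L z) = mag z) -> GI A (L (pa_one A)) ->
  (forall z, domainD A z -> h z = L z) -> biholomorphic (domainD A) (domainD A) h.
Proof.
move=> LK MK Liso gu hL; have hu := GI_has_inverse gu.
have DL z := isometry_domainD LK MK Liso hu gu z.
have Miso z : mag (M z) = mag z by rewrite -Liso MK.
have Ldiff (K : {linear A -> A}) z (Kiso : forall z, mag (K z) = mag z) :=
  (isometry_diff z Kiso).1.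
split.
- move=> x Dx; have [e e0 he] := domainD_open Dx.
  apply: (diff_local e0 _ (Ldiff L x Liso)).1 => y /he Dy.
  by rewrite hL.
- split.
  + by move=> z Dz; rewrite hL//; apply/DL.
  + move=> a b /set_mem Da /set_mem Db; rewrite !hL// => /(congr1 M).
    by rewrite !LK.
  + move=> w Dw; exists (M w); last by rewrite hL ?MK//; apply/DL; rewrite MK.
    by apply/DL; rewrite MK.
- exists M; first by move=> x _; exact: Ldiff.
  by move=> x Dx; rewrite hL// LK.
Qed.

End Backward.

(** * Extension across the non-invertible elements *)

Section FunctionalBounds.
Variables (R : realType) (H : hilbertType R).
Local Notation "''[' x , y ]" := (inner x y).

Variable A : powerAlgebra H.

Definition ipform (x y : H) (T : A) : R[i]^o := '[pa_val T x, y].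
Lemma ipform_is_linear x y : linear (ipform x y).
Proof. by move=> k S T; rewrite /ipform pa_valD pa_valZ bopDE bopZE ipDl ipZl. Qed.
HB.instance Definition _ x y := GRing.isLinear.Build R[i] A R[i]^o _ (ipform x y) (ipform_is_linear x y).

Lemma mag_ipform x y (T : A) : mag (ipform x y T : R[i]) <= mag T * (mag x * mag y).
Proof.
apply: le_trans (ip_CS _ _) _; rewrite mulrA; apply: ler_wpM2r; first exact: mag_ge0.
exact: mag_app.
Qed.

Lemma ipform_diff x y (T : A) : differentiable (ipform x y) T.
Proof.
have [] // := @linear_diff _ _ _ [the {linear A -> R[i]^o} of ipform x y] (mag x * mag y) T.
by move=> S; rewrite mulrC; exact: mag_ipform.
Qed.

End FunctionalBounds.

Section Extension.
Variables (R : realType) (H : hilbertType R) (A : powerAlgebra H).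
Implicit Types (a b Z Y : A).
Local Notation "''[' x , y ]" := (inner x y).
Local Notation I := (pa_one A).

Definition half : A := (2^-1)%:C *: I.

Lemma mag_half : mag half <= 2^-1.
Proof.
rewrite magZ magR ger0_norm ?invr_ge0// ler_piMr ?invr_ge0//.
exact/unitary_mag/unitary_one.
Qed.

Lemma half_ballB : ballB half.
Proof.
split; first by apply: GI_scale; [rewrite -mag_gt0 magR normr_gt0 invr_neq0// pnatr_eq0|exact: GI1].
by apply: le_lt_trans mag_half _; rewrite invf_lt1// ltr1n.
Qed.

Lemma ballB_open a : ballB a ->
  exists2 e : R, 0 < e & forall b, mag (b - a) < e -> ballB b.
Proof.
move=> [ga a1]; have [e e0 he] := GI_open ga.
exists (Num.min e (1 - mag a)); first by rewrite lt_min e0 subr_gt0.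
move=> b; rewrite lt_min => /andP[/he gb b1]; split=> //.
by have := mag_subl b a; lra.
Qed.

Lemma ballB_identity (f g : A -> A) : holo1 f -> holo1 g ->
  (forall Z, ballB Z -> f Z = g Z) -> forall Z, mag Z < 1 -> f Z = g Z.
Proof.
move=> fd gd fg; have [e e0 he] := ballB_open half_ballB.
apply: (ball_identity fd gd half_ballB.2 e0) => Z /he; exact: fg.
Qed.

Hypothesis hA : removable_singularity_property A.

Lemma extend (k : A -> A) (K : R) : (forall Z, ballB Z -> differentiable k Z) ->
  (forall Z, ballB Z -> mag (k Z) <= K) ->
  exists2 f : A -> A, holo1 f & forall Z, ballB Z -> f Z = k Z.
Proof.
move=> kd kK; have [||f fd fk] := hA (h := k).
- by rewrite ballBE.
- rewrite ballBE; exists K%:C; split; first by rewrite realE -[0]/(0%:C) !lecR -realE num_real.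
  move=> M KM Z BZ; apply: le_trans (ltW KM); rewrite magE lecR; exact: kK.
exists f; first by move=> Z Z1; apply: fd; apply/open_unit_ballE.
by move=> Z BZ; apply: fk; rewrite ballBE.
Qed.

(** A value [c] of the numerical form [<f x, y>] beyond the bound valid on
    [ballB A] is omitted there. Then [1 / (<f x, y> - c)] is bounded on [ballB
    A], and an extension of it would have to invert zero. *)
Lemma extend_bound (f : A -> A) : holo1 f -> (forall Z, ballB Z -> mag (f Z) <= 1) ->
  forall Z, mag Z < 1 -> mag (f Z) <= 1.
Proof.
move=> fd f1 Z0 Z01; rewrite pa_mag; apply: mag_le_form => // x y.
rewrite mul1r leNgt; apply/negP => big.
pose a Z : R[i]^o := ipform x y (f Z); pose c : R[i]^o := a Z0.
have ad Z : mag Z < 1 -> differentiable a Z.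
  by move=> Z1; apply: (diff_chain (fd Z Z1) (ipform_diff x y (f Z))).1.
pose N := mag x * mag y.
have N0 : 0 <= N by rewrite mulr_ge0 ?mag_ge0.
have aB Z : ballB Z -> mag (a Z : R[i]) <= N.
  move=> BZ; apply: le_trans (mag_ipform _ _ _) _; rewrite ler_piMl//; exact: f1.
have gap : 0 < mag (c : R[i]) - N by rewrite subr_gt0.
have acB Z : ballB Z -> mag (c : R[i]) - N <= mag (a Z - c : R[i]).
  by move=> /aB; have := mag_subl (c : R[i]) (a Z); rewrite (magB (c : R[i])); lra.
have acd Z : mag Z < 1 -> differentiable (fun Z => a Z - c) Z.
  by move=> Z1; apply: differentiableB; [exact: ad|exact: ex_diff].
have ac0 Z : ballB Z -> a Z - c != 0.
  by move=> /acB h; rewrite -mag_gt0; exact: lt_le_trans h.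
pose phi Z : A := (a Z - c)^-1 *: I.
have phid Z : ballB Z -> differentiable phi Z.
  move=> BZ; apply: differentiableZl; apply: differentiableV; [exact: acd BZ.2|exact: ac0].
(* The scalar function [1 / (a - c)] is bounded on [ballB A] by the gap
   between [c] and the bound of [a]. *)
have phiK Z : ballB Z -> mag (phi Z) <= (mag (c : R[i]) - N)^-1.
  move=> BZ; rewrite magZ magV -[leRHS]mulr1; apply: ler_pM; rewrite ?invr_ge0 ?mag_ge0//.
    by rewrite lef_pV2 ?posrE ?acB// mag_gt0 ac0.
  exact/unitary_mag/unitary_one.
have [p pd pE] := extend phid phiK.
pose b Z : R[i]^o := ipform x x (p Z).
have bd Z : mag Z < 1 -> differentiable b Z.
  by move=> Z1; apply: (diff_chain (pd Z Z1) (ipform_diff x x (p Z))).1.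
have bE Z : ballB Z -> b Z = (a Z - c)^-1 * (mag x ^+ 2)%:C.
  by move=> BZ; rewrite /b pE// /phi /ipform pa_valZ bopZE ipZl bop1E ipxx.
pose F Z : A := ((a Z - c) * b Z) *: I.
have Fd : holo1 F.
  by move=> Z Z1; apply: differentiableZl; apply: differentiableM; [exact: acd|exact: bd].
have cd : holo1 (fun=> (mag x ^+ 2)%:C *: I) by move=> Z _; exact: ex_diff.
have := ballB_identity Fd cd _ Z01; rewrite /F subrr mul0r scale0r => E.
have {}E : 0 = (mag x ^+ 2)%:C *: I.
  by apply: E => Z BZ; rewrite bE// mulrA divff ?ac0// mul1r.
have : ipform x x (0 : A) = ipform x x ((mag x ^+ 2)%:C *: I) by rewrite -E.
rewrite linear0 /ipform pa_valZ bopZE ipZl bop1E ipxx -rmorphM => /esym/complexI.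
move=> /eqP; rewrite mulf_eq0 orbb expf_eq0 /= mag_eq0 => /eqP x0.
by move: big; rewrite x0 linear0 linear0l !mag0 mul0r ltxx.
Qed.

(** Let [a k] be the coefficients of [<f x, y>], and [N] its bound. The last
    estimate of [taylor_disc] gives [|a k| <= 2 (N - |a 0|)] for positive [k];
    so if [|a 0|] is close to [N], the form is close to a constant on half the
    disc. *)
Lemma disc_max (f : R[i] -> A) (d : R) w : (forall z, mag z < 1 -> mag (f z) <= 1) ->
  (forall z, mag z < 1 -> cdiff f z) -> mag w <= 2^-1 -> mag (f w) <= 1 - d ->
  mag (f 0) <= 1 - d / 3.
Proof.
move=> f1 fd w2 fw; have [c [c1 tl _ c3]] := taylor_disc f1 fd.
have w1 : mag w < 1 by apply: le_lt_trans w2 _; rewrite invf_lt1// ltr1n.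
have c0 := tail_value tl.
have d1 : d <= 1 by have := mag_ge0 (f w); lra.
rewrite pa_mag; apply: mag_le_form => [|x y]; first by lra.
pose N := mag x * mag y; rewrite -/N.
have N0 : 0 <= N by rewrite mulr_ge0 ?mag_ge0.
pose a k : R[i] := '[pa_val (c k) x, y]; rewrite -c0 -/(a 0%N).
have D0 : mag (a 0%N) <= N.
  apply: le_trans (ip_CS _ _) _; apply: ler_wpM2r; first exact: mag_ge0.
  apply: le_trans (mag_app _ _) _; rewrite -pa_mag ler_piMl ?mag_ge0//.
have ak k : mag (a k.+1) <= 2 * (N - mag (a 0%N)).
  have [e e1 eE] := phase_align (2 * a 0%N) (a k.+1).
  have : mag '[pa_val (2 *: c 0%N + (e^*)%C *: c k.+1) x, y] <= 2 * N.
    apply: le_trans (ip_CS _ _) _; rewrite /N mulrA;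
    apply: ler_wpM2r; first exact: mag_ge0.
    apply: le_trans (mag_app _ _) _; apply: ler_wpM2r; first exact: mag_ge0.
    by have := c3 e k e1; rewrite mulr1.
  rewrite pa_valD !pa_valZ bopDE !bopZE ipDl !ipZl eE magM mag_nat.
  lra.
have key m : mag (a 0%N) <= (1 - d) * N + 2 * (N - mag (a 0%N)) + N * (2^-1 ^+ m).
  have := tl m.+1 w w1; rewrite big_ord_recl expr0 scale1r.
  have -> : \sum_(k < m) w ^+ lift ord0 k *: c (lift ord0 k) = \sum_(k < m) w ^+ k.+1 *: c k.+1 by [].
  set S := \sum_(k < m) _ => h.
  have SE : '[pa_val S x, y] = \sum_(k < m) w ^+ k.+1 * a k.+1.
    transitivity (ipform x y S); first by [].
    by rewrite /S linear_sum; apply: eq_bigr => k _; rewrite linearZ.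
  have S2 : mag '[pa_val S x, y] <= 2 * (N - mag (a 0%N)).
    rewrite SE; apply: le_trans (mag_sum _ _ _) _.
    apply: (@le_trans _ _ (\sum_(k < m) 2^-1 ^+ k.+1 * (2 * (N - mag (a 0%N))))).
      apply: ler_sum => k _; rewrite magM magX; apply: ler_pM; rewrite ?exprn_ge0 ?mag_ge0//.
      by rewrite lerXn2r ?nnegrE ?mag_ge0 ?invr_ge0.
    rewrite -mulr_suml half_sum; apply: ler_piMl; first by rewrite mulr_ge0// subr_ge0.
    by rewrite lerBlDr lerDl exprn_ge0// invr_ge0.
  have h2 : mag '[pa_val (f w - (c 0%N + S)) x, y] <= N * (2^-1 ^+ m).
    apply: le_trans (ip_CS _ _) _; rewrite /N mulrAC; apply: ler_wpM2r; first exact: mag_ge0.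
    apply: le_trans (mag_app _ _) _; rewrite mulrC; apply: ler_wpM2l; first exact: mag_ge0.
    rewrite -pa_mag; apply: le_trans h _; rewrite mul1r ler_pdivrMr ?subr_gt0//.
    have h3 : mag w ^+ m <= 2^-1 ^+ m by rewrite lerXn2r ?nnegrE ?mag_ge0 ?invr_ge0.
    have h4 : 0 <= mag w ^+ m by rewrite exprn_ge0// mag_ge0.
    rewrite exprS; have w0 := mag_ge0 w; nra.
  have h3 : mag '[pa_val (f w) x, y] <= (1 - d) * N.
    apply: le_trans (ip_CS _ _) _; rewrite /N mulrA; apply: ler_wpM2r; first exact: mag_ge0.
    by apply: le_trans (mag_app _ _) _; apply: ler_wpM2r; first exact: mag_ge0.
  move: h2; rewrite pa_valB pa_valD bopBE bopDE ipBl ipDl -/(a 0%N).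
  set p := '[pa_val (f w) x, y] in h3 *; set q := '[pa_val S x, y] in S2 * => h2.
  have E : a 0%N = p - q - (p - (a 0%N + q)) by ring.
  have := magD (p - q) (- (p - (a 0%N + q))); rewrite -E magN.
  have := magD p (- q); rewrite magN; lra.
have : mag (a 0%N) - ((1 - d) * N + 2 * (N - mag (a 0%N))) <= 0.
  apply: (@geom_le0 _ _ 2^-1 N) => [|m]; last by have := key m; lra.
  by rewrite invr_ge0 ler0n invf_lt1// ltr1n.
lra.
Qed.

(** By [disc_max] the condition [|f Z| < 1] is locally constant. *)
Lemma strong_max (f : A -> A) : holo1 f -> (forall Z, mag Z < 1 -> mag (f Z) <= 1) ->
  mag (f half) < 1 -> forall Z, mag Z < 1 -> mag (f Z) < 1.
Proof.
move=> fd f1 fh Z Z1; apply: (chain_ball (P := fun Y => mag (f Y) < 1) Z1 half_ballB.2) fh => Y Y1.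
have third (p q : R) : q < 1 -> p <= 1 - (1 - q) / 3 -> p < 1 by lra.
have step (r : R) X1 X2 : 0 < r -> mag X1 <= 1 - r -> mag (X2 - X1) < r / 2 ->
    mag (f X2) < 1 -> mag (f X1) < 1.
  move=> r0 Yr YY f2.
  have [->//|ne] := eqVneq X1 X2.
  have ne' : X2 - X1 != 0 by rewrite subr_eq0 eq_sym.
  have m0 : 0 < mag (X2 - X1) by rewrite mag_gt0.
  have [t [t0 mt Ur]] := rescale r0 ne'.
  have [g1 g2] := holo_bd_line r0 (holo1_bd fd f1 Yr) Ur.
  have := @disc_max (fun k => f (X1 + k *: (t *: (X2 - X1)))) (1 - mag (f X2)) t^-1 g1 g2.
  rewrite scale0r addr0 scalerA mulVf// scale1r (addrC X1) subrK magV mt invf_div.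
  rewrite ler_pdivrMr// mulrC (ltW YY) opprB addrC subrK lexx => /(_ isT isT) h.
  exact: (third _ _ f2 h).
pose r := (1 - mag Y) / 2.
have r0 : 0 < r by rewrite divr_gt0// subr_gt0.
have rE : mag Y = 1 - 2 * r by rewrite /r; field.
exists (r / 2); first by rewrite divr_gt0.
move=> Y' YY; split=> h.
  apply: (step r Y' Y) => //; last by rewrite magB.
  by have := mag_subl Y' Y; lra.
by apply: (step r Y Y') => //; lra.
Qed.

End Extension.

(** * Automorphisms of the ball that preserve the identity component *)

Section BallAutomorphism.
Variables (R : realType) (H : hilbertType R) (A : powerAlgebra H).
Implicit Types (Z : A).

Record ball_auto (f g : A -> A) : Prop := BallAuto {
  auto_holo : holo1 f;
  auto_holo_inv : holo1 g;
  auto_ball : forall Z, mag Z < 1 -> mag (f Z) < 1;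
  auto_ball_inv : forall Z, mag Z < 1 -> mag (g Z) < 1;
  auto_K : forall Z, mag Z < 1 -> g (f Z) = Z;
  auto_K_inv : forall Z, mag Z < 1 -> f (g Z) = Z;
  auto_GI : forall Z, mag Z < 1 -> (GI A (f Z) <-> GI A Z) }.

Lemma ball_auto_sym f g : ball_auto f g -> ball_auto g f.
Proof.
case=> fh gh fb gb fK gK fG; split=> // Z Z1.
by rewrite -fG ?gK//; exact: gb.
Qed.

Hypothesis hA : removable_singularity_property A.

Lemma transport_extend (h : A -> A) : holomorphic_on (domainD A) h ->
  (forall Z, domainD A Z -> domainD A (h Z)) ->
  exists f : A -> A, [/\ holo1 f, (forall Z, mag Z < 1 -> mag (f Z) < 1)
    & forall Z, ballB Z -> f Z = pinv (h (pinv Z))].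
Proof.
move=> hd hD; pose k Z := pinv (h (pinv Z)).
have kB Z : ballB Z -> ballB (k Z) by move=> /pinv_domainD/hD/pinv_ballB.
have kd Z : ballB Z -> differentiable k Z.
  move=> BZ; have DZ := pinv_domainD BZ.
  have d1 := (pinv_diff (GI_has_inverse BZ.1)).1.
  have d2 := (diff_chain d1 (hd _ DZ)).1.
  have /domainDP[g3 _] := hD _ DZ.
  exact: (diff_chain d2 (pinv_diff (GI_has_inverse g3)).1).1.
have k1 Z : ballB Z -> mag (k Z) <= 1 by move=> /kB[_ /ltW].
have [f fd fk] := extend hA kd k1.
exists f; split=> //; apply: strong_max => //.
  by apply: (extend_bound hA fd) => Z BZ; rewrite fk//; exact: k1.
by rewrite fk; [have [] := kB _ (half_ballB A)|exact: half_ballB].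
Qed.

Lemma biholomorphic_ball_auto (h : A -> A) :
  biholomorphic (domainD A) (domainD A) h ->
  exists f g, ball_auto f g /\ forall Z, domainD A Z -> h Z = pinv (f (pinv Z)).
Proof.
move=> [hd [hD _ hsurj] [g gd gh]].
have gD Z : domainD A Z -> domainD A (g Z).
  by move=> /hsurj[W DW <-]; rewrite gh.
have hg Z : domainD A Z -> h (g Z) = Z.
  by move=> /hsurj[W DW <-]; rewrite gh.
have [f [fd f1 fE]] := transport_extend hd hD.
have [f' [fd' f1' fE']] := transport_extend gd gD.
have fB Z : ballB Z -> ballB (f Z).
  by move=> BZ; rewrite fE//; apply/pinv_ballB/hD/pinv_domainD.
have fB' Z : ballB Z -> ballB (f' Z).
  by move=> BZ; rewrite fE'//; apply/pinv_ballB/gD/pinv_domainD.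
have Dinv Z : domainD A Z -> has_inverse Z by move=> [/GI_has_inverse].
have Binv Z : ballB Z -> has_inverse Z by move=> [/GI_has_inverse].
have idd : holo1 (@id A) by move=> Z _; exact: ex_diff.
have ffK Z : mag Z < 1 -> f' (f Z) = Z.
  apply: (ballB_identity _ idd (f := fun Z => f' (f Z))).
    by move=> Y Y1; exact: (diff_chain (fd _ Y1) (fd' _ (f1 _ Y1))).1.
  move=> Y BY; rewrite fE'; last exact: fB.
  have DY := pinv_domainD BY.
  by rewrite fE// pinvK ?gh ?pinvK//; [exact: Binv|exact/Dinv/hD].
have ffK' Z : mag Z < 1 -> f (f' Z) = Z.
  apply: (ballB_identity _ idd (f := fun Z => f (f' Z))).
    by move=> Y Y1; exact: (diff_chain (fd' _ Y1) (fd _ (f1' _ Y1))).1.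
  move=> Y BY; rewrite fE; last exact: fB'.
  have DY := pinv_domainD BY.
  by rewrite fE'// pinvK ?hg ?pinvK//; [exact: Binv|exact/Dinv/gD].
exists f, f'; split; first split=> //.
  move=> Z Z1; split=> [gf|gZ]; last by have [] := fB Z (conj gZ Z1).
  by rewrite -(ffK Z Z1); have [] := fB' (f Z) (conj gf (f1 _ Z1)).
move=> Z DZ; rewrite fE; last exact: pinv_ballB.
by rewrite (pinvK (Dinv _ DZ)) (pinvK (Dinv _ (hD _ DZ))).
Qed.

End BallAutomorphism.

Lemma auto_dK (R : realType) (H : hilbertType R) (A : powerAlgebra H) (f g : A -> A) (Z U : A) :
  ball_auto f g -> mag Z < 1 -> 'd g (f Z) ('d f Z U) = U.
Proof. by case=> fh gh fb _ fK _ _; exact: (cancel_deriv U fh gh fb fK). Qed.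

Section Origin.
Variables (R : realType) (H : hilbertType R) (A : powerAlgebra H).
Local Notation "''[' x , y ]" := (inner x y).
Local Notation I := (pa_one A).
Variables (f g : A -> A) (fg : ball_auto f g).
Implicit Types (Z U : A).

Let m0 : mag (0 : A) < 1. Proof. by rewrite mag0. Qed.
Let fh := auto_holo fg.
Let gh := auto_holo_inv fg.
Let fb := auto_ball fg.
Let gb := auto_ball_inv fg.

(** The velocity at the origin, for [s = 0], of the dilations [1 + s]
    transported by [f], namely of [g ((1 + s) f 0)]. *)
Definition drift : A := 'd g (f 0) (f 0).

(** The complement of [GI A] is closed and stable under scaling, and within
    the ball [f] and [g] preserve it. It therefore contains [t^-1 g ((1 + t s)
    f (t Z))], which tends to [Z + s drift] as [t] tends to zero. *)
Lemma GI_drift_neg s Z : ~ GI A Z -> ~ GI A (Z + s *: drift).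
Proof.
move=> nZ gZ; have [e e0 he] := GI_open gZ.
have f0 : f (0 *: Z) = f 0 by rewrite scale0r.
have h1 : velocity (fun t => t *: Z) Z := velocity_line Z.
have h2 := scaled_velocity s Z (fh m0).
have h3 := transported_velocity s Z (fh m0) (gh (fb m0)).
rewrite (auto_dK _ fg m0) in h3.
have a1 : 0 < 1 - mag (f 0) by rewrite subr_gt0 fb.
have [d1 d10 k1] := velocity_near h1 ltr01.
have [d2 d20 k2] := velocity_near h2 a1.
have g0 : g ((1 + 0 * s) *: f (0 *: Z)) = 0.
  by rewrite mul0r addr0 scale1r f0; exact: (auto_K fg).
have [d3 d30 k3] := velocity_quotient h3 g0 e0.
have s1 : 0 < mag s + 1 by rewrite ltr_wpDl// mag_ge0.
have [t t0] : exists2 t : R[i], t != 0 &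
    [/\ mag t < d1, mag t < d2, mag t < d3 & mag t < (mag s + 1)^-1].
  pose m := Num.min (Num.min d1 d2) (Num.min d3 (mag s + 1)^-1).
  have m00 : 0 < m by rewrite !lt_min d10 d20 d30 invr_gt0.
  have [b1 b2 b3 b4] : [/\ m <= d1, m <= d2, m <= d3 & m <= (mag s + 1)^-1].
    by split; rewrite !ge_min lexx ?orbT.
  clearbody m; have mh : m / 2 < m by rewrite ltr_pdivrMr// mulr_natr mulr2n ltrDl.
  have mt : mag (m / 2)%:C = m / 2 by rewrite magR gtr0_norm// divr_gt0.
  exists (m / 2)%:C; first by rewrite -mag_gt0 mt divr_gt0.
  by rewrite mt; split; apply: lt_le_trans mh _.
move=> [/k1 t1 /k2 t2 /(k3 _ t0) t3 t4].
have c0 : 1 + t * s != 0.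
  apply/eqP => E; have : mag (t * s) = 1.
    have -> : t * s = -1 by rewrite -[LHS](addKr 1) E addr0.
    by rewrite magN mag1.
  move: t4; rewrite magM -[X in _ < X]mul1r ltr_pdivlMr// => t4 E1.
  by have := mag_ge0 t; lra.
rewrite scale0r subr0 in t1; rewrite mul0r addr0 scale1r f0 in t2.
move: (he _ t3) => gw.
have q1 : mag ((1 + t * s) *: f (t *: Z)) < 1.
  by have := mag_subl ((1 + t * s) *: f (t *: Z)) (f 0); lra.
have gg : GI A (g ((1 + t * s) *: f (t *: Z))).
  by have := GI_scale t0 gw; rewrite scalerA divff// scale1r.
have gq := (auto_GI (ball_auto_sym fg) q1).1 gg.
have gf : GI A (f (t *: Z)).
  have := GI_scale (_ : (1 + t * s)^-1 != 0) gq; rewrite scalerA mulVf// scale1r; apply.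
  by rewrite invr_eq0.
have gt := (auto_GI fg t1).1 gf.
apply: nZ; have := GI_scale (_ : t^-1 != 0) gt; rewrite scalerA mulVf// scale1r; apply.
by rewrite invr_eq0.
Qed.

Lemma GI_drift s Z : GI A Z -> GI A (Z + s *: drift).
Proof.
move=> gZ; apply: contrapT => /(@GI_drift_neg (- s)); apply.
by rewrite scaleNr addrK.
Qed.

(** At [w = f (l I)] the map [g] takes the value [l I]. *)
Lemma auto_second_difference : exists r C rho : R,
  [/\ 0 < r < 1, 0 < rho, 0 <= C & forall xi l : R[i], mag xi = 1 -> mag (xi - 1) <= rho -> mag l < r ->
    mag (g (xi *: f (l *: I)) + g ((xi^*)%C *: f (l *: I)) - 2 *: (l *: I)) <= C * mag (xi - 1) ^+ 2].
Proof.
have a1 : 0 < 1 - mag (f 0) by rewrite subr_gt0 fb.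
pose rho := (1 - mag (f 0)) / 2.
have rho0 : 0 < rho by rewrite divr_gt0.
have [d d0 hd] := (continuousP_mag _ _).1 (differentiable_continuous (fh m0)) _ rho0.
exists (Num.min d 2^-1), (rho^-1 + 4 / rho ^+ 2), (rho / 2).
have h2 : (2^-1 : R) < 1 by rewrite invf_lt1// ltr1n.
split.
- rewrite lt_min d0 invr_gt0 ltr0n /=; apply: le_lt_trans h2; by rewrite ge_min lexx orbT.
- by rewrite divr_gt0.
- by rewrite addr_ge0// ?invr_ge0 ?divr_ge0 ?exprn_ge0// ltW.
move=> xi l xi1 xir; rewrite lt_min => /andP[ld lh].
have lI : mag (l *: I) <= mag l.
  by rewrite magZ ler_piMr ?mag_ge0//; exact/unitary_mag/unitary_one.
have lI1 : mag (l *: I) < 1 by apply: le_lt_trans lI (lt_trans lh h2).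
set w := f (l *: I).
have wr : mag w <= 1 - rho.
  have := hd (l *: I); rewrite subr0 => /(_ (le_lt_trans lI ld)).
  by have := mag_subl w (f 0); rewrite /rho -/w; lra.
have w1 : mag w <= 1 by lra.
have gw : g w = l *: I by exact: (auto_K fg).
have gK Z : mag Z < 1 -> mag (g Z) <= 1 by move=> /gb/ltW.
have := second_difference rho0 (holo1_bd gh gK wr) w1 xi1 xir.
by rewrite gw.
Qed.

End Origin.

Section DriftAdjoint.
Variables (R : realType) (H : hilbertType R) (A : powerAlgebra H).
Local Notation "''[' x , y ]" := (inner x y).
Local Notation I := (pa_one A).
Variables (f g : A -> A) (fg : ball_auto f g).
Local Notation v := (drift f g).

Let fh := auto_holo fg.
Let gh := auto_holo_inv fg.
Let fb := auto_ball fg.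
Let gb := auto_ball_inv fg.
Let m0 : mag (0 : A) < 1. Proof. by rewrite mag0. Qed.

(** For [xi = 1] this is [l I]; the coefficients for [xi] near [1] are
    compared with those of that function. *)
Definition radial (xi l : R[i]) : A := g (xi *: f (l *: I)).

Lemma mag_lI (l : R[i]) : mag l < 1 -> mag (l *: I) < 1.
Proof.
by move=> l1; rewrite magZ; apply: le_lt_trans l1; rewrite ler_piMr ?mag_ge0//; exact/unitary_mag/unitary_one.
Qed.

Lemma radial_cdiff xi l : mag xi = 1 -> mag l < 1 -> cdiff (radial xi) l.
Proof.
move=> xi1 l1; have lI := mag_lI l1.
have x1 : mag (xi *: f (l *: I)) < 1 by rewrite magZ xi1 mul1r fb.
have d1 : differentiable (fun Z => xi *: f Z) (l *: I).
  by apply: differentiableZ; exact: fh.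
have d2 := (diff_chain d1 (gh x1)).1.
have E : 0 + l *: I = l *: I by rewrite add0r.
rewrite -E in d2; apply: cdiff_eq (cdiff_line d2) => k.
by rewrite add0r.
Qed.

Lemma radial_le1 xi l : mag xi = 1 -> mag l < 1 -> mag (radial xi l) <= 1.
Proof. by move=> xi1 /mag_lI/fb f1; apply/ltW/gb; rewrite magZ xi1 mul1r. Qed.

Lemma radial_coeffs xi : mag xi = 1 -> exists c0 c1 c2 : A,
  [/\ c0 = g (xi *: f 0),
      forall e, mag e = 1 -> mag (2 *: c1 + e *: c0 + (e^*)%C *: c2) <= 2
    & forall w, mag w < 1 -> mag (radial xi w - (c0 + w *: c1)) <= mag w ^+ 2 / (1 - mag w)].
Proof.
move=> xi1; have [c [_ tl c2 _]] := taylor_disc (fun z => @radial_le1 xi z xi1) (fun z => @radial_cdiff xi z xi1).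
exists (c 0%N), (c 1%N), (c 2); split.
- by rewrite (tail_value tl) /radial scale0r.
- by move=> e e1; have := c2 e e1; rewrite mulr1.
- by move=> w w1; have := tl 2 w w1; rewrite big_ord_recl big_ord1 /= expr0 scale1r expr1 mul1r.
Qed.

(** Let [c0], [c1], [c2] be the first Taylor coefficients of [radial xi], and
    [b1] the first-order one for the conjugate of [xi]. Taking the best phase
    in the third bound of [taylor_disc], the form of [c0] plus the adjoint of
    [c2] is at most [2 (|x| ^ 2 - Re <c1 x, x>)]. As [c1 + b1] differs from [2
    I] by [O(|xi - 1| ^ 2)] and both terms have real parts at most [|x| ^ 2],
    this is of second order, although [c0] itself is of first order. *)
Lemma drift_adjoint_estimate : exists2 K : R, 0 <= K & exists2 rho : R, 0 < rho &
  forall xi, mag xi = 1 -> mag (xi - 1) <= rho ->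
    exists c2 : A, mag (adjoint (pa_val (g (xi *: f 0))) + pa_val c2) <= K * mag (xi - 1) ^+ 2.
Proof.
have [r [C [rho [r01 rho0 C0 sd]]]] := auto_second_difference fg.
have r0 : 0 < r by case/andP: r01.
exists (4 * (C / r)); first by rewrite mulr_ge0// divr_ge0// ltW.
exists rho => // xi xi1 xir.
have xc1 : mag (xi^*)%C = 1 by rewrite mag_conj.
have [c0 [c1 [c2 [E0 pos tl]]]] := radial_coeffs xi1.
have [b0 [b1 [b2 [_ posb tlb]]]] := radial_coeffs xc1.
pose q := C * mag (xi - 1) ^+ 2.
have q0 : 0 <= q by rewrite mulr_ge0// exprn_ge0// mag_ge0.
(* [auto_second_difference] bounds [radial xi l + radial xi' l - 2 l I], with
   [xi'] the conjugate of [xi], and hence its linear coefficient. *)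
have small : r * mag (c1 + b1 - 2 *: I) <= q.
  apply: (@linear_coef_bound _ _ (fun w => radial xi w + radial (xi^*)%C w - 2 *: (w *: I)) (c0 + b0) _ 2 q r r01) => //.
  - move=> w w1; apply: cdiffB; first by apply: cdiffD; exact: radial_cdiff.
    apply: cdiffZ; first exact: cdiff_cst.
    apply: cdiffZ; [exact: cdiff_id|exact: cdiff_cst].
  - move=> w w1.
    have -> : radial xi w + radial (xi^*)%C w - 2 *: (w *: I) - (c0 + b0 + w *: (c1 + b1 - 2 *: I)) =
        (radial xi w - (c0 + w *: c1)) + (radial (xi^*)%C w - (b0 + w *: b1)).
      rewrite scalerBr scalerDr (scalerA w) (mulrC w) -(scalerA 2).
      move: (radial _ _) (radial _ _) (2 *: _) (w *: c1) (w *: b1) => p p' s t t'.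
      have aux (P Q S T : A) : P - S - (Q + (T - S)) = P - (Q + T).
        by rewrite addrA opprB addrA subrK.
      by rewrite aux [RHS]addrACA -opprD (addrACA c0).
    apply: le_trans (magD _ _) _; have := tl w w1; have := tlb w w1.
    by rewrite -mulrA; lra.
  - by move=> w wr; exact: sd.
exists c2.
set S := pa_val c0 + adjoint (pa_val c2).
have Squad x : mag '[S x, x] <= 2 * (C / r * mag (xi - 1) ^+ 2) * mag x ^+ 2.
  pose N := mag x ^+ 2.
  have N0 : 0 <= N by rewrite exprn_ge0// mag_ge0.
  have re_le (T : A) (B : R) : mag T <= B -> complex.Re '[pa_val T x, x] <= B * N.
    move=> TB; apply: le_trans (ler_norm _) _; apply: le_trans (mag_Re _) _.
    apply: le_trans (ip_CS _ _) _; rewrite /N expr2 mulrA; apply: ler_wpM2r; first exact: mag_ge0.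
    apply: le_trans (mag_app _ _) _; apply: ler_wpM2r; first exact: mag_ge0.
    by rewrite -pa_mag.
  pose t := '[pa_val c0 x, x]; pose p := '[pa_val c2 x, x].
  have comb (a0 a1 a2 : A) e e' : '[pa_val (2 *: a1 + e *: a0 + e' *: a2) x, x] =
      2 * '[pa_val a1 x, x] + e * '[pa_val a0 x, x] + e' * '[pa_val a2 x, x].
    by rewrite !pa_valD !pa_valZ !bopDE !bopZE !ipDl !ipZl.
  (* Average the bound over the phases [1] and [-1]. *)
  have B1 : complex.Re '[pa_val b1 x, x] <= N.
    have h1 := re_le _ _ (posb 1 (mag1 R)).
    have m1 : mag (-1 : R[i]) = 1 by rewrite magN mag1.
    have h2 := re_le _ _ (posb (-1) m1).
    have cm1 : ((-1 : R[i])^*)%C = -1 by apply: complexP2; rewrite /= ?oppr0.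
    rewrite comb conjc_one !mul1r in h1; rewrite comb cm1 !mulN1r in h2; move: h1 h2.
    case: '[pa_val b1 x, x] => u1 u2; case: '[pa_val b0 x, x] => v1 v2; case: '[pa_val b2 x, x] => w1 w2 /=.
    lra.
  have B2 : 2 * N - complex.Re '[pa_val c1 x, x] - complex.Re '[pa_val b1 x, x] <= C / r * mag (xi - 1) ^+ 2 * N.
    have : mag (- (c1 + b1 - 2 *: I)) <= C / r * mag (xi - 1) ^+ 2.
      by rewrite magN mulrAC ler_pdivlMr// mulrC.
    move=> /re_le; rewrite pa_valN pa_valB pa_valD pa_valZ bopNE bopBE bopDE bopZE bop1E.
    rewrite -scaleN1r ipZl ipBl ipDl ipZl ipxx -/N.
    case: '[pa_val b1 x, x] => u1 u2; case: '[pa_val c1 x, x] => v1 v2 /=.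
    lra.
  have [e e1 eE] := phase (t + (p^*)%C).
  have SE : '[S x, x] = t + (p^*)%C.
    by rewrite /S bopDE ipDl -/t adjP' [X in _ + X]ipC.
  have h := re_le _ _ (pos e e1).
  have k2 : complex.Re (e * t + (e^*)%C * p) = mag (t + (p^*)%C).
    have -> : mag (t + (p^*)%C) = complex.Re (e * (t + (p^*)%C)) by rewrite eE.
    by case: (e) => a b; case: (t) => c d; case: (p) => m n /=; ring.
  rewrite comb -/t -/p -addrA raddfD /= k2 -SE in h.
  move: h B1 B2; case: '[pa_val c1 x, x] => u1 u2 /=; rewrite -/N.
  move: (C / r * _) => eps; lra.
have S4 : mag S <= 4 * (C / r) * mag (xi - 1) ^+ 2.
  have := mag_le_quad _ Squad; rewrite !mulrA (_ : 2 * 2 = 4 :> R); last by ring.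
  by apply; rewrite !mulr_ge0 ?invr_ge0 ?exprn_ge0 ?mag_ge0// ltW.
apply: le_trans S4; rewrite -E0.
have -> : adjoint (pa_val c0) + pa_val c2 = adjoint S by rewrite /S adjD adjK.
exact: mag_adj.
Qed.

End DriftAdjoint.

Section DriftZero.
Variables (R : realType) (H : hilbertType R) (A : powerAlgebra H).
Local Notation I := (pa_one A).
Variables (f g : A -> A) (fg : ball_auto f g).
Local Notation v := (drift f g).
Let m0 : mag (0 : A) < 1. Proof. by rewrite mag0. Qed.
Let f01 : mag (f 0) < 1 := auto_ball fg m0.

(** Divided by the conjugate of [xi - 1], the estimate presents the adjoint of
    the derivative of [xi |-> g (xi f 0)] at [1] as a limit of elements of the
    algebra, which is closed. *)
Lemma drift_adjoint_in : pa_set A (adjoint (pa_val v)).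
Proof.
apply: contrapT => /pa_far[e e0 far].
have [K K0 [rho rho0 est]] := drift_adjoint_estimate fg.
have e2 : 0 < e / 2 by rewrite divr_gt0.
have [d d0 hd] := diff_eps (auto_holo_inv fg f01) e2.
have K1 : 0 < K + 1 by rewrite ltr_wpDl.
pose m := Num.min (Num.min rho d) (e / (4 * (K + 1))).
have mp : 0 < m by rewrite !lt_min rho0 d0 divr_gt0// mulr_gt0.
have [n1 n2 n3] : [/\ m <= rho, m <= d & m * (4 * (K + 1)) <= e].
  by rewrite -ler_pdivlMr ?mulr_gt0//; split; rewrite !ge_min lexx ?orbT.
clearbody m; have [xi [xi1 xin xim]] := circle_near1 mp.
have [c2 hc] := est xi xi1 (le_trans (ltW xim) n1).
have z0 : xi - 1 != 0 by rewrite subr_eq0.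
set z := xi - 1 in hc z0 xim.
have mz : 0 < mag z by rewrite mag_gt0.
have zc0 : (z^*)%C != 0 by rewrite -mag_gt0 mag_conj.
(* The element of the algebra that is close to the adjoint of the drift. *)
pose w : A := - ((z^*)%C^-1 *: c2).
apply: (far (pa_val w)); last exact: pa_in.
have za : mag (z *: f 0) < d.
  rewrite magZ; apply: le_lt_trans (lt_le_trans xim n2).
  by rewrite ler_piMr ?mag_ge0// ltW.
have gE : g (f 0) = 0 := auto_K fg m0.
have h1 : mag (g (xi *: f 0) - z *: v) <= e / 2 * mag z.
  have := hd _ za.
  have -> : f 0 + z *: f 0 = xi *: f 0 by rewrite -[X in X + _]scale1r -scalerDl /z addrC subrK.
  rewrite gE subr0 [X in _ - X]linearZ -/(drift f g) => /le_trans; apply.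
  by rewrite magZ; apply: ler_wpM2l; [exact: ltW|rewrite ler_piMr ?mag_ge0// ltW].
have h2 : mag (adjoint (pa_val (g (xi *: f 0) - z *: v))) <= e / 2 * mag z.
  by apply: le_trans (mag_adj _) h1.
rewrite pa_valB pa_valZ adjB adjZ in h2.
have E : (z^*)%C *: (pa_val w - adjoint (pa_val v)) =
    (adjoint (pa_val (g (xi *: f 0))) - (z^*)%C *: adjoint (pa_val v)) -
    (adjoint (pa_val (g (xi *: f 0))) + pa_val c2).
  rewrite scalerBr pa_valN pa_valZ scalerN scalerA divff// scale1r.
  by rewrite opprD [RHS]addrACA subrr add0r addrC.
have : mag ((z^*)%C *: (pa_val w - adjoint (pa_val v))) < e * mag z.
  rewrite E; apply: le_lt_trans (magD _ _) _; rewrite magN.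
  have : K * mag z ^+ 2 <= e / 4 * mag z.
    rewrite expr2 mulrA; apply: ler_wpM2r; first exact: mag_ge0.
    have := mulr_ge0 K0 (mag_ge0 z); have : (K + 1) * mag z <= (K + 1) * m by rewrite ler_pM2l// ltW.
    lra.
  have : 0 < e * mag z by rewrite mulr_gt0.
  lra.
by rewrite magZ mag_conj mulrC ltr_pM2r.
Qed.

Let w : A := pa_mk drift_adjoint_in.

Let wE : pa_val w = adjoint (pa_val v). Proof. by []. Qed.

(** Taking adjoints in [1 + c v] preserves invertibility along the segment
    from the identity. *)
Lemma GI_one_adjoint b : GI A (I + b *: w).
Proof.
apply: GI_segment (GI1 A) _ => t _; pose c : R[i] := ((t%:C * b)^*)%C.
have [W [h1 h2]] := GI_inv (GI_drift fg c (GI1 A)).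
have E : pa_val (I + t%:C *: (b *: w)) = adjoint (pa_val (I + c *: v)).
  by rewrite !pa_valD !pa_valZ adjD adjZ /c conjcK wE adj1 scalerA.
by apply: (@invertible_of _ _ _ _ (adjoint W)); rewrite E; split; rewrite -adjM ?h1 ?h2 adj1.
Qed.

Lemma drift_combination a b W : W = a *: pa_val v + b *: adjoint (pa_val v) ->
  adjoint W = W -> W = 0.
Proof.
move=> WE Wsa; apply: (selfadjoint_eq0 Wsa) => s.
have [X hX] := GI_inv (GI_drift fg (s%:C * a) (GI_one_adjoint (s%:C * b))).
exists X; move: hX; rewrite !pa_valD !pa_valZ WE scalerDr !scalerA wE.
by rewrite -addrA [X in 1 + X]addrC.
Qed.

(** The self-adjoint combinations [v + v^*] and [i v - i v^*] vanish. *)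
Lemma drift_eq0 : v = 0.
Proof.
have h1 : pa_val v + adjoint (pa_val v) = 0.
  by apply: (@drift_combination 1 1); rewrite ?scale1r// adjD adjK addrC.
have ci : (('i : R[i])^*)%C = - 'i by apply: complexP2 => /=; rewrite ?oppr0.
have h2 : 'i *: pa_val v - 'i *: adjoint (pa_val v) = 0.
  apply: (@drift_combination 'i (- 'i)); first by rewrite scaleNr.
  by rewrite adjB !adjZ adjK ci !scaleNr opprK addrC.
apply: pa_inj; rewrite pa_val0.
have i0 : ('i : R[i]) != 0 by rewrite -mag_gt0 magi.
have h3 : pa_val v - adjoint (pa_val v) = 0.
  by apply: (scalerI i0); rewrite scalerBr h2 scaler0.
have two : (2 : R[i]) != 0 by rewrite pnatr_eq0.
apply: (scalerI two); rewrite scaler0 scaler_nat mulr2n -[RHS](addr0 0) -{1}h1 -h3.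
by rewrite addrACA subrr addr0.
Qed.

(** [f 0] is the image of the drift under the derivative of [f] at the origin. *)
Lemma auto_fix0 : f 0 = 0.
Proof.
have := auto_dK (f 0) (ball_auto_sym fg) f01.
by rewrite -/(drift f g) drift_eq0 linear0.
Qed.

End DriftZero.

(** * Biholomorphic maps of the domain *)

Section Linear.
Variables (R : realType) (H : hilbertType R) (A : powerAlgebra H).

Lemma auto_linear (f g : A -> A) : ball_auto f g ->
  exists L : {linear A -> A}, [/\ forall Z, mag (L Z) = mag Z,
    forall W, exists Z, L Z = W & forall Z, mag Z < 1 -> f Z = L Z].
Proof.
move=> fg; have f0 := auto_fix0 fg; have g0 := auto_fix0 (ball_auto_sym fg).
by case: fg => fh gh fb gb fK gK _; exact: auto_fix0_linear fh gh fb gb fK gK f0 g0.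
Qed.

(** If [f] is the restriction of the isometry [L], then [h Z] is the inverse
    of [L (Z^-1)], which [isometry_pinv] computes. *)
Lemma biholomorphic_isometry (h : A -> A) : removable_singularity_property A ->
  biholomorphic (domainD A) (domainD A) h ->
  exists L : {linear A -> A},
    [/\ (forall Z : A, mag (L Z) = mag Z), (forall W : A, exists Z : A, L Z = W),
        GI A (L (pa_one A)) & (forall Z : A, domainD A Z -> h Z = L Z)].
Proof.
move=> hA /(biholomorphic_ball_auto hA)[f [g [fg hE]]].
have [L [Liso Lonto fL]] := auto_linear fg.
have [M [LK MK]] := linear_isometry_inverse Liso Lonto.
(* The identity need not lie in the open ball, where [f] agrees with [L]; half
   of it does. *)
have gu : GI A (L (pa_one A)).
  have hB := half_ballB A.
  have : GI A (f (half A)) by apply/(auto_GI fg hB.2); exact: hB.1.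
  rewrite fL; last exact: hB.2.
  rewrite linearZ /= => /(@GI_scale _ _ _ 2); rewrite scalerA.
  have -> : 2 * (2^-1)%:C = 1 :> R[i].
    by rewrite -(rmorph_nat (real_complex R)) -rmorphM divff ?rmorph1// pnatr_eq0.
  by rewrite scale1r pnatr_eq0; exact.
set u := L (pa_one A) in gu *; have hu := GI_has_inverse gu.
have uu : unitary u := isometry_unitary LK MK Liso hu.
have uu' := unitary_pinv uu.
pose K : {linear A -> A} := [the {linear A -> A} of sandwich (pinv u) \o L].
have KE Z : K Z = sandwich (pinv u) (L Z) by [].
exists K; split.
- by move=> Z; rewrite KE mag_sandwich_unitary.
- move=> W; exists (M (sandwich u W)); rewrite KE MK.
  exact: sandwichK'.
- rewrite KE -/u (_ : sandwich (pinv u) u = pinv u); first exact: GI_pinv.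
  by apply: pa_inj; rewrite sandwichE (pinvP hu).2 mul1r.
- move=> Z DZ; have [gZ Z1] := (domainDP Z).1 DZ.
  have hZ := GI_has_inverse gZ.
  rewrite hE// fL// KE; apply: pinv_unique.
  have := isometry_pinv LK MK Liso hu (has_inverse_pinv hZ).
  by rewrite pinvK.
Qed.

End Linear.

Theorem theorem9 (R : realType) (H : hilbertType R) (A : powerAlgebra H)
    (hA : removable_singularity_property A) (h : A -> A) :
  biholomorphic (domainD A) (domainD A) h <->
  exists L : {linear A -> A},
    [/\ (forall Z : A, `|L Z| = `|Z|),
        (forall W : A, exists Z : A, L Z = W),
        GI A (L (pa_one A))
      & (forall Z : A, domainD A Z -> h Z = L Z)].
Proof.
split.
  move=> /(biholomorphic_isometry hA)[L [Liso Lonto gu hL]].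
  by exists L; split=> // Z; rewrite !magE Liso.
move=> [L [Liso Lonto gu hL]].
have miso Z : mag (L Z) = mag Z by rewrite /mag Liso.
have [M [LK MK]] := linear_isometry_inverse miso Lonto.
exact: (isometry_biholomorphic LK MK miso gu hL).
Qed.
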